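(* Let $k\in\mathbb N$, $\nu>0$ and $f\in\mathcal B_k^{2+\nu}$ with domain $I=[0,1)$. Then there are constants $C=C(f)>0$ and $0<\lambda=\lambda(k)<1$ such that for every $n\ge0$ and every $\alpha\in\mathcal A$, $$\Big|N_\alpha^n-\frac{\sum_{i=1}^{q_\alpha^n}|f^i(I_\alpha^n)|}{|I|}\int_I\frac{D^2f(x)}{Df(x)}\,dx\Big|\le C\lambda^{\sqrt n},\qquad N_\alpha^n=\int_{I_\alpha^n}\frac{D^2R^n(f)(x)}{DR^n(f)(x)}dx.$$ In particular, if $\int_{I}\frac{D^2f(x)}{Df(x)}dx=0$ then $|N_\alpha^n|\le C\lambda^{\sqrt n}$.
   Context: Let $\mathcal A$ be a finite alphabet with $d\ge 2$ elements and $I$ a bounded interval. A generalized interval exchange map (g.i.e.m.) is a bijection $f:I\to I$ together with a partition $\{I_\alpha\}_{\alpha\in\mathcal A}$ of $I$ into nonempty intervals of the form $[a,b)$ such that each $f|_{I_\alpha}$ is an orientation-preserving homeomorphism onto an interval. For intervals $J,U$ write $J<U$ if their interiors are disjoint and $x<y$ for all $x\in J$, $y\in U$. The combinatorial data of $f$ are the bijections $\pi_0,\pi_1:\mathcal A\to\{1,\dots,d\}$ with $I_\alpha<I_\beta\iff\pi_0(\alpha)<\pi_0(\beta)$ and $f(I_\alpha)<f(I_\beta)\iff\pi_1(\alpha)<\pi_1(\beta)$; they are assumed irreducible: $\pi_1\circ\pi_0^{-1}(\{1,\dots,j\})\neq\{1,\dots,j\}$ for $1\le j<d$. Rauzy–Veech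 renormalization: let $\alpha(\varepsilon)=\pi_\varepsilon^{-1}(d)$, $\varepsilon\in\{0,1\}$. If $|I_{\alpha(0)}|>|f(I_{\alpha(1)})|$, $f$ has type 0, winner $\alpha(0)$, loser $\alpha(1)$, and $I^1=I\setminus f(I_{\alpha(1)})$, $I^1_\alpha=I_\alpha$ for $\alpha\ne\alpha(0)$, $I^1_{\alpha(0)}=I_{\alpha(0)}\setminus f(I_{\alpha(1)})$. If $|I_{\alpha(0)}|<|f(I_{\alpha(1)})|$, $f$ has type 1, winner $\alpha(1)$, loser $\alpha(0)$, and $I^1=I\setminus I_{\alpha(0)}$, $I^1_\alpha=I_\alpha$ for $\alpha\ne\alpha(0),\alpha(1)$, $I^1_{\alpha(1)}=f^{-1}(f(I_{\alpha(1)})\setminus I_{\alpha(0)})$, $I^1_{\alpha(0)}=I_{\alpha(1)}\setminus I^1_{\alpha(1)}$. The renormalization $R(f):I^1\to I^1$ is the first return map of $f$ to $I^1$, regarded as a g.i.e.m. with partition $\{I^1_\alpha\}$. $f$ is infinitely renormalizable if $R^n(f)$ is defined for all $n$. Write $f_n=R^n(f)$ ($f_0=f$), $I^n$ its domain ($I^0=I$), $\{I^n_\alpha\}$ its partition, $\varepsilon_n$ its type, $\alpha_n(\varepsilon_n)$ and $\alpha_n(1-\varepsilon_n)$ its winner and loser; $q^n_\alpha$ is the first return time of $I^n_\alpha$ to $I^n$, so $f_n|_{I^n_\alpha}=f^{q^n_\alpha}$. $f$ has $k$-bounded combinatorics if it is infinitely renormalizable and for each $n$ and $\beta,\gamma\in\mathcal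 A$ there exist $n_1,p\ge 0$ with $|n-n_1|<k$, $|n-n_1-p|<k$, $\alpha_{n_1}(\varepsilon_{n_1})=\beta$, $\alpha_{n_1+p}(1-\varepsilon_{n_1+p})=\gamma$ and $\alpha_{n_1+i}(1-\varepsilon_{n_1+i})=\alpha_{n_1+i+1}(\varepsilon_{n_1+i+1})$ for $0\le i<p$. $f$ has no connection if $f^m(\partial I_\alpha)\ne\partial I_\beta$ for all $m\ge1$ and $\alpha,\beta$ with $\pi_0(\beta)\ne1$, where $\partial[a,b)=\{a\}$. $f$ has genus one if it has at most two discontinuities. $\mathcal B_k^{2+\nu}$ is the set of g.i.e.m. $f$ such that (i) each $f|_{I_\alpha}$ extends to $\overline{I_\alpha}$ as an orientation-preserving $C^{2+\nu}$ diffeomorphism onto its image; (ii) $f$ has $k$-bounded combinatorics; (iii) $f$ has genus one and no connection. The integral $\int_I \frac{D^2f}{Df}$ means $\sum_{\alpha}\int_{I_\alpha}\frac{D^2f}{Df}$. *)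

(* Defs.v *)
From Stdlib Require Import Reals Lra Lia List Classical ClassicalEpsilon.
Import ListNotations.
Open Scope R_scope.

(* Alphabet: the letters are the natural numbers alpha < d.            *)
(* A generalized interval exchange map (g.i.e.m.) is recorded as:      *)
(*   domain [glo, ghi), the map gmap, and for each letter alpha the    *)
(*   partition interval I_alpha = [fst (gpart alpha), snd (gpart alpha)). *)
(* Values of gmap outside the domain are irrelevant.                   *)
Record giem := mkGiem {
  glo : R; ghi : R; gmap : R -> R; gpart : nat -> R * R }.

Definition inI (g : giem) (x : R) : Prop := glo g <= x < ghi g.
Definition inP (g : giem) (a : nat) (x : R) : Prop :=
  fst (gpart g a) <= x < snd (gpart g a).
Definition img (g : giem) (a : nat) (y : R) : Prop :=
  exists x, inP g a x /\ y = gmap g x.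

Definition decP (P : Prop) : bool :=
  if excluded_middle_informative P then true else false.

(* J < U : interiors disjoint and x < y for all x in J, y in U
   (for the half-open intervals used here, the second clause implies the first) *)
Definition Iless (J U : R -> Prop) : Prop :=
  forall x y, J x -> U y -> x < y.

Definition countL (d : nat) (P : nat -> Prop) : nat :=
  length (filter (fun b => decP (P b)) (seq 0 d)).

Definition pi0 (d : nat) (g : giem) (a : nat) : nat :=
  S (countL d (fun b => Iless (inP g b) (inP g a))).
Definition pi1 (d : nat) (g : giem) (a : nat) : nat :=
  S (countL d (fun b => Iless (img g b) (img g a))).
Definition pi (d : nat) (eps : bool) (g : giem) (a : nat) : nat :=
  if eps then pi1 d g a else pi0 d g a.

Definition is_giem (d : nat) (g : giem) : Prop :=
  glo g < ghi g /\
  (forall a, (a < d)%nat ->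
     fst (gpart g a) < snd (gpart g a) /\
     glo g <= fst (gpart g a) /\ snd (gpart g a) <= ghi g) /\
  (forall a b, (a < d)%nat -> (b < d)%nat -> a <> b ->
     forall x, ~ (inP g a x /\ inP g b x)) /\
  (forall x, inI g x -> exists a, (a < d)%nat /\ inP g a x) /\
  (forall x, inI g x -> inI g (gmap g x)) /\
  (forall x y, inI g x -> inI g y -> gmap g x = gmap g y -> x = y) /\
  (forall y, inI g y -> exists x, inI g x /\ gmap g x = y) /\
  (* each branch: orientation-preserving homeomorphism onto an interval
     (continuous and strictly increasing on the interval I_alpha) *)
  (forall a, (a < d)%nat ->
     (forall x y, inP g a x -> inP g a y -> x < y -> gmap g x < gmap g y) /\
     (forall x, inP g a x -> continue_in (gmap g) (inP g a) x)).

Definition irreducible (d : nat) (g : giem) : Prop :=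
  forall j, (1 <= j)%nat -> (j < d)%nat ->
    ~ (forall m, (exists a, (a < d)%nat /\ (1 <= pi0 d g a <= j)%nat /\ pi1 d g a = m)
                 <-> (1 <= m <= j)%nat).

Definition Ilen (S : R -> Prop) (L : R) : Prop :=
  exists u v, u <= v /\ L = v - u /\
    (forall y, S y -> u <= y <= v) /\ (forall y, u < y < v -> S y).

(* RV_data d g eps a0 a1 : a0 = alpha(0), a1 = alpha(1), and g has type eps
   (false = type 0, true = type 1). *)
Definition RV_data (d : nat) (g : giem) (eps : bool) (a0 a1 : nat) : Prop :=
  (a0 < d)%nat /\ pi0 d g a0 = d /\ (a1 < d)%nat /\ pi1 d g a1 = d /\
  exists L, Ilen (img g a1) L /\
    let len0 := snd (gpart g a0) - fst (gpart g a0) in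
    if eps then len0 < L else L < len0.

Definition winner (eps : bool) (a0 a1 : nat) : nat := if eps then a1 else a0.
Definition loser  (eps : bool) (a0 a1 : nat) : nat := if eps then a0 else a1.

Definition iterf (F : R -> R) (m : nat) (x : R) : R := Nat.iter m F x.

Definition RV_step (d : nat) (g g' : giem) : Prop :=
  exists eps a0 a1, RV_data d g eps a0 a1 /\
  (if eps then
     (forall x, inI g' x <-> inI g x /\ ~ inP g a0 x) /\
     (forall a, (a < d)%nat -> a <> a0 -> a <> a1 -> gpart g' a = gpart g a) /\
     (forall x, inP g' a1 x <->
                  inI g x /\ img g a1 (gmap g x) /\ ~ inP g a0 (gmap g x)) /\
     (forall x, inP g' a0 x <-> inP g a1 x /\ ~ inP g' a1 x)
   else
     (forall x, inI g' x <-> inI g x /\ ~ img g a1 x) /\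
     (forall a, (a < d)%nat -> a <> a0 -> gpart g' a = gpart g a) /\
     (forall x, inP g' a0 x <-> inP g a0 x /\ ~ img g a1 x)) /\
  (forall x, inI g' x ->
     exists m, (1 <= m)%nat /\ inI g' (iterf (gmap g) m x) /\
       (forall j, (1 <= j)%nat -> (j < m)%nat -> ~ inI g' (iterf (gmap g) j x)) /\
       gmap g' x = iterf (gmap g) m x).

(* k-bounded combinatorics, for the sequence fs n = R^n(f) *)
Definition win_at (d : nat) (g : giem) (b : nat) : Prop :=
  exists eps a0 a1, RV_data d g eps a0 a1 /\ winner eps a0 a1 = b.
Definition los_at (d : nat) (g : giem) (b : nat) : Prop :=
  exists eps a0 a1, RV_data d g eps a0 a1 /\ loser eps a0 a1 = b.

Definition k_bounded (d k : nat) (fs : nat -> giem) : Prop :=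
  forall n b c, (b < d)%nat -> (c < d)%nat ->
    exists n1 p,
      (n < n1 + k)%nat /\ (n1 < n + k)%nat /\          (* |n - n1| < k *)
      (n < n1 + p + k)%nat /\ (n1 + p < n + k)%nat /\  (* |n - n1 - p| < k *)
      win_at d (fs n1) b /\ los_at d (fs (n1 + p)%nat) c /\
      (forall i, (i < p)%nat -> forall e,
         los_at d (fs (n1 + i)%nat) e <-> win_at d (fs (n1 + i + 1)%nat) e).

(* no connection; boundary of [a,b) is {a} *)
Definition no_connection (d : nat) (g : giem) : Prop :=
  forall m a b, (1 <= m)%nat -> (a < d)%nat -> (b < d)%nat -> pi0 d g b <> 1%nat ->
    iterf (gmap g) m (fst (gpart g a)) <> fst (gpart g b).

Definition discont (g : giem) (x : R) : Prop :=
  inI g x /\ ~ continue_in (gmap g) (inI g) x.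
Definition genus_one (g : giem) : Prop :=
  forall x y z, discont g x -> discont g y -> discont g z ->
    x = y \/ y = z \/ x = z.

(* (i): each branch extends to the closure as an orientation-preserving
   C^{2+nu} diffeomorphism; Hoelder exponent min(nu,1) *)
Definition C2nu_branches (d : nat) (nu : R) (g : giem) : Prop :=
  forall a, (a < d)%nat ->
    let lo := fst (gpart g a) in let hi := snd (gpart g a) in
    exists h h1 h2 : R -> R,
      (forall x, lo <= x < hi -> h x = gmap g x) /\
      (forall x, lo <= x <= hi ->
         derivable_pt_lim h x (h1 x) /\ derivable_pt_lim h1 x (h2 x) /\ 0 < h1 x) /\
      exists K, forall x y, lo <= x <= hi -> lo <= y <= hi -> x <> y ->
        Rabs (h2 x - h2 y) <= K * Rpower (Rabs (x - y)) (Rmin nu 1).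

(* IntD2D phi lo hi V : V = int_{[lo,hi)} D^2 phi / D phi  (derivatives of phi on
   the open interval, extended continuously to the closed interval) *)
Definition IntD2D (phi : R -> R) (lo hi V : R) : Prop :=
  exists psi1 psi2 : R -> R,
    (forall x, lo < x < hi ->
       derivable_pt_lim phi x (psi1 x) /\ derivable_pt_lim psi1 x (psi2 x)) /\
    (forall x, lo <= x <= hi ->
       continue_in psi1 (fun y => lo <= y <= hi) x /\
       continue_in psi2 (fun y => lo <= y <= hi) x /\ psi1 x <> 0) /\
    exists pr : Riemann_integrable (fun x => psi2 x / psi1 x) lo hi,
      RiemannInt pr = V.

Fixpoint sumR (n : nat) (F : nat -> R) : R :=
  match n with O => 0 | S m => sumR m F + F m end.

Definition total_D2D (d : nat) (g : giem) (T : R) : Prop :=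
  exists Ts : nat -> R,
    (forall a, (a < d)%nat -> IntD2D (gmap g) (fst (gpart g a)) (snd (gpart g a)) (Ts a)) /\
    T = sumR d Ts.

Definition return_time (F : R -> R) (gn : giem) (a q : nat) : Prop :=
  (1 <= q)%nat /\
  forall x, inP gn a x ->
    inI gn (iterf F q x) /\
    forall m, (1 <= m)%nat -> (m < q)%nat -> ~ inI gn (iterf F m x).

Definition sum_tower_len (F : R -> R) (gn : giem) (a q : nat) (S : R) : Prop :=
  exists L : nat -> R,
    (forall i, (1 <= i <= q)%nat ->
       Ilen (fun y => exists x, inP gn a x /\ y = iterf F i x) (L i)) /\
    S = sumR q (fun i => L (Datatypes.S i)).

(* Main.v *)
(** Write [H], [U = ln DH] and [E] for a branch of [R^n f], its log-derivative and the Birkhoff sum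
    of the identity along the corresponding tower. The nonlinearity of the branch is the increment of
    [U], the measure of the tower is the increment of [E], and both totals over the alphabet are
    conserved by renormalization. So it suffices that the ratio [r = U' / E'] becomes constant.

    One step replaces [r] on the loser by a weighted average of [r] on the two letters, and the
    distortion of each branch is controlled by the increment of [E], which is at most [1]. If all
    branches have bounded slopes, bounded combinatorics makes the weights comparable and positive over
    a bounded window, and a cone argument for positive densities with Hoelder logarithm, in which
    constants are repeatedly subtracted, shows that the oscillation of [r] decays exponentially in [n].
    This beats [lam ^ sqrt n] for every [lam], in particular for [1 / 2].

    The slope bound uses genus one: the letters split into three blocks [A], [B], [C], ordered [ABC]
    in the domain and [CBA] in the image, and the jumps of the log-derivative across the boundary
    points are conserved. Hence [U] is close to [u] on [A], [v] on [C] and [u + v] on [B]. Because a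
    branch must have slope at least [1] somewhere and at most [1] somewhere, [u] and [v] have opposite
    signs, and such a pair is expanded when followed backwards to level [0]; so it is bounded. *)

Require Import Defs.
From Stdlib Require Import Reals Lra Lia List Classical ClassicalEpsilon Permutation Wf_nat.
From Coquelicot Require Import Coquelicot.
Import ListNotations.
Open Scope R_scope.
Set Bullet Behavior "Strict Subproofs".

Local Notation hd0 := (hd 0%nat).
Local Notation last0 l := (last l 0%nat).

Ltac in_app := rewrite ?in_app_iff in *; simpl in *; tauto.

(** * Calculus *)

(** Distortion controls only the variation of [U] over one branch, not its size. Without a bound on
    the size, the two parts of a merged tower need not have comparable densities, and averaging
    could be arbitrarily weak; this is why the slopes need an argument of their own. The Hoelder
    condition on the ratio is measured in the coordinate [E], not in [x]. A merged tower consists of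
    two old towers, each at most a fixed fraction of the whole, so distances in [E] shrink at each
    merge and the Hoelder constant shrinks with them, up to an additive distortion term. This gain
    pays for subtracting from the ratio a constant proportional to its minimum: positivity keeps a
    lower bound, while the upper bound decays geometrically. The limiting constant need not be known
    beforehand: summing over the alphabet and using the conserved totals identifies it with the
    total nonlinearity, up to the same error. The statement sums lengths over the levels 1 to [q] of
    a tower, whereas [E] covers 0 to [q - 1]. The discrepancy is the length of an image minus that
    of its base, and both decay exponentially. *)

Lemma deriv_nondecr (f f' : R -> R) (x y : R) :
  x <= y ->
  (forall z, x <= z <= y -> derivable_pt_lim f z (f' z)) ->
  (forall z, x <= z <= y -> 0 <= f' z) -> f x <= f y.
Proof.
intros Hxy Hd Hp.
destruct (Req_dec x y) as [->|Hne]; [lra|].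
destruct (MVT_cor2 f f' x y) as [c [Hc1 Hc2]]; [lra|exact Hd|].
assert (0 <= f' c) by (apply Hp; lra).
nra.
Qed.

Lemma deriv_incr (f f' : R -> R) (x y : R) :
  x < y ->
  (forall z, x <= z <= y -> derivable_pt_lim f z (f' z)) ->
  (forall z, x <= z <= y -> 0 < f' z) -> f x < f y.
Proof.
intros Hxy Hd Hp.
destruct (MVT_cor2 f f' x y) as [c [Hc1 Hc2]]; [lra|exact Hd|].
assert (0 < f' c) by (apply Hp; lra).
nra.
Qed.

(** Increments of primitives take the place of integrals of densities: a pointwise inequality
    between densities is integrated through the monotonicity of [c * g - f]. *)
Lemma deriv_incr_le (f f' g g' : R -> R) (x y c : R) :
  x <= y ->
  (forall z, x <= z <= y -> derivable_pt_lim f z (f' z)) ->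
  (forall z, x <= z <= y -> derivable_pt_lim g z (g' z)) ->
  (forall z, x <= z <= y -> f' z <= c * g' z) ->
  f y - f x <= c * (g y - g x).
Proof.
intros Hxy Hf Hg Hle.
assert (H : c * g x - f x <= c * g y - f y).
{ apply (deriv_nondecr (fun z => c * g z - f z) (fun z => c * g' z - f' z) x y Hxy).
  - intros z Hz.
    apply (derivable_pt_lim_minus (fun z => c * g z) f z).
    + apply (derivable_pt_lim_scal g c z). now apply Hg.
    + now apply Hf.
  - intros z Hz. specialize (Hle z Hz). lra. }
lra.
Qed.

Lemma deriv_abs_le (f f' g g' : R -> R) (x y k c : R) :
  x <= y ->
  (forall z, x <= z <= y -> derivable_pt_lim f z (f' z)) ->
  (forall z, x <= z <= y -> derivable_pt_lim g z (g' z)) ->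
  (forall z, x <= z <= y -> Rabs (f' z - k * g' z) <= c * g' z) ->
  Rabs (f y - f x - k * (g y - g x)) <= c * (g y - g x).
Proof.
intros Hxy Hf Hg Hle.
assert (H1 : f y - f x <= (k + c) * (g y - g x)).
{ apply (deriv_incr_le f f' g g'); auto.
  intros z Hz. specialize (Hle z Hz). apply Rabs_le_between in Hle. lra. }
assert (H2 : -1 * f y - -1 * f x <= (c - k) * (g y - g x)).
{ apply (deriv_incr_le (fun z => -1 * f z) (fun z => -1 * f' z) g g'); auto.
  - intros z Hz. apply (derivable_pt_lim_scal f). now apply Hf.
  - intros z Hz. specialize (Hle z Hz). apply Rabs_le_between in Hle. lra. }
apply Rabs_le. lra.
Qed.

(* Modulus [t^nu] of Hoelder continuity; [Rpower 0 nu] is [1] in Rocq, hence the case split. *)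
Definition om (nu t : R) : R := if Rle_dec t 0 then 0 else Rpower t nu.

Lemma om_pos nu t : 0 <= om nu t.
Proof. unfold om. destruct (Rle_dec t 0); [lra|]. left. apply exp_pos. Qed.

Lemma om_0 nu : om nu 0 = 0.
Proof. unfold om. destruct (Rle_dec 0 0); lra. Qed.

Lemma om_mono nu s t : 0 < nu -> s <= t -> om nu s <= om nu t.
Proof.
intros Hnu Hst. unfold om.
destruct (Rle_dec s 0), (Rle_dec t 0); try lra.
- left. apply exp_pos.
- apply Rle_Rpower_l; lra.
Qed.

Lemma om_le1 nu t : 0 < nu -> t <= 1 -> om nu t <= 1.
Proof.
intros Hnu Ht.
eapply Rle_trans; [apply (om_mono nu t 1 Hnu Ht)|].
unfold om. destruct (Rle_dec 1 0); [lra|]. unfold Rpower. rewrite ln_1, Rmult_0_r, exp_0. lra.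
Qed.

(** The exponent is capped at 1 for this inequality: it absorbs Lipschitz distortion terms into the
    Hoelder modulus. *)
Lemma om_ge nu t : 0 < nu <= 1 -> t <= 1 -> t <= om nu t.
Proof.
intros Hnu Ht. unfold om. destruct (Rle_dec t 0); [lra|].
rewrite <- (Rpower_1 t) at 1 by lra. unfold Rpower.
assert (Hl : ln t <= 0) by (rewrite <- ln_1; apply ln_le; lra).
destruct (Req_dec (1 * ln t) (nu * ln t)) as [->|]; [lra|].
left. apply exp_increasing. nra.
Qed.

Lemma om_scale nu th t : 0 < th -> om nu (th * t) = Rpower th nu * om nu t.
Proof.
intros Hth. unfold om.
destruct (Rle_dec (th * t) 0), (Rle_dec t 0); try (exfalso; nra); try lra.
rewrite Rpower_mult_distr; lra.
Qed.

Lemma om_small nu eps : 0 < nu -> 0 < eps ->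
  exists del, 0 < del /\ forall t, t < del -> om nu t < eps.
Proof.
intros Hnu He. exists (Rpower eps (/ nu)). split; [apply exp_pos|].
intros t Ht. unfold om. destruct (Rle_dec t 0); [lra|].
replace eps with (Rpower (Rpower eps (/ nu)) nu).
- apply Rlt_Rpower_l; lra.
- rewrite Rpower_mult, Rinv_l, Rpower_1; lra.
Qed.

Definition clamp (lo hi x : R) : R := Rmax lo (Rmin x hi).

Lemma clamp_in lo hi x : lo <= hi -> lo <= clamp lo hi x <= hi.
Proof. intros. unfold clamp, Rmax, Rmin. destruct (Rle_dec x hi), (Rle_dec lo _); lra. Qed.

Lemma clamp_id lo hi x : lo <= x <= hi -> clamp lo hi x = x.
Proof. intros. unfold clamp, Rmax, Rmin. destruct (Rle_dec x hi), (Rle_dec lo _); lra. Qed.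

Lemma clamp_lip lo hi x y : lo <= hi -> Rabs (clamp lo hi x - clamp lo hi y) <= Rabs (x - y).
Proof.
intros. unfold clamp, Rmax, Rmin.
destruct (Rle_dec x hi), (Rle_dec y hi); repeat destruct (Rle_dec lo _);
unfold Rabs; repeat destruct (Rcase_abs _); lra.
Qed.

Lemma exp_le x y : x <= y -> exp x <= exp y.
Proof. intros [H| ->]; [left; now apply exp_increasing|lra]. Qed.

(** Branches live on all of [R], so that derivatives and compositions carry no side conditions at
    end points. [U] is the log-derivative of [H], and [u] its nonlinearity. The one-sided Hoelder
    bound suffices, since [x] and [y] may be exchanged. *)
Definition is_branch (nu : R) (H U u : R -> R) : Prop :=
  (forall x, derivable_pt_lim H x (exp (U x))) /\
  (forall x, derivable_pt_lim U x (u x)) /\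
  (forall x, continuous u x) /\
  exists K, 0 <= K /\ (forall x, Rabs (u x) <= K) /\
    forall x y, u x - u y <= K * om nu (Rabs (x - y)).

Lemma RInt_derivable (f : R -> R) (a : R) :
  (forall x, continuous f x) -> forall x, derivable_pt_lim (RInt f a) x (f x).
Proof.
intros Hc x. apply is_derive_Reals. apply is_derive_RInt with a.
- apply filter_forall. intros y. apply (RInt_correct (V := R_CompleteNormedModule)). apply (ex_RInt_continuous (V := R_CompleteNormedModule)). auto.
- apply Hc.
Qed.

Lemma derivable_lim_continuous (f : R -> R) (x l : R) :
  derivable_pt_lim f x l -> continuous f x.
Proof.
intros Hd. apply (ex_derive_continuous (K := R_AbsRing) (V := R_NormedModule)).
exists l. now apply is_derive_Reals.
Qed.

Lemma exp_comp_deriv (U : R -> R) (x l : R) :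
  derivable_pt_lim U x l -> derivable_pt_lim (fun y => exp (U y)) x (exp (U x) * l).
Proof.
intros HU. apply (derivable_pt_lim_comp U exp x l (exp (U x)) HU).
apply derivable_pt_lim_exp.
Qed.

Lemma const_of_deriv0 (f : R -> R) (lo hi x : R) :
  (forall z, lo <= z <= hi -> derivable_pt_lim f z 0) -> lo <= x <= hi -> f x = f lo.
Proof.
intros Hd Hx. apply Rle_antisym.
- assert (- f lo <= - f x); [|lra].
  apply (deriv_nondecr (fun z => - f z) (fun _ => - 0) lo x); [lra| |intros; lra].
  intros z Hz. apply derivable_pt_lim_opp. apply Hd. lra.
- apply (deriv_nondecr f (fun _ => 0) lo x); [lra| |intros; lra].
  intros z Hz. apply Hd. lra.
Qed.

(* The nonlinearity [h2 / h1] is extended by constants outside [lo, hi], and then integrated twice. *)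
Lemma branch_extension (nu lo hi : R) (h h1 h2 : R -> R) (K : R) :
  0 < nu <= 1 -> lo < hi -> hi - lo <= 1 ->
  (forall x, lo <= x <= hi ->
     derivable_pt_lim h x (h1 x) /\ derivable_pt_lim h1 x (h2 x) /\ 0 < h1 x) ->
  (forall x y, lo <= x <= hi -> lo <= y <= hi -> x <> y ->
     Rabs (h2 x - h2 y) <= K * Rpower (Rabs (x - y)) nu) ->
  exists H U u, is_branch nu H U u /\ forall x, lo <= x <= hi -> H x = h x.
Proof.
intros Hnu Hlh Hlen Hd HK.
assert (HKom : forall x y, lo <= x <= hi -> lo <= y <= hi ->
  Rabs (h2 x - h2 y) <= Rabs K * om nu (Rabs (x - y))).
{ intros x y Hx Hy. destruct (Req_dec x y) as [->|Hne].
  - rewrite !Rminus_diag, Rabs_R0. rewrite om_0. lra.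
  - eapply Rle_trans; [now apply HK|].
    unfold om. destruct (Rle_dec (Rabs (x - y)) 0) as [Hz|_].
    + exfalso. assert (0 < Rabs (x - y)) by (apply Rabs_pos_lt; lra). lra.
    + apply Rmult_le_compat_r; [left; apply exp_pos|apply Rle_abs]. }
assert (Hom1 : forall x y, lo <= x <= hi -> lo <= y <= hi ->
  Rabs (x - y) <= om nu (Rabs (x - y)) /\ om nu (Rabs (x - y)) <= 1).
{ intros x y Hx Hy.
  assert (Rabs (x - y) <= 1) by (apply Rabs_le; lra).
  split; [now apply om_ge|apply om_le1; lra]. }
set (M := Rabs (h2 lo) + Rabs K).
assert (HM0 : 0 <= M) by (unfold M; pose proof (Rabs_pos (h2 lo)); pose proof (Rabs_pos K); lra).
assert (HM : forall x, lo <= x <= hi -> Rabs (h2 x) <= M).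
{ intros x Hx. replace (h2 x) with (h2 lo + (h2 x - h2 lo)) by ring.
  eapply Rle_trans; [apply Rabs_triang|]. unfold M. apply Rplus_le_compat_l.
  eapply Rle_trans; [apply HKom; lra|].
  destruct (Hom1 x lo) as [_ H1]; [lra|lra|].
  pose proof (Rabs_pos K). nra. }
assert (Hlip : forall x y, lo <= x <= hi -> lo <= y <= hi -> Rabs (h1 x - h1 y) <= M * Rabs (x - y)).
{ assert (Hlt : forall x y, lo <= x -> x < y -> y <= hi -> Rabs (h1 x - h1 y) <= M * Rabs (x - y)).
  { intros x y Hx Hxy Hy.
    destruct (MVT_cor2 h1 h2 x y) as [c [Hc1 Hc2]]; [lra| |].
    - intros c Hc. apply Hd. lra.
    - rewrite (Rabs_minus_sym (h1 x)), Hc1, Rabs_mult, (Rabs_minus_sym x).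
      apply Rmult_le_compat_r; [apply Rabs_pos|]. apply HM. lra. }
  intros x y Hx Hy. destruct (Rtotal_order x y) as [Hlt'|[->|Hgt]].
  - apply Hlt; lra.
  - rewrite !Rminus_diag, Rabs_R0. lra.
  - rewrite (Rabs_minus_sym (h1 x)), (Rabs_minus_sym x). apply Hlt; lra. }
destruct (continuity_ab_min h1 lo hi) as [mx [Hmin Hmx]].
{ lra. }
{ intros c Hc. apply derivable_continuous_pt. exists (h2 c). now apply Hd. }
set (m := h1 mx) in *.
assert (Hm : 0 < m) by (apply Hd; exact Hmx).
set (uu := fun x => h2 (clamp lo hi x) / h1 (clamp lo hi x)).
(* The first two terms bound the Hoelder constant of [h2 / h1], from the variation of the numerator
   and of the denominator; the last bounds its absolute value. Here [m] is the minimum of [h1] and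
   [M] bounds [h2]. *)
set (K' := Rabs K / m + M * M / (m * m) + M / m).
assert (HK'0 : 0 <= Rabs K / m /\ 0 <= M * M / (m * m) /\ 0 <= M / m).
{ repeat split; apply Rmult_le_pos; try apply Rabs_pos; try nra; left; apply Rinv_0_lt_compat; nra. }
assert (Hu_bd : forall x, Rabs (uu x) <= K').
{ intros x. unfold uu. pose proof (clamp_in lo hi x ltac:(lra)) as Hc.
  set (c := clamp lo hi x) in *.
  unfold Rdiv. rewrite Rabs_mult, Rabs_inv. rewrite (Rabs_pos_eq (h1 c)) by (left; now apply Hd).
  apply Rle_trans with (M / m); [|unfold K'; lra].
  apply Rmult_le_compat; [apply Rabs_pos| |now apply HM|].
  - left; apply Rinv_0_lt_compat; now apply Hd.
  - apply Rinv_le_contravar; [lra|]. now apply Hmin. }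
assert (Hu_om : forall x y, lo <= x <= hi -> lo <= y <= hi ->
   h2 x / h1 x - h2 y / h1 y <= K' * om nu (Rabs (x - y))).
{ intros x y Hx Hy.
  assert (H1x : m <= h1 x) by (now apply Hmin).
  assert (H1y : m <= h1 y) by (now apply Hmin).
  replace (h2 x / h1 x - h2 y / h1 y) with
    ((h2 x - h2 y) / h1 x + h2 y * (h1 y - h1 x) / (h1 x * h1 y)) by (field; lra).
  destruct (Hom1 x y Hx Hy) as [Ho1 Ho2].
  pose proof (om_pos nu (Rabs (x - y))) as Ho0.
  set (o := om nu (Rabs (x - y))) in *.
  assert (E1 : (h2 x - h2 y) / h1 x <= Rabs K / m * o).
  { eapply Rle_trans; [apply Rle_abs|]. unfold Rdiv. rewrite Rabs_mult, Rabs_inv.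
    rewrite (Rabs_pos_eq (h1 x)) by lra.
    replace (Rabs K * / m * o) with ((Rabs K * o) * / m) by ring.
    apply Rmult_le_compat; [apply Rabs_pos| |now apply HKom|].
    - left; apply Rinv_0_lt_compat; lra.
    - apply Rinv_le_contravar; lra. }
  assert (E2 : h2 y * (h1 y - h1 x) / (h1 x * h1 y) <= M * M / (m * m) * o).
  { eapply Rle_trans; [apply Rle_abs|]. unfold Rdiv. rewrite Rabs_mult, Rabs_inv, Rabs_mult.
    rewrite (Rabs_pos_eq (h1 x * h1 y)) by nra.
    replace (M * M * / (m * m) * o) with ((M * (M * o)) * / (m * m)) by ring.
    assert (0 < h1 x * h1 y) by nra.
    apply Rmult_le_compat.
    - apply Rmult_le_pos; apply Rabs_pos.
    - left; apply Rinv_0_lt_compat; lra.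
    - apply Rmult_le_compat; try apply Rabs_pos; [now apply HM|].
      rewrite Rabs_minus_sym. eapply Rle_trans; [now apply Hlip|].
      apply Rmult_le_compat_l; lra.
    - apply Rinv_le_contravar; [nra|]. apply Rmult_le_compat; lra. }
  assert (0 <= M / m * o) by (apply Rmult_le_pos; lra).
  unfold K'. lra. }
assert (Huu_om : forall x y, uu x - uu y <= K' * om nu (Rabs (x - y))).
{ intros x y. eapply Rle_trans; [apply Hu_om; apply clamp_in; lra|].
  apply Rmult_le_compat_l; [unfold K'; lra|]. apply om_mono; [lra|]. apply clamp_lip. lra. }
assert (Huu_c : forall x, continuous uu x).
{ intros x. apply continuity_pt_filterlim. intros eps He.
  destruct (om_small nu (eps / (K' + 1))) as [del [Hdel1 Hdel2]]; [lra| |].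
  { apply Rdiv_lt_0_compat; [lra|unfold K'; lra]. }
  exists del. split; [exact Hdel1|]. intros y [_ Hy]. simpl in *. unfold Rdist in *.
  assert (HK1 : 0 < K' + 1) by (unfold K'; lra).
  pose proof (Hdel2 _ Hy) as Ho. pose proof (om_pos nu (Rabs (y - x))) as Hop.
  assert (Ho' : K' * om nu (Rabs (y - x)) < eps).
  { apply Rle_lt_trans with ((K' + 1) * om nu (Rabs (y - x))); [nra|].
    apply (Rmult_lt_compat_l (K' + 1)) in Ho; [|lra].
    replace ((K' + 1) * (eps / (K' + 1))) with eps in Ho by (field; lra). exact Ho. }
  pose proof (Huu_om y x) as H1. pose proof (Huu_om x y) as H2.
  rewrite (Rabs_minus_sym x y) in H2.
  apply Rabs_def1; lra. }
set (U := fun x => ln (h1 lo) + RInt uu lo x).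
assert (HU : forall x, derivable_pt_lim U x (uu x)).
{ intros x. unfold U. replace (uu x) with (0 + uu x) by ring.
  apply (derivable_pt_lim_plus (fun _ => ln (h1 lo)) (RInt uu lo)).
  - apply derivable_pt_lim_const.
  - now apply RInt_derivable. }
assert (HeU : forall x, continuous (fun y => exp (U y)) x).
{ intros x. eapply derivable_lim_continuous. apply exp_comp_deriv. apply HU. }
set (H := fun x => h lo + RInt (fun y => exp (U y)) lo x).
assert (HH : forall x, derivable_pt_lim H x (exp (U x))).
{ intros x. unfold H. replace (exp (U x)) with (0 + exp (U x)) by ring.
  apply (derivable_pt_lim_plus (fun _ => h lo)).
  - apply derivable_pt_lim_const.
  - apply (RInt_derivable (fun y => exp (U y))). exact HeU. }
assert (HU1 : forall x, lo <= x <= hi -> exp (U x) = h1 x).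
{ intros x Hx.
  assert (Hu : U x - ln (h1 x) = U lo - ln (h1 lo)).
  { apply (const_of_deriv0 (fun z => U z - ln (h1 z)) lo hi); [|exact Hx].
    intros z Hz. replace 0 with (uu z - / h1 z * h2 z).
    - apply (derivable_pt_lim_minus U (fun z => ln (h1 z))); [apply HU|].
      apply (derivable_pt_lim_comp h1 ln); [now apply Hd|].
      apply derivable_pt_lim_ln. now apply Hd.
    - unfold uu. rewrite clamp_id by exact Hz. field. pose proof (Hd z Hz). lra. }
  unfold U in Hu at 2. rewrite RInt_point in Hu. unfold zero in Hu; simpl in Hu.
  replace (U x) with (ln (h1 x)) by lra. apply exp_ln. now apply Hd. }
exists H, U, uu. split.
- split; [exact HH|split; [exact HU|split; [exact Huu_c|]]].
  exists K'. split; [unfold K'; lra|]. split; [exact Hu_bd|exact Huu_om].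
- intros x Hx.
  assert (Hh : H x - h x = H lo - h lo).
  { apply (const_of_deriv0 (fun z => H z - h z) lo hi); [|exact Hx].
    intros z Hz. replace 0 with (exp (U z) - h1 z) by (rewrite HU1; lra).
    apply derivable_pt_lim_minus; [apply HH|now apply Hd]. }
  unfold H in Hh at 2. rewrite RInt_point in Hh. unfold zero in Hh; simpl in Hh. lra.
Qed.

Lemma IVT_incr (J : R -> R) (lo hi y : R) :
  (forall x, continuity_pt J x) -> lo < hi -> J lo < y < J hi ->
  exists z, lo < z < hi /\ J z = y.
Proof.
intros Hc Hlh Hy.
destruct (IVT (fun x => J x - y) lo hi) as [z [Hz1 Hz2]]; try lra.
{ intros a. apply continuity_pt_minus; [apply Hc|].
  apply continuity_pt_const. intros ? ?; reflexivity. }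
exists z. split; [|lra].
destruct (Req_dec z hi) as [->|]; [lra|].
destruct (Req_dec z lo) as [->|]; lra.
Qed.

Lemma Ilen_incr_image (J : R -> R) (lo hi : R) (P : R -> Prop) :
  lo < hi -> (forall x y, x < y -> J x < J y) -> (forall x, continuity_pt J x) ->
  (forall y, P y <-> exists x, lo <= x < hi /\ y = J x) ->
  Ilen P (J hi - J lo).
Proof.
intros Hlh Hinc Hc HP. exists (J lo), (J hi).
pose proof (Hinc lo hi Hlh) as Hl.
split; [lra|]. split; [reflexivity|]. split.
- intros y Hy. apply HP in Hy. destruct Hy as [x [Hx ->]].
  assert (J x < J hi) by (apply Hinc; lra).
  destruct (Req_dec x lo) as [->|]; [lra|].
  assert (J lo < J x) by (apply Hinc; lra). lra.
- intros y Hy. apply HP. destruct (IVT_incr J lo hi y Hc Hlh Hy) as [z [Hz1 Hz2]].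
  exists z. split; [lra|auto].
Qed.

Lemma continuous_continue_in (f : R -> R) (P : R -> Prop) (x : R) :
  continuous f x -> continue_in f P x.
Proof.
intros Hc. apply continuity_pt_filterlim in Hc.
intros eps He. destruct (Hc eps He) as [a [Ha H]].
exists a. split; [exact Ha|]. intros y [[_ Hne] Hy].
apply H. split; [|exact Hy]. split; [exact I|exact Hne].
Qed.

(** The quotient of the two derivatives is [u], a primitive of which is [U]. Since [phi] agrees with
    [H] only on the half-open interval, the derivatives of [phi] are taken at interior points, and
    those of [H] give the continuous extension. *)
Lemma IntD2D_branch (phi H U u : R -> R) (lo hi : R) :
  lo < hi ->
  (forall x, derivable_pt_lim H x (exp (U x))) ->
  (forall x, derivable_pt_lim U x (u x)) ->
  (forall x, continuous u x) ->
  (forall x, lo <= x < hi -> phi x = H x) ->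
  IntD2D phi lo hi (U hi - U lo).
Proof.
intros Hlh HH HU Hu Hphi.
assert (HeU : forall x, continuous (fun y => exp (U y)) x).
{ intros x. eapply derivable_lim_continuous. apply exp_comp_deriv. apply HU. }
exists (fun x => exp (U x)), (fun x => exp (U x) * u x). repeat apply conj.
- intros x Hx. split.
  + apply is_derive_Reals. apply (is_derive_ext_loc H); [|apply is_derive_Reals; apply HH].
    assert (Hp : 0 < Rmin (x - lo) (hi - x)) by (apply Rmin_pos; lra).
    exists (mkposreal _ Hp). intros y Hy. symmetry. apply Hphi.
    unfold ball in Hy; simpl in Hy; unfold AbsRing_ball, abs, minus, plus, opp in Hy; simpl in Hy.
    apply Rabs_def2 in Hy.
    pose proof (Rmin_l (x - lo) (hi - x)). pose proof (Rmin_r (x - lo) (hi - x)). lra.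
  + now apply exp_comp_deriv.
- intros x Hx. repeat apply conj.
  + now apply continuous_continue_in.
  + apply continuous_continue_in. apply (continuous_mult (fun y => exp (U y)) u); auto.
  + pose proof (exp_pos (U x)). lra.
- assert (HI : is_RInt (fun x => exp (U x) * u x / exp (U x)) lo hi (U hi - U lo)).
  { apply (is_RInt_ext u).
    - intros x _. change (@eq R (u x) (exp (U x) * u x / exp (U x))). field.
      pose proof (exp_pos (U x)); lra.
    - apply (is_RInt_derive U u).
      + intros x _. apply is_derive_Reals. apply HU.
      + intros x _. apply Hu. }
  assert (He : ex_RInt (fun x => exp (U x) * u x / exp (U x)) lo hi) by (eexists; exact HI).
  apply ex_RInt_Reals_0 in He. exists He.
  rewrite <- RInt_Reals. now apply is_RInt_unique.
Qed.

(** * Pairs of reals expanded backwards *)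

Lemma finite_upper_bound (F : nat -> R) (m : nat) : exists M, forall n, (n < m)%nat -> F n <= M.
Proof.
induction m as [|m [M IH]].
- exists 0. intros; lia.
- exists (Rmax M (F m)). intros n Hn. destruct (Nat.eq_dec n m) as [->|].
  + apply Rmax_r.
  + eapply Rle_trans; [apply IH; lia|apply Rmax_l].
Qed.

Definition near (E x y : R) : Prop := - E <= x - y <= E.

Definition stay_step (u v : nat -> R) (E : R) (n : nat) : Prop :=
  near E (u (S n)) (u n) /\ near E (v (S n)) (v n).
Definition add_step (u v : nat -> R) (E : R) (n : nat) : Prop :=
  near E (u (S n)) (u n + v n) /\ near E (v (S n)) (v n).

(** A model for the log-slopes of the two outer blocks. Up to errors [E], a step leaves the pair
    alone or adds one entry to the other, both additions recur in every window of length [K], and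
    the last clause says that the signs are opposite. *)
Definition balanced_pair (u v : nat -> R) (E : R) (K : nat) : Prop :=
  0 <= E /\
  (forall n, stay_step u v E n \/ add_step u v E n \/ add_step v u E n) /\
  (forall n, exists j, (n <= j < n + K)%nat /\ add_step u v E j) /\
  (forall n, exists j, (n <= j < n + K)%nat /\ add_step v u E j) /\
  forall n, (u n <= E \/ v n <= E) /\ (- E <= u n \/ - E <= v n).

(** Together with [balanced_opp], this symmetry reduces two-sided bounds on both entries to an upper
    bound on the first one. *)
Lemma balanced_swap u v E K : balanced_pair u v E K -> balanced_pair v u E K.
Proof.
intros [HE [Hs [HA [HC Hb]]]]. split; [exact HE|]. split; [|split; [exact HC|split; [exact HA|]]].
- intros n. destruct (Hs n) as [[H1 H2]|[H|H]]; [left; split; auto|right; right; auto|right; left; auto].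
- intros n. destruct (Hb n). tauto.
Qed.

Lemma balanced_opp u v E K : balanced_pair u v E K -> balanced_pair (fun n => - u n) (fun n => - v n) E K.
Proof.
assert (Hadd : forall u v n, add_step u v E n -> add_step (fun n => - u n) (fun n => - v n) E n).
{ intros u' v' n. unfold add_step, near. lra. }
intros [HE [Hs [HA [HC Hb]]]]. split; [exact HE|]. split; [|split; [|split]].
- intros n. destruct (Hs n) as [[H1 H2]|[H|H]]; [left|right; left|right; right]; auto.
  unfold stay_step, near in *. lra.
- intros n. destruct (HA n) as [j [Hj H]]. exists j. auto.
- intros n. destruct (HC n) as [j [Hj H]]. exists j. auto.
- intros n. destruct (Hb n). lra.
Qed.

(* Followed backwards, a pair of opposite signs is expanded: over a window containing both kinds of
   additions its first entry doubles, so it cannot have been large in the first place. *)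
Lemma balanced_bounded_above u v E K : balanced_pair u v E K -> exists M, forall n, u n <= M.
Proof.
intros [HE [Hs [HA [HC Hb]]]].
(* The errors collected over two windows amount to at most [17 * INR K * E + 3 * E]; this threshold
   leaves room. *)
set (B := 30 * (INR K + 1) * E).
pose proof (pos_INR K) as HK.
assert (HKE : 0 <= INR K * E) by nra.
(* Let [u] be large at the end of two windows. In the second window an addition of [u] to [v],
   undone, makes [v] about [- X] or lower; in the first window an addition of [v] to [u], undone,
   makes [u] about [2 * X] or higher. The surplus [X] exceeds all errors. *)
assert (Hback : forall n, u (n + 2 * K)%nat <= Rmax B (u n)).
{ intros n. destruct (Rle_or_lt (u (n + 2 * K)%nat) B) as [Hle|HX].
  { eapply Rle_trans; [exact Hle|apply Rmax_l]. }
  eapply Rle_trans; [|apply Rmax_r].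
  set (X := u (n + 2 * K)%nat) in *. set (N := (n + 2 * K)%nat) in *.
  (* Backwards, [u] can drop only by the subtraction of [v], and [v] is at most [E] at the later
     level as long as [u] exceeds [E] there. With the two step errors this costs [3 * E]. *)
  assert (Hub : forall i m, (m + i = N)%nat -> (n <= m)%nat -> X - 3 * E * INR i <= u m).
  { induction i as [|i IH]; intros m Hm Hnm.
    - replace m with N by lia. simpl. fold X. lra.
    - specialize (IH (S m) ltac:(lia) ltac:(lia)).
      assert (Hi : INR i <= 2 * INR K).
      { replace (2 * INR K) with (INR (2 * K)) by (rewrite mult_INR; simpl; ring).
        apply le_INR. lia. }
      pose proof (pos_INR i). assert (INR i * E <= 2 * INR K * E) by nra.
      destruct (Hb (S m)) as [[Hb1|Hb1] _]; [unfold B in HX; nra|].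
      rewrite S_INR.
      destruct (Hs m) as [[H1 H2]|[[H1 H2]|[H1 H2]]]; unfold near in *; nra. }
  assert (Hlow : forall m, (n <= m <= N)%nat -> X - 6 * (INR K * E) <= u m).
  { intros m Hm. specialize (Hub (N - m)%nat m ltac:(lia) ltac:(lia)).
    assert (Hi : INR (N - m) <= 2 * INR K).
    { replace (2 * INR K) with (INR (2 * K)) by (rewrite mult_INR; simpl; ring).
      apply le_INR. unfold N in *; lia. }
    pose proof (pos_INR (N - m)). nra. }
  assert (Hv : forall m, (n <= m <= N)%nat -> v m <= E).
  { intros m Hm. specialize (Hlow m Hm). destruct (Hb m) as [[Hb1|Hb1] _]; [|exact Hb1].
    unfold B in HX. nra. }
  destruct (HC (n + K)%nat) as [j [Hj HCj]].
  assert (Hvj : v j <= - X + 6 * (INR K * E) + 2 * E).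
  { destruct HCj as [H1 H2]. pose proof (Hv (S j) ltac:(unfold N; lia)).
    pose proof (Hlow j ltac:(unfold N; lia)). unfold near in *. lra. }
  assert (Hvb : forall i m, (m + i = j)%nat -> (n <= m)%nat -> v m <= v j + E * INR i).
  { induction i as [|i IH]; intros m Hm Hnm.
    - replace m with j by lia. simpl. lra.
    - specialize (IH (S m) ltac:(lia) ltac:(lia)).
      pose proof (Hlow m ltac:(unfold N; lia)) as Hl.
      rewrite S_INR. unfold B in HX.
      destruct (Hs m) as [[H1 H2]|[[H1 H2]|[H1 H2]]]; unfold near in *; nra. }
  destruct (HA n) as [i [Hi HAi]].
  assert (Hvi : v i <= - X + 8 * (INR K * E) + 2 * E).
  { specialize (Hvb (j - i)%nat i ltac:(lia) ltac:(lia)).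
    assert (Hji : INR (j - i) <= 2 * INR K).
    { replace (2 * INR K) with (INR (2 * K)) by (rewrite mult_INR; simpl; ring).
      apply le_INR. lia. }
    pose proof (pos_INR (j - i)). nra. }
  assert (Hui : 2 * X - 14 * (INR K * E) - 3 * E <= u i).
  { destruct HAi as [H1 _]. pose proof (Hlow (S i) ltac:(unfold N; lia)). unfold near in *. lra. }
  assert (Hun : forall r m, (m + r = i)%nat -> (n <= m)%nat -> u i - 3 * E * INR r <= u m).
  { induction r as [|r IH]; intros m Hm Hnm.
    - replace m with i by lia. simpl. lra.
    - specialize (IH (S m) ltac:(lia) ltac:(lia)).
      pose proof (Hv m ltac:(unfold N; lia)) as Hl.
      rewrite S_INR.
      destruct (Hs m) as [[H1 H2]|[[H1 H2]|[H1 H2]]]; unfold near in *; nra. }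
  specialize (Hun (i - n)%nat n ltac:(lia) ltac:(lia)).
  assert (Hin : INR (i - n) <= INR K) by (apply le_INR; lia).
  pose proof (pos_INR (i - n)). unfold B in HX. nra. }
assert (HK0 : (0 < K)%nat) by (destruct (HA 0%nat) as [j [Hj _]]; lia).
destruct (finite_upper_bound u (2 * K)) as [M0 HM0].
exists (Rmax B M0). intros n. induction n as [n IH] using (well_founded_induction Wf_nat.lt_wf).
destruct (Nat.lt_ge_cases n (2 * K)) as [Hlt|Hge].
- eapply Rle_trans; [now apply HM0|apply Rmax_r].
- specialize (Hback (n - 2 * K)%nat). replace (n - 2 * K + 2 * K)%nat with n in Hback by lia.
  eapply Rle_trans; [exact Hback|]. apply Rmax_lub; [apply Rmax_l|]. apply IH. lia.
Qed.

Lemma balanced_bounded u v E K : balanced_pair u v E K ->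
  exists M, forall n, Rabs (u n) <= M /\ Rabs (v n) <= M.
Proof.
intros H.
destruct (balanced_bounded_above _ _ _ _ H) as [M1 H1].
destruct (balanced_bounded_above _ _ _ _ (balanced_swap _ _ _ _ H)) as [M2 H2].
destruct (balanced_bounded_above _ _ _ _ (balanced_opp _ _ _ _ H)) as [M3 H3].
destruct (balanced_bounded_above _ _ _ _ (balanced_swap _ _ _ _ (balanced_opp _ _ _ _ H))) as [M4 H4].
exists (Rabs M1 + Rabs M2 + Rabs M3 + Rabs M4). intros n.
specialize (H1 n). specialize (H2 n). specialize (H3 n). specialize (H4 n). simpl in *.
pose proof (Rle_abs M1). pose proof (Rle_abs M2). pose proof (Rle_abs M3). pose proof (Rle_abs M4).
pose proof (Rabs_pos M1). pose proof (Rabs_pos M2). pose proof (Rabs_pos M3). pose proof (Rabs_pos M4).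
split; apply Rabs_le; lra.
Qed.

(** * The three blocks and their jumps *)

(* The boolean is the type of the step; the letter that moves into the middle block is the loser. *)
Inductive lists_step : bool -> list nat * list nat * list nat -> list nat * list nat * list nat -> Prop :=
| ls_top A' b1 B C : A' <> [] -> lists_step false (A' ++ [b1], B, C) (A', b1 :: B, C)
| ls_top_last b1 B C : lists_step false ([b1], B, C) (b1 :: B, [], C)
| ls_bot A B C' b0 : C' <> [] -> lists_step true (A, B, C' ++ [b0]) (A, b0 :: B, C')
| ls_bot_last A B b0 : lists_step true (A, B, [b0]) (A, [], b0 :: B).

Section Jumps.

Variables (sl sr : nat -> R) (J : R).

(** [sl a] and [sr a] are the log-slopes at the left and right ends of the letter [a]. Neighbours
    within a block are adjacent both in the domain and in the image, so the map is continuous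
    between them and only its log-derivative jumps. *)
Fixpoint linked (l : list nat) : Prop :=
  match l with
  | [] => True
  | a :: t => match t with [] => True | b :: _ => near J (sl b) (sr a) end /\ linked t
  end.

Lemma linked_app l1 a l2 : linked (l1 ++ a :: l2) <->
  linked l1 /\ linked (a :: l2) /\ (l1 <> [] -> near J (sl a) (sr (last0 l1))).
Proof.
induction l1 as [|b l1 IH].
- simpl. tauto.
- destruct l1 as [|c l1].
  + simpl. split; [|intros H; repeat split; apply H; discriminate]. tauto.
  + change ((b :: c :: l1) ++ a :: l2) with (b :: (c :: l1) ++ a :: l2).
    change (last0 (b :: c :: l1)) with (last0 (c :: l1)).
    change (linked (b :: (c :: l1) ++ a :: l2)) with
      (near J (sl c) (sr b) /\ linked ((c :: l1) ++ a :: l2)).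
    change (linked (b :: c :: l1)) with (near J (sl c) (sr b) /\ linked (c :: l1)).
    rewrite IH. assert (c :: l1 <> []) by discriminate. assert (b :: c :: l1 <> []) by discriminate. tauto.
Qed.

(** Walking along the block costs [V] for crossing a letter and [J] for the jump to the next one. *)
Lemma linked_spread V l : 0 <= J -> 0 <= V -> linked l -> (forall a, In a l -> near V (sl a) (sr a)) ->
  (forall a, In a l -> near ((J + V) * INR (length l)) (sl a) (sl (hd0 l))) /\
  (l <> [] -> near ((J + V) * INR (length l)) (sr (last0 l)) (sl (hd0 l))).
Proof.
intros HJ HV. induction l as [|b l IH]; intros Hl Hv; [split; [simpl; tauto|congruence]|].
destruct l as [|c l].
- assert (Hb := Hv b (or_introl eq_refl)). unfold near in *.
  split; [intros a [<-|[]]|intros _]; simpl; nra.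
- destruct Hl as [Hbc Hl].
  destruct (IH Hl (fun a Ha => Hv a (or_intror Ha))) as [I1 I2].
  assert (Hb := Hv b (or_introl eq_refl)).
  change (length (b :: c :: l)) with (S (length (c :: l))). rewrite S_INR.
  change (last0 (b :: c :: l)) with (last0 (c :: l)).
  specialize (I2 ltac:(discriminate)). change (hd0 (b :: c :: l)) with b.
  change (hd0 (c :: l)) with c in *.
  pose proof (pos_INR (length (c :: l))). unfold near in *. split.
  + intros a [<-|Ha]; [nra|]. specialize (I1 a Ha). nra.
  + intros _. nra.
Qed.

(* Across [A|B] the left side needs one more step than the right side to rejoin it, across [B|C] one
   less; hence the two-term sums. *)
Definition jumps (t : list nat * list nat * list nat) : Prop :=
  let '(A, B, C) := t in
  linked A /\ linked B /\ linked C /\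
  match B with
  | [] => near J (sl (hd0 C) + sl (hd0 A)) (sr (last0 A) + sr (last0 C))
  | b :: _ => near J (sl b) (sr (last0 A) + sr (last0 C)) /\
              near J (sl (hd0 C) + sl (hd0 A)) (sr (last0 B))
  end.

End Jumps.

(** The right end of the last letter enters no link. It may therefore change freely, as it does for
    the winner, which is cut on the right. *)
Lemma linked_ext sl sr sl' sr' J l :
  (forall a, In a l -> sl' a = sl a) -> (forall a, In a l -> a <> last0 l -> sr' a = sr a) ->
  NoDup l -> linked sl sr J l -> linked sl' sr' J l.
Proof.
induction l as [|b l IH]; intros H1 H2 Hnd; [simpl; tauto|].
destruct l as [|c l]; [simpl; tauto|].
change (last0 (b :: c :: l)) with (last0 (c :: l)) in H2.
inversion Hnd as [|? ? Hnin Hnd']; subst.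
intros [Hbc Hl]. split.
- rewrite H1 by (simpl; tauto). rewrite H2; [exact Hbc|simpl; tauto|].
  intros Heq. apply Hnin. rewrite Heq.
  rewrite (app_removelast_last 0%nat (l := c :: l)) at 2 by discriminate.
  apply in_or_app. right. simpl. tauto.
- apply IH; auto.
  + intros a Ha. apply H1. right; exact Ha.
  + intros a Ha. apply H2. right; exact Ha.
Qed.

Lemma hd_app_nonnil (l l' : list nat) : l <> [] -> hd0 (l ++ l') = hd0 l.
Proof. destruct l; [congruence|reflexivity]. Qed.

Lemma hd_in (l : list nat) : l <> [] -> In (hd0 l) l.
Proof. destruct l; [congruence|simpl; tauto]. Qed.

Lemma last_in (l : list nat) : l <> [] -> In (last0 l) l.
Proof.
intros H. rewrite (app_removelast_last 0%nat H) at 2. apply in_or_app. right; simpl; tauto.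
Qed.

Lemma last_cons_nonnil (a : nat) l : l <> [] -> last0 (a :: l) = last0 l.
Proof. destruct l; [congruence|reflexivity]. Qed.

(* Each of the [d - 1] jumps is carried over unchanged to a jump of the new level. *)
Lemma jumps_step_top A B C t' sl sr sl' sr' w J b0 b1 :
  lists_step false (A, B, C) t' -> NoDup (A ++ B ++ C) -> A <> [] -> C <> [] ->
  b1 = last0 A -> b0 = last0 C ->
  (forall a, In a (A ++ B ++ C) -> a <> b0 -> a <> b1 -> sl' a = sl a /\ sr' a = sr a) ->
  sl' b0 = sl b0 /\ sr' b0 = w /\ sl' b1 = sl b1 + w /\ sr' b1 = sr b1 + sr b0 ->
  jumps sl sr J (A, B, C) -> jumps sl' sr' J t'.
Proof.
intros Hst Hnd HA HC Hb1 Hb0 Heq Hspec [LA [LB [LC HJ]]].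
assert (HndA : NoDup A) by (eapply NoDup_app_remove_r; exact Hnd).
assert (HndBC : NoDup (B ++ C)) by (eapply NoDup_app_remove_l; exact Hnd).
assert (HndB : NoDup B) by (eapply NoDup_app_remove_r; exact HndBC).
assert (HndC : NoDup C) by (eapply NoDup_app_remove_l; exact HndBC).
assert (Hdis : forall x y, In x A -> In y (B ++ C) -> x <> y).
{ intros x y Hx Hy ->. apply in_split in Hx. destruct Hx as [l1 [l2 ->]].
  rewrite <- app_assoc in Hnd. simpl in Hnd. apply NoDup_remove_2 in Hnd.
  apply Hnd. in_app. }
assert (Hdis2 : forall x y, In x B -> In y C -> x <> y).
{ intros x y Hx Hy ->. apply in_split in Hx. destruct Hx as [l1 [l2 ->]].
  rewrite <- app_assoc in HndBC. simpl in HndBC. apply NoDup_remove_2 in HndBC.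
  apply HndBC. in_app. }
pose proof (last_in A HA) as InA. pose proof (last_in C HC) as InC. rewrite <- Hb1 in InA. rewrite <- Hb0 in InC.
assert (HeqB : forall a, In a B -> sl' a = sl a /\ sr' a = sr a).
{ intros a Ha. apply Heq.
  - in_app.
  - now apply Hdis2.
  - apply not_eq_sym. apply Hdis; [exact InA|in_app]. }
assert (HeqA : forall a, In a A -> a <> b1 -> sl' a = sl a /\ sr' a = sr a).
{ intros a Ha Hne. apply Heq; [in_app| |exact Hne].
  apply Hdis; [exact Ha|in_app]. }
assert (HeqC : forall a, In a C -> a <> b0 -> sl' a = sl a /\ sr' a = sr a).
{ intros a Ha Hne. apply Heq; [in_app|exact Hne|].
  apply not_eq_sym. apply Hdis; [exact InA|in_app]. }
assert (LB' : linked sl' sr' J B).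
{ apply (linked_ext sl sr); auto; intros; now apply HeqB. }
assert (HlastB : B <> [] -> sr' (last0 B) = sr (last0 B)).
{ intros HB. apply HeqB. now apply last_in. }
destruct Hspec as [S1 [S2 [S3 S4]]].
assert (LC' : linked sl' sr' J C).
{ apply (linked_ext sl sr); auto.
  - intros a Ha. destruct (Nat.eq_dec a b0) as [->|]; [exact S1|now apply HeqC].
  - intros a Ha Hne. apply HeqC; congruence. }
assert (HslC : sl' (hd0 C) = sl (hd0 C)).
{ destruct (Nat.eq_dec (hd0 C) b0) as [->|]; [exact S1|apply HeqC; auto; now apply hd_in]. }
(* The old jump across [[A|B]] turns into the link from the moved letter to the old head of [B]. *)
assert (LcB : linked sl' sr' J (b1 :: B)).
{ split; [|exact LB']. destruct B as [|b B']; [exact I|].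
  destruct HJ as [HJ1 _]. rewrite (proj1 (HeqB b (or_introl eq_refl))), S4.
  rewrite Hb1, Hb0. exact HJ1. }
inversion Hst as [A' c1 B0 C0 HA' E1 E2|c1 B0 C0 E1 E2| | ]; subst A B0 C0 t'.
+ assert (Hc1 : c1 = b1) by (rewrite Hb1, last_last; reflexivity). subst c1.
  assert (Hb1A' : ~ In b1 A').
  { apply NoDup_remove_2 in HndA. rewrite app_nil_r in HndA. exact HndA. }
  apply linked_app in LA. destruct LA as [LA' [_ Hj]]. specialize (Hj HA').
  split; [|split; [exact LcB|split; [exact LC'|split]]].
  * apply (linked_ext sl sr); auto.
    -- intros a Ha. apply HeqA; [in_app|intros ->; auto].
    -- intros a Ha _. apply HeqA; [in_app|intros ->; auto].
    -- eapply NoDup_app_remove_r; exact HndA.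
  (* The old link inside [A] turns into the new jump across [[A|B]]. The uncontrolled value [w]
     occurs on both sides and cancels. *)
  * rewrite S3, <- Hb0, S2.
    rewrite (proj2 (HeqA (last0 A') ltac:(apply in_or_app; left; now apply last_in)
       ltac:(intros E; apply Hb1A'; rewrite <- E; now apply last_in))).
    unfold near in *. lra.
  * rewrite HslC.
    rewrite (proj1 (HeqA (hd0 A') ltac:(apply in_or_app; left; now apply hd_in)
       ltac:(intros E; apply Hb1A'; rewrite <- E; now apply hd_in))).
    rewrite (hd_app_nonnil A' [b1] HA') in HJ.
    destruct B as [|b B'].
    -- simpl last. rewrite S4. rewrite last_last, <- Hb0 in HJ. exact HJ.
    -- rewrite last_cons_nonnil by discriminate. rewrite HlastB by discriminate. apply HJ.
(* Here [A] is exhausted and takes over [B]; only one jump between the two remaining blocks is left,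
   and [w] cancels in it as well. *)
+ assert (Hc1 : c1 = b1) by (rewrite Hb1; reflexivity). subst c1.
  split; [exact LcB|]. split; [exact I|]. split; [exact LC'|].
  simpl hd at 2. rewrite HslC, S3, <- Hb0, S2. simpl hd at 2 in HJ. simpl last in HJ at 1.
  destruct B as [|b B'].
  * simpl last. rewrite S4. simpl in HJ. rewrite <- Hb0 in HJ. unfold near in *. lra.
  * rewrite last_cons_nonnil by discriminate. rewrite HlastB by discriminate.
    destruct HJ as [_ HJ]. simpl hd in HJ at 2. unfold near in *. lra.
Qed.

Lemma jumps_swap sl sr J A B C : jumps sl sr J (A, B, C) -> jumps sl sr J (C, B, A).
Proof.
intros [LA [LB [LC HJ]]]. split; [exact LC|]. split; [exact LB|]. split; [exact LA|].
destruct B; unfold near in *; lra.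
Qed.

(** Exchanging [A] and [C] exchanges the two types of step, and [jumps] is symmetric under it, so
    the second type needs no computation of its own. *)
Lemma jumps_step e A B C t' sl sr sl' sr' w J b0 b1 :
  lists_step e (A, B, C) t' -> NoDup (A ++ B ++ C) -> A <> [] -> C <> [] ->
  b1 = last0 A -> b0 = last0 C ->
  (forall a, In a (A ++ B ++ C) -> a <> b0 -> a <> b1 -> sl' a = sl a /\ sr' a = sr a) ->
  (if e then sl' b1 = sl b1 /\ sr' b1 = w /\ sl' b0 = w + sl b0 /\ sr' b0 = sr b1 + sr b0
   else sl' b0 = sl b0 /\ sr' b0 = w /\ sl' b1 = sl b1 + w /\ sr' b1 = sr b1 + sr b0) ->
  jumps sl sr J (A, B, C) -> jumps sl' sr' J t'.
Proof.
destruct e; [|apply jumps_step_top].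
intros Hst Hnd HA HC Hb1 Hb0 Heq [S1 [S2 [S3 S4]]] HJ.
destruct t' as [[A2 B2] C2]. apply jumps_swap.
apply (jumps_step_top C B A (C2, B2, A2) sl sr sl' sr' w J b1 b0); auto.
- inversion Hst; subst; now constructor.
- apply (Permutation_NoDup (l := A ++ B ++ C)); [|exact Hnd].
  rewrite (app_assoc C). eapply Permutation_trans; [|apply Permutation_app_comm].
  apply Permutation_app_head. apply Permutation_app_comm.
- intros a Ha Hn1 Hn0. apply Heq; auto. in_app.
- lra.
- now apply jumps_swap.
Qed.

(** * Renormalized branches as cocycles *)

Lemma sumR_ext d F F' : (forall a, (a < d)%nat -> F a = F' a) -> sumR d F = sumR d F'.
Proof.
induction d as [|d IH]; intros H; simpl; [reflexivity|].
rewrite IH, H by (try lia; intros; apply H; lia). reflexivity.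
Qed.

Lemma sumR_plus d F F' : sumR d (fun a => F a + F' a) = sumR d F + sumR d F'.
Proof. induction d as [|d IH]; simpl; [lra|rewrite IH; lra]. Qed.

Lemma sumR_scal d c F : sumR d (fun a => c * F a) = c * sumR d F.
Proof. induction d as [|d IH]; simpl; [lra|rewrite IH; lra]. Qed.

Lemma sumR_le d F F' : (forall a, (a < d)%nat -> F a <= F' a) -> sumR d F <= sumR d F'.
Proof.
induction d as [|d IH]; intros H; simpl; [lra|].
apply Rplus_le_compat; [apply IH; intros|]; apply H; lia.
Qed.

Lemma sumR_lt d F F' : (0 < d)%nat -> (forall a, (a < d)%nat -> F a < F' a) -> sumR d F < sumR d F'.
Proof.
intros Hd H. destruct d as [|d]; [lia|]. simpl.
apply Rplus_le_lt_compat; [apply sumR_le; intros; left|]; apply H; lia.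
Qed.

Lemma sumR_nonneg d F : (forall a, (a < d)%nat -> 0 <= F a) -> 0 <= sumR d F.
Proof.
intros H. rewrite <- (Rmult_0_l (sumR d F)) at 1. rewrite <- sumR_scal.
apply sumR_le. intros a Ha. specialize (H a Ha). lra.
Qed.

Lemma sumR_term_le d F b : (b < d)%nat -> (forall a, (a < d)%nat -> 0 <= F a) -> F b <= sumR d F.
Proof.
induction d as [|d IH]; intros Hb H; [lia|]. simpl.
destruct (Nat.eq_dec b d) as [->|].
- assert (0 <= sumR d F) by (apply sumR_nonneg; intros; apply H; lia). lra.
- assert (F b <= sumR d F) by (apply IH; [lia|intros; apply H; lia]).
  specialize (H d ltac:(lia)). lra.
Qed.

Lemma sumR_upd1 d F F' b : (b < d)%nat ->
  (forall a, (a < d)%nat -> a <> b -> F' a = F a) -> sumR d F' = sumR d F + (F' b - F b).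
Proof.
induction d as [|d IH]; intros Hb H; [lia|]. simpl.
destruct (Nat.eq_dec b d) as [->|].
- rewrite (sumR_ext d F' F); [lra|]. intros; apply H; lia.
- rewrite IH, (H d); [lra|lia|lia|lia|]. intros; apply H; lia.
Qed.

Lemma sumR_upd2 d F F' b c : (b < d)%nat -> (c < d)%nat -> b <> c ->
  (forall a, (a < d)%nat -> a <> b -> a <> c -> F' a = F a) ->
  sumR d F' = sumR d F + (F' b - F b) + (F' c - F c).
Proof.
intros Hb Hc Hbc H.
rewrite (sumR_upd1 d (fun a => if Nat.eq_dec a b then F' a else F a) F' c Hc).
- rewrite (sumR_upd1 d F (fun a => if Nat.eq_dec a b then F' a else F a) b Hb).
  + cbv beta. destruct (Nat.eq_dec b b), (Nat.eq_dec c b); congruence.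
  + intros a _ Hab. destruct (Nat.eq_dec a b); congruence.
- intros a Ha Hac. destruct (Nat.eq_dec a b); auto.
Qed.

(** A step expressed by end points alone. The first equation says that the last interval of the
    domain and the last one of the image end together. For type 1 the interval of [b1] is cut at the
    preimage of the left end of [b0], and [b0] receives its right part; for type 0 the interval of
    [b0] is cut at the image of the left end of [b1]. *)
Definition explicit_step (d : nat) (e : bool) (b0 b1 : nat) (Hb1 : R -> R)
  (l h l' h' : nat -> R) : Prop :=
  Hb1 (h b1) = h b0 /\
  if e then
    Hb1 (h' b1) = l b0 /\ l' b1 = l b1 /\ l' b0 = h' b1 /\ h' b0 = h b1 /\
    forall a, (a < d)%nat -> a <> b0 -> a <> b1 -> l' a = l a /\ h' a = h a
  else
    h' b0 = Hb1 (l b1) /\ l' b0 = l b0 /\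
    forall a, (a < d)%nat -> a <> b0 -> l' a = l a /\ h' a = h a.

Section Renormalization.

Variables (d : nat) (a0 a1 : nat -> nat) (ep : nat -> bool).
Variables (H0 U0 u0 : nat -> R -> R).

Definition losr (n : nat) : nat := loser (ep n) (a0 n) (a1 n).
Definition winr (n : nat) : nat := winner (ep n) (a0 n) (a1 n).

(* [brH], [coc] and [den] are the branches of [R^n f], and what additive cocycles and densities on the
   towers over them become at level [n]; the branch of the loser is always [a1] followed by [a0]. *)
Fixpoint brH (n : nat) (a : nat) (x : R) : R :=
  match n with
  | O => H0 a x
  | S m => if Nat.eq_dec a (losr m) then brH m (a0 m) (brH m (a1 m) x) else brH m a x
  end.

Fixpoint coc (P0 : nat -> R -> R) (n : nat) (a : nat) (x : R) : R :=
  match n with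
  | O => P0 a x
  | S m => if Nat.eq_dec a (losr m)
           then coc P0 m (a1 m) x + coc P0 m (a0 m) (brH m (a1 m) x)
           else coc P0 m a x
  end.

Definition brU : nat -> nat -> R -> R := coc U0.

Fixpoint den (D0 : nat -> R -> R) (n : nat) (a : nat) (x : R) : R :=
  match n with
  | O => D0 a x
  | S m => if Nat.eq_dec a (losr m)
           then den D0 m (a1 m) x + den D0 m (a0 m) (brH m (a1 m) x) * exp (brU m (a1 m) x)
           else den D0 m a x
  end.

Definition brE : nat -> nat -> R -> R := coc (fun _ x => x).
(** The sum of the derivatives of the iterates along the tower. It is at least 1, since the zeroth
    iterate contributes 1, and serves as the reference density. *)
Definition brL : nat -> nat -> R -> R := den (fun _ _ => 1).
Definition bru : nat -> nat -> R -> R := den u0.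

Hypothesis HH0 : forall a x, derivable_pt_lim (H0 a) x (exp (U0 a x)).
Hypothesis HU0 : forall a x, derivable_pt_lim (U0 a) x (u0 a x).
Hypothesis Hu0c : forall a x, continuous (u0 a) x.
Variable G : R.
Hypothesis HG : 0 <= G.
Hypothesis Hu0 : forall a x, Rabs (u0 a x) <= G.

Lemma brH_deriv n a x : derivable_pt_lim (brH n a) x (exp (brU n a x)).
Proof.
revert a x. induction n as [|n IH]; intros a x; [apply HH0|].
unfold brU; cbn [coc brH]. destruct (Nat.eq_dec a (losr n)).
- rewrite exp_plus, Rmult_comm.
  apply (derivable_pt_lim_comp (brH n (a1 n)) (brH n (a0 n))); apply IH.
- apply IH.
Qed.

Lemma coc_deriv P0 D0 n a x :
  (forall a x, derivable_pt_lim (P0 a) x (D0 a x)) ->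
  derivable_pt_lim (coc P0 n a) x (den D0 n a x).
Proof.
intros HP. revert a x. induction n as [|n IH]; intros a x; [apply HP|].
cbn [coc den]. destruct (Nat.eq_dec a (losr n)); [|apply IH].
apply (derivable_pt_lim_plus (coc P0 n (a1 n)) (fun x => coc P0 n (a0 n) (brH n (a1 n) x)));
  [apply IH|].
apply (derivable_pt_lim_comp (brH n (a1 n)) (coc P0 n (a0 n))); [apply brH_deriv|apply IH].
Qed.

Lemma brU_deriv n a x : derivable_pt_lim (brU n a) x (bru n a x).
Proof. apply coc_deriv. exact HU0. Qed.

Lemma brE_deriv n a x : derivable_pt_lim (brE n a) x (brL n a x).
Proof. apply coc_deriv. intros. apply derivable_pt_lim_id. Qed.

Lemma brH_incr n a x y : x < y -> brH n a x < brH n a y.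
Proof.
intros Hxy. apply (deriv_incr _ (fun z => exp (brU n a z))); [exact Hxy| |].
- intros; apply brH_deriv.
- intros; apply exp_pos.
Qed.

Lemma brH_mono n a x y : x <= y -> brH n a x <= brH n a y.
Proof. intros [H| ->]; [left; now apply brH_incr|lra]. Qed.

Lemma brH_cont n a x : continuity_pt (brH n a) x.
Proof. apply derivable_continuous_pt. eexists. apply brH_deriv. Qed.

Lemma bru_continuous n a x : continuous (bru n a) x.
Proof.
revert a x. induction n as [|n IH]; intros a x; [apply Hu0c|].
unfold bru in *. cbn [den]. destruct (Nat.eq_dec a (losr n)); [|apply IH].
apply (continuous_plus (den u0 n (a1 n))
   (fun x => den u0 n (a0 n) (brH n (a1 n) x) * exp (brU n (a1 n) x))); [apply IH|].
apply (continuous_mult (fun x => den u0 n (a0 n) (brH n (a1 n) x))).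
- apply (continuous_comp (brH n (a1 n)) (den u0 n (a0 n))); [|apply IH].
  eapply derivable_lim_continuous, brH_deriv.
- eapply derivable_lim_continuous, exp_comp_deriv, brU_deriv.
Qed.

(** Subtracting a constant from the ratio at level [n] amounts to subtracting it from the initial
    density, so repeated subtraction never leaves the family [den]. *)
Lemma den_linear D1 D2 c n a x :
  den (fun a x => D1 a x + c * D2 a x) n a x = den D1 n a x + c * den D2 n a x.
Proof.
revert a x. induction n as [|n IH]; intros a x; [reflexivity|].
cbn [den]. destruct (Nat.eq_dec a (losr n)); rewrite !IH; ring.
Qed.

Lemma brL_ge1 n a x : 1 <= brL n a x.
Proof.
revert a x. induction n as [|n IH]; intros a x; unfold brL in *; cbn [den]; [lra|].
destruct (Nat.eq_dec a (losr n)); [|apply IH].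
pose proof (IH (a1 n) x). pose proof (IH (a0 n) (brH n (a1 n) x)).
pose proof (exp_pos (brU n (a1 n) x)). nra.
Qed.

Lemma brL_pos n a x : 0 < brL n a x.
Proof. pose proof (brL_ge1 n a x). lra. Qed.

Lemma brE_incr n a x y : x < y -> brE n a x < brE n a y.
Proof.
intros Hxy. apply (deriv_incr _ (brL n a)); [exact Hxy| |].
- intros; apply brE_deriv.
- intros; apply brL_pos.
Qed.

Lemma brE_mono n a x y : x <= y -> brE n a x <= brE n a y.
Proof. intros [H| ->]; [left; now apply brE_incr|lra]. Qed.

Lemma bru_bound n a x : Rabs (bru n a x) <= G * brL n a x.
Proof.
revert a x. induction n as [|n IH]; intros a x; unfold bru, brL in *; cbn [den].
- rewrite Rmult_1_r. apply Hu0.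
- destruct (Nat.eq_dec a (losr n)); [|apply IH].
  eapply Rle_trans; [apply Rabs_triang|]. rewrite Rabs_mult.
  rewrite (Rabs_pos_eq (exp _)) by (left; apply exp_pos).
  pose proof (IH (a1 n) x). pose proof (IH (a0 n) (brH n (a1 n) x)).
  pose proof (exp_pos (brU n (a1 n) x)). nra.
Qed.

Lemma brU_dist n a x y : Rabs (brU n a x - brU n a y) <= G * Rabs (brE n a x - brE n a y).
Proof.
assert (Hle : forall x y, x <= y -> Rabs (brU n a x - brU n a y) <= G * Rabs (brE n a x - brE n a y)).
{ clear x y. intros x y Hxy. pose proof (brE_mono n a x y Hxy).
  rewrite (Rabs_minus_sym (brE n a x)), (Rabs_pos_eq (brE n a y - brE n a x)) by lra.
  rewrite Rabs_minus_sym.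
  replace (brU n a y - brU n a x) with (brU n a y - brU n a x - 0 * (brE n a y - brE n a x)) by ring.
  apply (deriv_abs_le (brU n a) (bru n a) (brE n a) (brL n a)); [exact Hxy| | |].
  - intros. apply brU_deriv.
  - intros. apply brE_deriv.
  - intros z _. rewrite Rmult_0_l, Rminus_0_r. apply bru_bound. }
destruct (Rle_or_lt x y) as [Hxy|Hxy]; [now apply Hle|].
rewrite (Rabs_minus_sym (brU n a x)), (Rabs_minus_sym (brE n a x)). apply Hle. lra.
Qed.

(** Both parts of the merged tower increase with [x], so the two differences have the same sign and
    their absolute values add. *)
Lemma brE_los_split n x y :
  Rabs (brE (S n) (losr n) x - brE (S n) (losr n) y) =
  Rabs (brE n (a1 n) x - brE n (a1 n) y) +
  Rabs (brE n (a0 n) (brH n (a1 n) x) - brE n (a0 n) (brH n (a1 n) y)).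
Proof.
unfold brE at 1 2; cbn [coc]. destruct (Nat.eq_dec (losr n) (losr n)); [|congruence].
fold brE.
assert (Hle : forall x y, x <= y -> brE n (a1 n) x <= brE n (a1 n) y /\
  brE n (a0 n) (brH n (a1 n) x) <= brE n (a0 n) (brH n (a1 n) y)).
{ intros x' y' Hxy. split; [now apply brE_mono|]. apply brE_mono. now apply brH_mono. }
destruct (Rle_or_lt x y) as [Hxy|Hxy].
- destruct (Hle x y Hxy).
  rewrite (Rabs_left1 (brE n (a1 n) x - _)), (Rabs_left1 (brE n (a0 n) _ - _)), Rabs_left1 by lra. lra.
- destruct (Hle y x ltac:(lra)).
  rewrite (Rabs_pos_eq (brE n (a1 n) x - _)), (Rabs_pos_eq (brE n (a0 n) _ - _)), Rabs_pos_eq by lra. lra.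
Qed.

(** In the merged tower the second summand is distorted twice, by the density of the upper part and
    by the slope of the lower branch. The two exponents add up to exactly the increment of [brE]
    over the merged tower, so no constant is lost in the induction. *)
Lemma brL_dist n a x y : brL n a x <= brL n a y * exp (G * Rabs (brE n a x - brE n a y)).
Proof.
revert a x y. induction n as [|n IH]; intros a x y.
- unfold brL; cbn [den]. rewrite Rmult_1_l, <- exp_0.
  apply exp_le. apply Rmult_le_pos; [exact HG|apply Rabs_pos].
- destruct (Nat.eq_dec a (losr n)) as [->|Hne].
  + rewrite brE_los_split.
    unfold brL; cbn [den]. destruct (Nat.eq_dec (losr n) (losr n)); [|congruence].
    fold brL.
    pose proof (IH (a1 n) x y) as I1.
    pose proof (IH (a0 n) (brH n (a1 n) x) (brH n (a1 n) y)) as I0.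
    pose proof (brU_dist n (a1 n) x y) as IU.
    set (e1 := Rabs (brE n (a1 n) x - brE n (a1 n) y)) in *.
    set (e0 := Rabs (brE n (a0 n) (brH n (a1 n) x) - brE n (a0 n) (brH n (a1 n) y))) in *.
    assert (0 <= e1) by apply Rabs_pos. assert (0 <= e0) by apply Rabs_pos.
    rewrite Rmult_plus_distr_r. apply Rplus_le_compat.
    * eapply Rle_trans; [exact I1|]. apply Rmult_le_compat_l; [left; apply brL_pos|].
      apply exp_le. nra.
    * assert (HeU : exp (brU n (a1 n) x) <= exp (brU n (a1 n) y) * exp (G * e1)).
      { rewrite <- exp_plus. apply exp_le. apply Rabs_le_between in IU. lra. }
      eapply Rle_trans.
      { apply Rmult_le_compat; [left; apply brL_pos|left; apply exp_pos|exact I0|exact HeU]. }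
      rewrite Rmult_plus_distr_l, exp_plus. right. ring.
  + unfold brL, brE in *; cbn [den coc]. destruct (Nat.eq_dec a (losr n)); [congruence|].
    apply IH.
Qed.

(** * Domains of the branches and conserved totals *)

Variables (lo hi : nat -> nat -> R).
Hypothesis Ha0 : forall n, (a0 n < d)%nat.
Hypothesis Ha1 : forall n, (a1 n < d)%nat.
Hypothesis Ha01 : forall n, a0 n <> a1 n.
Hypothesis Hlh : forall n a, (a < d)%nat -> lo n a < hi n a.
Hypothesis HES : forall n, explicit_step d (ep n) (a0 n) (a1 n) (brH n (a1 n))
   (lo n) (hi n) (lo (S n)) (hi (S n)).

Definition dom (n a : nat) (x : R) : Prop := lo n a <= x <= hi n a.

Lemma losr_lt n : (losr n < d)%nat.
Proof. unfold losr, loser. destruct (ep n); auto. Qed.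

Lemma dom_nonlos n a x : (a < d)%nat -> a <> losr n -> dom (S n) a x -> dom n a x.
Proof.
intros Ha Hne. pose proof (HES n) as [E1 E2]. pose proof (Hlh (S n)) as Hl'. pose proof (Hlh n) as Hl.
unfold losr, loser, dom in *. destruct (ep n).
- destruct E2 as [E2 [E3 [E4 [E5 E6]]]].
  destruct (Nat.eq_dec a (a1 n)) as [->|Hn1].
  + rewrite E3. pose proof (Hl' (a0 n) (Ha0 n)). rewrite E4, E5 in *. lra.
  + destruct (E6 a Ha Hne Hn1) as [-> ->]. auto.
- destruct E2 as [E2 [E3 E4]].
  destruct (Nat.eq_dec a (a0 n)) as [->|Hn1].
  + rewrite E3, E2. pose proof (brH_incr n (a1 n) _ _ (Hl (a1 n) (Ha1 n))). lra.
  + destruct (E4 a Ha Hn1) as [-> ->]. auto.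
Qed.

Lemma dom_los1 n x : dom (S n) (losr n) x -> dom n (a1 n) x.
Proof.
pose proof (HES n) as [E1 E2]. pose proof (Hlh (S n)) as Hl'.
unfold losr, loser, dom in *. destruct (ep n).
- destruct E2 as [E2 [E3 [E4 [E5 E6]]]].
  pose proof (Hl' (a1 n) (Ha1 n)). rewrite E4, E5. rewrite E3 in *. lra.
- destruct E2 as [E2 [E3 E4]].
  destruct (E4 (a1 n) (Ha1 n)) as [-> ->]; [apply not_eq_sym; apply Ha01|]. auto.
Qed.

Lemma dom_los0 n x : dom (S n) (losr n) x -> dom n (a0 n) (brH n (a1 n) x).
Proof.
pose proof (HES n) as [E1 E2]. pose proof (Hlh (S n)) as Hl'.
unfold losr, loser, dom in *. destruct (ep n).
- destruct E2 as [E2 [E3 [E4 [E5 E6]]]]. rewrite E4, E5. intros [Hx1 Hx2].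
  apply (brH_mono n (a1 n)) in Hx1. apply (brH_mono n (a1 n)) in Hx2. lra.
- destruct E2 as [E2 [E3 E4]].
  destruct (E4 (a1 n) (Ha1 n)) as [-> ->]; [apply not_eq_sym; apply Ha01|].
  intros [Hx1 Hx2]. pose proof (Hl' (a0 n) (Ha0 n)).
  apply (brH_mono n (a1 n)) in Hx1. apply (brH_mono n (a1 n)) in Hx2. lra.
Qed.

Definition incrm (P : nat -> nat -> R -> R) (n a : nat) : R := P n a (hi n a) - P n a (lo n a).

(** Only winner and loser change: the piece cut off the tower of the winner is stacked together with
    the tower of the loser, so the total is unaffected. *)
Lemma coc_total P0 n : sumR d (incrm (coc P0) n) = sumR d (incrm (coc P0) 0).
Proof.
induction n as [|n IH]; [reflexivity|]. rewrite <- IH.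
pose proof (HES n) as [E1 E2]. pose proof (Ha01 n) as H01.
rewrite (sumR_upd2 d (incrm (coc P0) n) _ (a0 n) (a1 n)); auto.
- unfold incrm. cbn [coc]. unfold losr, loser. destruct (ep n).
  + destruct E2 as [E2 [E3 [E4 [E5 E6]]]].
    destruct (Nat.eq_dec (a0 n) (a0 n)), (Nat.eq_dec (a1 n) (a0 n)); try congruence.
    rewrite E4, E5, E3, E1, E2. lra.
  + destruct E2 as [E2 [E3 E4]].
    destruct (Nat.eq_dec (a0 n) (a1 n)), (Nat.eq_dec (a1 n) (a1 n)); try congruence.
    destruct (E4 (a1 n) (Ha1 n)) as [-> ->]; [congruence|].
    rewrite E2, E3, E1. lra.
- intros a Ha Hn0 Hn1. unfold incrm. cbn [coc]. unfold losr, loser.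
  destruct (ep n).
  + destruct E2 as [E2 [E3 [E4 [E5 E6]]]].
    destruct (E6 a Ha Hn0 Hn1) as [-> ->]. destruct (Nat.eq_dec a (a0 n)); congruence.
  + destruct E2 as [E2 [E3 E4]]. destruct (E4 a Ha Hn0) as [-> ->].
    destruct (Nat.eq_dec a (a1 n)); congruence.
Qed.

(** The displacement [brH n a x - x] is itself additive along towers, hence its total is conserved
    too. *)
Lemma brH_total n :
  sumR d (incrm brH n) - sumR d (fun a => hi n a - lo n a) =
  sumR d (incrm brH 0) - sumR d (fun a => hi 0%nat a - lo 0%nat a).
Proof.
induction n as [|n IH]; [reflexivity|]. rewrite <- IH.
pose proof (HES n) as [E1 E2]. pose proof (Ha01 n) as H01.
rewrite (sumR_upd2 d (incrm brH n) (incrm brH (S n)) (a0 n) (a1 n)); auto.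
- rewrite (sumR_upd2 d (fun a => hi n a - lo n a) (fun a => hi (S n) a - lo (S n) a) (a0 n) (a1 n)); auto.
  + unfold incrm. cbn [brH]. unfold losr, loser. destruct (ep n).
    * destruct E2 as [E2 [E3 [E4 [E5 E6]]]].
      destruct (Nat.eq_dec (a0 n) (a0 n)), (Nat.eq_dec (a1 n) (a0 n)); try congruence.
      rewrite E4, E5, E3, E1, E2. lra.
    * destruct E2 as [E2 [E3 E4]].
      destruct (Nat.eq_dec (a0 n) (a1 n)), (Nat.eq_dec (a1 n) (a1 n)); try congruence.
      destruct (E4 (a1 n) (Ha1 n)) as [-> ->]; [congruence|].
      rewrite E2, E3, E1. lra.
  + intros a Ha Hn0 Hn1. destruct (ep n).
    * destruct E2 as [E2 [E3 [E4 [E5 E6]]]]. destruct (E6 a Ha Hn0 Hn1) as [-> ->]. reflexivity.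
    * destruct E2 as [E2 [E3 E4]]. destruct (E4 a Ha Hn0) as [-> ->]. reflexivity.
- intros a Ha Hn0 Hn1. unfold incrm. cbn [brH]. unfold losr, loser.
  destruct (ep n).
  + destruct E2 as [E2 [E3 [E4 [E5 E6]]]].
    destruct (E6 a Ha Hn0 Hn1) as [-> ->]. destruct (Nat.eq_dec a (a0 n)); congruence.
  + destruct E2 as [E2 [E3 E4]]. destruct (E4 a Ha Hn0) as [-> ->].
    destruct (Nat.eq_dec a (a1 n)); congruence.
Qed.

Hypothesis Hlen0 : sumR d (fun a => hi 0%nat a - lo 0%nat a) = 1.

Lemma brE_total n : sumR d (incrm brE n) = 1.
Proof. unfold brE. rewrite coc_total. exact Hlen0. Qed.

Lemma incrm_brE_pos n a : (a < d)%nat -> 0 < incrm brE n a.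
Proof. intros Ha. unfold incrm. pose proof (brE_incr n a _ _ (Hlh n a Ha)). lra. Qed.

Lemma incrm_brE_le1 n a : (a < d)%nat -> incrm brE n a <= 1.
Proof.
intros Ha. rewrite <- (brE_total n). apply sumR_term_le; [exact Ha|].
intros b Hb. left. now apply incrm_brE_pos.
Qed.

Lemma brE_dist_le1 n a x y : (a < d)%nat -> dom n a x -> dom n a y ->
  Rabs (brE n a x - brE n a y) <= 1.
Proof.
intros Ha [Hx1 Hx2] [Hy1 Hy2]. pose proof (incrm_brE_le1 n a Ha) as Hi. unfold incrm in Hi.
apply (brE_mono n a) in Hx1, Hx2, Hy1, Hy2. apply Rabs_le. lra.
Qed.

(** The tower over a letter has total length at most 1, so the distortion bound is uniform in the
    level. It limits the variation inside one letter only. *)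
Lemma brU_osc n a x y : (a < d)%nat -> dom n a x -> dom n a y -> Rabs (brU n a x - brU n a y) <= G.
Proof.
intros Ha Hx Hy. eapply Rle_trans; [apply brU_dist|].
pose proof (brE_dist_le1 n a x y Ha Hx Hy). nra.
Qed.

Lemma brL_osc n a x y : (a < d)%nat -> dom n a x -> dom n a y -> brL n a x <= exp G * brL n a y.
Proof.
intros Ha Hx Hy. eapply Rle_trans; [apply (brL_dist n a x y)|]. rewrite Rmult_comm.
apply Rmult_le_compat_r; [left; apply brL_pos|]. apply exp_le.
pose proof (brE_dist_le1 n a x y Ha Hx Hy). nra.
Qed.

(** * Bounded slopes *)

(** The only new end point is the cut on the right of the winner, with log-slope [w]. The same [w]
    enters the left end of the loser, whose composed branch passes through the cut. The point [z]
    records that [w] is a value attained on the old domain of the winner, hence controlled by its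
    block. *)
Lemma endpoint_logs n : exists w,
  (forall a, (a < d)%nat -> a <> a0 n -> a <> a1 n ->
     brU (S n) a (lo (S n) a) = brU n a (lo n a) /\ brU (S n) a (hi (S n) a) = brU n a (hi n a)) /\
  (if ep n then
     brU (S n) (a1 n) (lo (S n) (a1 n)) = brU n (a1 n) (lo n (a1 n)) /\
     brU (S n) (a1 n) (hi (S n) (a1 n)) = w /\
     brU (S n) (a0 n) (lo (S n) (a0 n)) = w + brU n (a0 n) (lo n (a0 n)) /\
     brU (S n) (a0 n) (hi (S n) (a0 n)) = brU n (a1 n) (hi n (a1 n)) + brU n (a0 n) (hi n (a0 n)) /\
     exists z, dom n (a1 n) z /\ w = brU n (a1 n) z
   else
     brU (S n) (a0 n) (lo (S n) (a0 n)) = brU n (a0 n) (lo n (a0 n)) /\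
     brU (S n) (a0 n) (hi (S n) (a0 n)) = w /\
     brU (S n) (a1 n) (lo (S n) (a1 n)) = brU n (a1 n) (lo n (a1 n)) + w /\
     brU (S n) (a1 n) (hi (S n) (a1 n)) = brU n (a1 n) (hi n (a1 n)) + brU n (a0 n) (hi n (a0 n)) /\
     exists z, dom n (a0 n) z /\ w = brU n (a0 n) z).
Proof.
pose proof (HES n) as [E1 E2]. pose proof (Ha01 n) as H01.
assert (Hlos : forall x, brU (S n) (losr n) x = brU n (a1 n) x + brU n (a0 n) (brH n (a1 n) x)).
{ intros x. unfold brU. cbn [coc]. destruct (Nat.eq_dec (losr n) (losr n)); congruence. }
assert (Hnon : forall a x, a <> losr n -> brU (S n) a x = brU n a x).
{ intros a x Hne. unfold brU. cbn [coc]. destruct (Nat.eq_dec a (losr n)); congruence. }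
assert (Hdom1 : dom (S n) (losr n) (lo (S n) (losr n))).
{ pose proof (Hlh (S n) (losr n) (losr_lt n)). unfold dom; lra. }
unfold losr, loser in *. destruct (ep n) eqn:Ee.
- destruct E2 as [E2 [E3 [E4 [E5 E6]]]]. exists (brU n (a1 n) (hi (S n) (a1 n))). split.
  + intros a Ha Hn0 Hn1. rewrite !Hnon by congruence. destruct (E6 a Ha Hn0 Hn1) as [-> ->]. auto.
  + rewrite !Hlos, !Hnon by congruence. rewrite E5, E4, E3, E2, E1. repeat split.
    exists (hi (S n) (a1 n)). split; [|reflexivity].
    pose proof (dom_los1 n (lo (S n) (a0 n))) as D1. unfold losr, loser in D1. rewrite Ee in D1.
    specialize (D1 Hdom1). rewrite E4 in D1. exact D1.
- destruct E2 as [E2 [E3 E4]]. exists (brU n (a0 n) (hi (S n) (a0 n))). split.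
  + intros a Ha Hn0 Hn1. rewrite !Hnon by congruence. destruct (E4 a Ha Hn0) as [-> ->]. auto.
  + destruct (E4 (a1 n) (Ha1 n)) as [F1 F2]; [congruence|].
    rewrite !Hlos, !Hnon by congruence. rewrite F1, F2, E2, E3, E1. repeat split.
    exists (brH n (a1 n) (lo n (a1 n))). split; [|reflexivity].
    pose proof (dom_los0 n (lo (S n) (a1 n))) as D1. unfold losr, loser in D1. rewrite Ee in D1.
    specialize (D1 Hdom1). rewrite F1 in D1. exact D1.
Qed.

Section Slopes.

Variables (As Bs Cs : nat -> list nat) (K : nat).
Hypothesis Hlists : forall n, lists_step (ep n) (As n, Bs n, Cs n) (As (S n), Bs (S n), Cs (S n)).
Hypothesis Hperm : forall n, Permutation (As n ++ Bs n ++ Cs n) (seq 0 d).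
Hypothesis HAne : forall n, As n <> [].
Hypothesis HCne : forall n, Cs n <> [].
Hypothesis HAl : forall n, a1 n = last0 (As n).
Hypothesis HCl : forall n, a0 n = last0 (Cs n).
Hypothesis Hlose : forall n c, (c < d)%nat -> exists j, (n <= j < n + K)%nat /\ losr j = c.
Hypothesis HHtot : sumR d (incrm brH 0) = sumR d (fun a => hi 0%nat a - lo 0%nat a).
Hypothesis Hd0 : (0 < d)%nat.

Lemma lists_nodup n : NoDup (As n ++ Bs n ++ Cs n).
Proof. eapply Permutation_NoDup; [apply Permutation_sym, Hperm|apply seq_NoDup]. Qed.

Lemma lists_lt n a : In a (As n ++ Bs n ++ Cs n) <-> (a < d)%nat.
Proof.
split; intros H.
- apply (Permutation_in a (Hperm n)) in H. apply in_seq in H. lia.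
- apply (Permutation_in a (Permutation_sym (Hperm n))). apply in_seq. lia.
Qed.

Lemma jumps_bounded : exists J, 0 <= J /\ forall n,
  jumps (fun a => brU n a (lo n a)) (fun a => brU n a (hi n a)) J (As n, Bs n, Cs n).
Proof.
destruct (finite_upper_bound (fun a => Rabs (brU 0 a (lo 0%nat a)) + Rabs (brU 0 a (hi 0%nat a))) d) as [M HM].
assert (HM2 : forall a, (a < d)%nat -> - M <= brU 0 a (lo 0%nat a) <= M /\ - M <= brU 0 a (hi 0%nat a) <= M).
{ intros a Ha. specialize (HM a Ha). simpl in HM.
  pose proof (Rabs_pos (brU 0 a (lo 0%nat a))). pose proof (Rabs_pos (brU 0 a (hi 0%nat a))).
  split; apply Rabs_le_between; lra. }
assert (HMpos : 0 <= M) by (specialize (HM2 0%nat Hd0); lra).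
(* A jump compares at most four end values, each at most [M] in absolute value. Since jumps are
   carried over unchanged, the bound at level 0 serves all levels. *)
exists (4 * M). split; [lra|]. induction n as [|n IH].
- assert (Hin : forall a, In a (As 0%nat ++ Bs 0%nat ++ Cs 0%nat) -> (a < d)%nat) by (intros a; apply lists_lt).
  assert (Hlinked : forall l, (forall a, In a l -> (a < d)%nat) ->
    linked (fun a => brU 0 a (lo 0%nat a)) (fun a => brU 0 a (hi 0%nat a)) (4 * M) l).
  { induction l as [|b l IHl]; intros Hl; [exact I|]. split.
    - destruct l as [|c l]; [exact I|].
      pose proof (HM2 b (Hl b (or_introl eq_refl))). pose proof (HM2 c (Hl c (or_intror (or_introl eq_refl)))).
      unfold near. lra.
    - apply IHl. intros a Ha. apply Hl. now right. }
  assert (HA : forall a, In a (As 0%nat) -> (a < d)%nat) by (intros; apply Hin; in_app).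
  assert (HB : forall a, In a (Bs 0%nat) -> (a < d)%nat).
  { intros; apply Hin; in_app. }
  assert (HC : forall a, In a (Cs 0%nat) -> (a < d)%nat).
  { intros; apply Hin; in_app. }
  pose proof (HM2 _ (HA _ (hd_in _ (HAne 0%nat)))). pose proof (HM2 _ (HA _ (last_in _ (HAne 0%nat)))).
  pose proof (HM2 _ (HC _ (hd_in _ (HCne 0%nat)))). pose proof (HM2 _ (HC _ (last_in _ (HCne 0%nat)))).
  split; [now apply Hlinked|]. split; [now apply Hlinked|]. split; [now apply Hlinked|].
  destruct (Bs 0%nat) as [|b B] eqn:EB.
  + unfold near. lra.
  + pose proof (HM2 _ (HB _ (or_introl eq_refl))).
    pose proof (HM2 _ (HB _ (last_in (b :: B) ltac:(discriminate)))).
    unfold near. lra.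
- destruct (endpoint_logs n) as [w [W1 W2]].
  eapply (jumps_step (ep n) (As n) (Bs n) (Cs n) _ _ _ _ _ w (4 * M) (a0 n) (a1 n)); auto.
  + apply lists_nodup.
  + intros a Ha Hn0 Hn1. apply lists_lt in Ha. now apply W1.
  + destruct (ep n); destruct W2 as [V1 [V2 [V3 [V4 _]]]]; auto.
  + exact IH.
Qed.

Lemma near_weaken E E' x y : E <= E' -> near E x y -> near E' x y.
Proof. unfold near. lra. Qed.

Lemma block_values : exists E, 0 <= E /\ forall n a x, dom n a x ->
  let u := brU n (hd0 (As n)) (lo n (hd0 (As n))) in
  let v := brU n (hd0 (Cs n)) (lo n (hd0 (Cs n))) in
  (In a (As n) -> near E (brU n a x) u) /\ (In a (Cs n) -> near E (brU n a x) v) /\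
  (In a (Bs n) -> near E (brU n a x) (u + v)).
Proof.
destruct jumps_bounded as [J [HJ0 HJ]].
set (E0 := (J + G) * INR d).
assert (HE0 : 0 <= E0) by (unfold E0; pose proof (pos_INR d); nra).
(* One [E0] for the spread inside each of the three blocks, [J] for the jump from the outer blocks
   to the head of [B], and [G] for the oscillation inside a letter. *)
exists (3 * E0 + J + G). split; [lra|]. intros n a x Hx u v.
destruct (HJ n) as [LA [LB [LC Hjun]]].
set (sl := fun a => brU n a (lo n a)) in *. set (sr := fun a => brU n a (hi n a)) in *.
assert (Hlt : forall b, In b (As n ++ Bs n ++ Cs n) -> (b < d)%nat) by (intros b; apply lists_lt).
assert (Hosc : forall b, (b < d)%nat -> near G (sl b) (sr b)).
{ intros b Hb. pose proof (Hlh n b Hb).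
  assert (H1 : Rabs (brU n b (lo n b) - brU n b (hi n b)) <= G) by (apply brU_osc; auto; unfold dom; lra).
  apply Rabs_le_between in H1. exact H1. }
assert (Hxo : (a < d)%nat -> near G (brU n a x) (sl a)).
{ intros Hb. pose proof (Hlh n a Hb).
  assert (H1 : Rabs (brU n a x - brU n a (lo n a)) <= G) by (apply brU_osc; auto; unfold dom; lra).
  apply Rabs_le_between in H1. exact H1. }
assert (Hlen : (length (As n) <= d /\ length (Bs n) <= d /\ length (Cs n) <= d)%nat).
{ pose proof (Permutation_length (Hperm n)) as Hl. rewrite !length_app, length_seq in Hl. lia. }
assert (HinA : forall b, In b (As n) -> (b < d)%nat) by (intros; apply Hlt; in_app).
assert (HinB : forall b, In b (Bs n) -> (b < d)%nat).
{ intros; apply Hlt; in_app. }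
assert (HinC : forall b, In b (Cs n) -> (b < d)%nat).
{ intros; apply Hlt; in_app. }
assert (Hle : forall l : list nat, (length l <= d)%nat -> (J + G) * INR (length l) <= E0).
{ intros l Hl. unfold E0. apply le_INR in Hl. apply Rmult_le_compat_l; lra. }
destruct (linked_spread sl sr J G (As n) HJ0 HG LA ltac:(auto)) as [A1 A2].
destruct (linked_spread sl sr J G (Bs n) HJ0 HG LB ltac:(auto)) as [B1 B2].
destruct (linked_spread sl sr J G (Cs n) HJ0 HG LC ltac:(auto)) as [C1 C2].
specialize (A2 (HAne n)). specialize (C2 (HCne n)).
apply (near_weaken _ E0) in A2; [|apply Hle; apply Hlen].
apply (near_weaken _ E0) in C2; [|apply Hle; apply Hlen].
assert (Eu : u = sl (hd0 (As n))) by reflexivity.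
assert (Ev : v = sl (hd0 (Cs n))) by reflexivity.
clearbody u v. rewrite <- Eu in A1, A2. rewrite <- Ev in C1, C2.
split; [|split]; intros Ha.
- specialize (A1 a Ha). apply (near_weaken _ E0) in A1; [|apply Hle; apply Hlen].
  specialize (Hxo (HinA a Ha)). unfold near in *. lra.
- specialize (C1 a Ha). apply (near_weaken _ E0) in C1; [|apply Hle; apply Hlen].
  specialize (Hxo (HinC a Ha)). unfold near in *. lra.
- specialize (B1 a Ha). apply (near_weaken _ E0) in B1; [|apply Hle; apply Hlen].
  specialize (Hxo (HinB a Ha)). clear HinB LB B2. destruct (Bs n) as [|b B]; [destruct Ha|].
  destruct Hjun as [Hj1 _]. simpl hd in B1. unfold near, sl, sr in *. cbv beta in *. lra.
Qed.

(** Domains and images have the same total length at every level. Were all slopes above 1, or all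
    below 1, integrating them would contradict this. *)
Lemma some_slope_sign n :
  (exists a x, (a < d)%nat /\ dom n a x /\ brU n a x <= 0) /\
  (exists a x, (a < d)%nat /\ dom n a x /\ 0 <= brU n a x).
Proof.
assert (Htot : sumR d (incrm brH n) = sumR d (fun a => hi n a - lo n a)).
{ pose proof (brH_total n) as H. lra. }
split; apply NNPP; intros Hno.
- assert (sumR d (fun a => hi n a - lo n a) < sumR d (incrm brH n)); [|lra].
  apply sumR_lt; [exact Hd0|]. intros a Ha. unfold incrm. pose proof (Hlh n a Ha) as Hl.
  assert (brH n a (lo n a) - lo n a < brH n a (hi n a) - hi n a); [|lra].
  apply (deriv_incr (fun z => brH n a z - z) (fun z => exp (brU n a z) - 1)); [exact Hl| |].
  + intros z _. apply derivable_pt_lim_minus; [apply brH_deriv|apply derivable_pt_lim_id].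
  + intros z Hz. assert (0 < brU n a z).
    { apply Rnot_le_lt. intros Hle. apply Hno. exists a, z. auto. }
    rewrite <- exp_0. assert (exp 0 < exp (brU n a z)) by (now apply exp_increasing). lra.
- assert (sumR d (incrm brH n) < sumR d (fun a => hi n a - lo n a)); [|lra].
  apply sumR_lt; [exact Hd0|]. intros a Ha. unfold incrm. pose proof (Hlh n a Ha) as Hl.
  assert (lo n a - brH n a (lo n a) < hi n a - brH n a (hi n a)); [|lra].
  apply (deriv_incr (fun z => z - brH n a z) (fun z => 1 - exp (brU n a z))); [exact Hl| |].
  + intros z _. apply derivable_pt_lim_minus; [apply derivable_pt_lim_id|apply brH_deriv].
  + intros z Hz. assert (brU n a z < 0).
    { apply Rnot_le_lt. intros Hle. apply Hno. exists a, z. auto. }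
    rewrite <- exp_0. assert (exp (brU n a z) < exp 0) by (now apply exp_increasing). lra.
Qed.

Lemma lists_disjoint n x y : In x (As n) -> In y (Cs n) -> x <> y.
Proof.
intros Hx Hy ->. pose proof (lists_nodup n) as Hnd.
apply in_split in Hx. destruct Hx as [l1 [l2 Hx]]. rewrite Hx in Hnd.
rewrite <- app_assoc in Hnd. simpl in Hnd. apply NoDup_remove_2 in Hnd.
apply Hnd. in_app.
Qed.

(** The heads of [A] and [C] represent their blocks. The loser ends an outer block, so it is a head
    only if that block has a single letter; exactly then the block absorbs [B], and the log-slope of
    the winning block is added to that of the head. *)
Lemma step_cases n :
  (ep n = false /\ As n = [a1 n] /\ hd0 (As (S n)) = a1 n /\ Cs (S n) = Cs n) \/
  (ep n = true /\ Cs n = [a0 n] /\ hd0 (Cs (S n)) = a0 n /\ As (S n) = As n) \/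
  (hd0 (As (S n)) = hd0 (As n) /\ hd0 (Cs (S n)) = hd0 (Cs n) /\
   losr n <> hd0 (As n) /\ losr n <> hd0 (Cs n)).
Proof.
pose proof (HAl n) as Ha. pose proof (HCl n) as Hc. pose proof (Hlists n) as Hs.
pose proof (lists_nodup n) as Hnd. pose proof (lists_disjoint n) as Hdis.
pose proof (HAne n) as HA. pose proof (HCne n) as HC. unfold losr, loser.
remember (As n, Bs n, Cs n) as t eqn:Et. remember (As (S n), Bs (S n), Cs (S n)) as t' eqn:Et'.
destruct Hs as [A' c1 B0 C0 HA'|c1 B0 C0|A0 B0 C' c0 HC'|A0 B0 c0];
  injection Et as EA EB EC; injection Et' as EA' EB' EC'; rewrite <- EA, <- EC in *; rewrite <- EA', <- EC' in *.
- right; right. rewrite last_last in Ha. rewrite hd_app_nonnil by exact HA'.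
  split; [reflexivity|]. split; [reflexivity|]. split.
  + intros E. rewrite <- !app_assoc in Hnd. simpl in Hnd. apply NoDup_remove_2 in Hnd. apply Hnd.
    apply in_or_app. left. rewrite <- Ha, E. now apply hd_in.
  + apply Hdis; [rewrite Ha; apply in_or_app; right; simpl; tauto|now apply hd_in].
- left. simpl in Ha. subst c1. auto.
- right; right. rewrite last_last in Hc. rewrite hd_app_nonnil by exact HC'.
  split; [reflexivity|]. split; [reflexivity|]. split.
  + apply not_eq_sym. apply Hdis; [now apply hd_in|rewrite Hc; apply in_or_app; right; simpl; tauto].
  + intros E. rewrite !app_assoc in Hnd. apply NoDup_remove_2 in Hnd. apply Hnd.
    rewrite app_nil_r. apply in_or_app. right. rewrite <- Hc, E. now apply hd_in.
- right; left. simpl in Hc. subst c0. auto.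
Qed.

(** Every letter loses within each window of length [K]; if [h] has not changed until then, the loss
    falls on it and produces the event [ch]. *)
Lemma head_loses (h : nat -> nat) (ch : nat -> Prop) :
  (forall n, (h n < d)%nat) -> (forall n, ~ ch n -> h (S n) = h n) -> (forall n, losr n = h n -> ch n) ->
  forall n, exists j, (n <= j < n + K)%nat /\ ch j.
Proof.
intros Hlt Hkeep Hch n. apply NNPP. intros Hno.
assert (Hi : forall i, (i <= K)%nat -> h (n + i)%nat = h n).
{ induction i as [|i IH]; intros Hi; [now rewrite Nat.add_0_r|].
  rewrite Nat.add_succ_r, <- IH by lia. apply Hkeep. intros Hc. apply Hno. exists (n + i)%nat.
  split; [lia|exact Hc]. }
destruct (Hlose n (h n) (Hlt n)) as [j [Hj1 Hj2]]. apply Hno. exists j. split; [exact Hj1|]. apply Hch.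
rewrite Hj2, <- (Hi (j - n)%nat) by lia. f_equal. lia.
Qed.

Lemma slopes_bounded : exists Sl, forall n a x, (a < d)%nat -> dom n a x -> Rabs (brU n a x) <= Sl.
Proof.
destruct block_values as [E [HE Hblk]].
set (u := fun n => brU n (hd0 (As n)) (lo n (hd0 (As n)))) in *.
set (v := fun n => brU n (hd0 (Cs n)) (lo n (hd0 (Cs n)))) in *.
assert (HinA : forall n b, In b (As n) -> (b < d)%nat).
{ intros n b Hb. apply (lists_lt n). in_app. }
assert (HinC : forall n b, In b (Cs n) -> (b < d)%nat).
{ intros n b Hb. apply (lists_lt n). in_app. }
assert (Hself : forall x, near E x x) by (intros; unfold near; lra).
assert (Ha1in : forall n, In (a1 n) (As n)) by (intros n; rewrite HAl; now apply last_in).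
assert (Ha0in : forall n, In (a0 n) (Cs n)) by (intros n; rewrite HCl; now apply last_in).
assert (Hhd : forall n a, (a < d)%nat -> a <> losr n ->
  brU (S n) a (lo (S n) a) = brU n a (lo n a)).
{ intros n a Ha Hne. destruct (endpoint_logs n) as [w [W1 W2]].
  unfold losr, loser in Hne. destruct (ep n).
  - destruct (Nat.eq_dec a (a1 n)) as [->|]; [apply W2|now apply W1].
  - destruct (Nat.eq_dec a (a0 n)) as [->|]; [apply W2|now apply W1]. }
(* The winner [a0 n] belongs to [C], so its log-slope [w] at the cut is within [E] of [v n]: the
   head of [A] gains [v] up to [E]. *)
assert (HaddA : forall n, ep n = false -> As n = [a1 n] -> hd0 (As (S n)) = a1 n -> Cs (S n) = Cs n ->
  add_step u v E n).
{ intros n Ee HA1 HA2 HC1. destruct (endpoint_logs n) as [w [_ W2]]. rewrite Ee in W2.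
  destruct W2 as [V1 [V2 [V3 [V4 [z [Hz Hw]]]]]].
  destruct (Hblk n (a0 n) z Hz) as [_ [Hbz _]]. specialize (Hbz (Ha0in n)). rewrite <- Hw in Hbz.
  split.
  - unfold u at 1 2. rewrite HA2, HA1, V3. simpl hd. fold (v n) in Hbz. unfold near in *. lra.
  - unfold v. rewrite HC1. rewrite Hhd; [apply Hself|apply (HinC n); now apply hd_in|].
    unfold losr, loser. rewrite Ee. apply not_eq_sym. apply (lists_disjoint n); [apply Ha1in|now apply hd_in]. }
assert (HaddC : forall n, ep n = true -> Cs n = [a0 n] -> hd0 (Cs (S n)) = a0 n -> As (S n) = As n ->
  add_step v u E n).
{ intros n Ee HC1 HC2 HA1. destruct (endpoint_logs n) as [w [_ W2]]. rewrite Ee in W2.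
  destruct W2 as [V1 [V2 [V3 [V4 [z [Hz Hw]]]]]].
  destruct (Hblk n (a1 n) z Hz) as [Hbz _]. specialize (Hbz (Ha1in n)). rewrite <- Hw in Hbz.
  split.
  - unfold v at 1 2. rewrite HC2, HC1, V3. simpl hd. fold (u n) in Hbz. unfold near in *. lra.
  - unfold u. rewrite HA1. rewrite Hhd; [apply Hself|apply (HinA n); now apply hd_in|].
    unfold losr, loser. rewrite Ee. apply (lists_disjoint n); [now apply hd_in|apply Ha0in]. }
assert (Hbal : balanced_pair u v E K).
{ split; [exact HE|]. split; [|split; [|split]].
  - intros n. destruct (step_cases n) as [[E1 [E2 [E3 E4]]]|[[E1 [E2 [E3 E4]]]|[E1 [E2 [E3 E4]]]]].
    + right; left. now apply HaddA.
    + right; right. now apply HaddC.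
    + left. split.
      * unfold u. rewrite E1. rewrite Hhd; [apply Hself|apply (HinA n); now apply hd_in|congruence].
      * unfold v. rewrite E2. rewrite Hhd; [apply Hself|apply (HinC n); now apply hd_in|congruence].
  - apply (head_loses (fun n => hd0 (As n))).
    + intros n. apply (HinA n). now apply hd_in.
    + intros n Hno. destruct (step_cases n) as [[E1 [E2 [E3 E4]]]|[[E1 [E2 [E3 E4]]]|[E1 _]]]; auto.
      * exfalso. apply Hno. now apply HaddA.
      * now rewrite E4.
    + intros n Hl. destruct (step_cases n) as [[E1 [E2 [E3 E4]]]|[[E1 _]|[_ [_ [E3 _]]]]]; auto.
      * unfold losr, loser in Hl. rewrite E1 in Hl. exfalso.
        apply (lists_disjoint n (hd0 (As n)) (a0 n)); [now apply hd_in|apply Ha0in|congruence].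
      * congruence.
  - apply (head_loses (fun n => hd0 (Cs n))).
    + intros n. apply (HinC n). now apply hd_in.
    + intros n Hno. destruct (step_cases n) as [[E1 [E2 [E3 E4]]]|[[E1 [E2 [E3 E4]]]|[_ [E2 _]]]]; auto.
      * now rewrite E4.
      * exfalso. apply Hno. now apply HaddC.
    + intros n Hl. destruct (step_cases n) as [[E1 _]|[[E1 [E2 [E3 E4]]]|[_ [_ [_ E4]]]]]; auto.
      * unfold losr, loser in Hl. rewrite E1 in Hl. exfalso.
        apply (lists_disjoint n (a1 n) (hd0 (Cs n))); [apply Ha1in|now apply hd_in|congruence].
      * congruence.
  (* A log-slope of sign at most 0 in [A] or [C] bounds that entry by [E]; in [B] it bounds [u + v]
     by [E], so the entries cannot both exceed [E]. The other sign is alike. *)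
  - intros n. destruct (some_slope_sign n) as [[a [x [Ha [Hx Hs]]]] [b [y [Hb [Hy Ht]]]]].
    assert (Hin : forall c, (c < d)%nat -> In c (As n) \/ In c (Cs n) \/ In c (Bs n)).
    { intros c Hc. apply (lists_lt n) in Hc. apply in_app_or in Hc. destruct Hc as [Hc|Hc]; [now left|].
      apply in_app_or in Hc. tauto. }
    destruct (Hblk n a x Hx) as [P1 [P2 P3]]. destruct (Hblk n b y Hy) as [Q1 [Q2 Q3]].
    fold (u n) in *. fold (v n) in *. unfold near in *.
    split.
    + destruct (Hin a Ha) as [Hi|[Hi|Hi]]; [specialize (P1 Hi)|specialize (P2 Hi)|specialize (P3 Hi)].
      * left; lra.
      * right; lra.
      * destruct (Rle_or_lt (u n) E); [now left|right; lra].
    + destruct (Hin b Hb) as [Hi|[Hi|Hi]]; [specialize (Q1 Hi)|specialize (Q2 Hi)|specialize (Q3 Hi)].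
      * left; lra.
      * right; lra.
      * destruct (Rle_or_lt (- E) (u n)); [now left|right; lra]. }
destruct (balanced_bounded u v E K Hbal) as [M HM].
exists (2 * M + E). intros n a x Ha Hx.
destruct (HM n) as [M1 M2]. apply Rabs_le_between in M1. apply Rabs_le_between in M2.
destruct (Hblk n a x Hx) as [P1 [P2 P3]]. fold (u n) in *. fold (v n) in *. unfold near in *.
apply Rabs_le.
apply (lists_lt n) in Ha. apply in_app_or in Ha. destruct Ha as [Ha|Ha]; [specialize (P1 Ha); lra|].
apply in_app_or in Ha. destruct Ha as [Ha|Ha]; [specialize (P3 Ha)|specialize (P2 Ha)]; lra.
Qed.

End Slopes.

(** * Contraction of densities *)

Section Contraction.

Variables (Sl : R) (K : nat).
Hypothesis Hd : (0 < d)%nat.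
Hypothesis HSl : forall n a x, (a < d)%nat -> dom n a x -> Rabs (brU n a x) <= Sl.
Hypothesis Hpath : forall n b c, (b < d)%nat -> (c < d)%nat ->
  exists n1 p, (n <= n1)%nat /\ (n1 + p < n + K)%nat /\ winr n1 = b /\ losr (n1 + p) = c /\
    forall i, (i < p)%nat -> losr (n1 + i) = winr (n1 + i + 1).

Lemma Sl_nonneg : 0 <= Sl.
Proof.
pose proof (Hlh 0 0 Hd) as H.
pose proof (HSl 0%nat 0%nat (lo 0%nat 0%nat) Hd ltac:(unfold dom; lra)) as H1.
pose proof (Rabs_pos (brU 0 0 (lo 0%nat 0%nat))). lra.
Qed.

Lemma expU_le n a x : (a < d)%nat -> dom n a x -> exp (- Sl) <= exp (brU n a x) <= exp Sl.
Proof.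
intros Ha Hx. pose proof (HSl n a x Ha Hx) as H. apply Rabs_le_between in H.
split; apply exp_le; lra.
Qed.

Lemma den_los D0 n x : den D0 (S n) (losr n) x =
  den D0 n (a1 n) x + den D0 n (a0 n) (brH n (a1 n) x) * exp (brU n (a1 n) x).
Proof. cbn [den]. destruct (Nat.eq_dec (losr n) (losr n)); congruence. Qed.

Lemma den_nonlos D0 n a x : a <> losr n -> den D0 (S n) a x = den D0 n a x.
Proof. intros Hne. cbn [den]. destruct (Nat.eq_dec a (losr n)); congruence. Qed.

Lemma brE_nonlos n a x : a <> losr n -> brE (S n) a x = brE n a x.
Proof. intros Hne. unfold brE. cbn [coc]. destruct (Nat.eq_dec a (losr n)); congruence. Qed.

(** [Q n a v] stands for a bound [v] valid on the letter [a] at level [n]. It survives on its letter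
    and passes from winner to loser; since each loser of the chain wins the next step, it travels
    from [b] to [c]. Idle steps are charged [kap] as well, which makes the exponent exactly [K]. *)
Lemma path_spread (Q : nat -> nat -> R -> Prop) (kap : R) :
  (forall n a v, (a < d)%nat -> Q n a v -> Q (S n) a (kap * v)) ->
  (forall n v, Q n (winr n) v -> Q (S n) (losr n) (kap * v)) ->
  forall n b c v, (b < d)%nat -> (c < d)%nat -> Q n b v -> Q (n + K)%nat c (kap ^ K * v).
Proof.
intros Hstep Hwin n b c v Hb Hc HQ.
assert (Hmany : forall j n a v, (a < d)%nat -> Q n a v -> Q (n + j)%nat a (kap ^ j * v)).
{ clear - Hstep. induction j as [|j IH]; intros n a v Ha HQ.
  - rewrite Nat.add_0_r, pow_O, Rmult_1_l. exact HQ.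
  - rewrite Nat.add_succ_r. simpl. rewrite Rmult_assoc. apply Hstep; [exact Ha|]. now apply IH. }
destruct (Hpath n b c Hb Hc) as [n1 [p [Hn1 [Hn2 [Hw [Hl Hchain]]]]]].
assert (Hq1 : Q n1 b (kap ^ (n1 - n) * v)).
{ replace n1 with (n + (n1 - n))%nat at 1 by lia. now apply Hmany. }
assert (Hq2 : forall i, (i <= p)%nat ->
   Q (S (n1 + i)) (losr (n1 + i)) (kap ^ (S i) * (kap ^ (n1 - n) * v))).
{ induction i as [|i IH]; intros Hi.
  - rewrite Nat.add_0_r. rewrite pow_1. apply Hwin. now rewrite Hw.
  - specialize (IH ltac:(lia)). rewrite (Hchain i ltac:(lia)) in IH.
    replace (n1 + S i)%nat with (n1 + i + 1)%nat by lia.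
    replace (S (n1 + i)) with (n1 + i + 1)%nat in IH by lia.
    apply Hwin in IH. rewrite <- Rmult_assoc in IH. exact IH. }
specialize (Hq2 p (Nat.le_refl p)). rewrite Hl in Hq2.
apply (Hmany (n + K - S (n1 + p))%nat) in Hq2; [|exact Hc].
replace (S (n1 + p) + (n + K - S (n1 + p)))%nat with (n + K)%nat in Hq2 by lia.
rewrite <- !Rmult_assoc, <- !pow_add in Hq2.
replace (n + K - S (n1 + p) + S p + (n1 - n))%nat with K in Hq2 by lia. exact Hq2.
Qed.

Lemma every_letter_loses n c : (c < d)%nat -> exists j, (n <= j < n + K)%nat /\ losr j = c.
Proof.
intros Hc. destruct (Hpath n c c Hc Hc) as [n1 [p [Hn1 [Hn2 [_ [Hl _]]]]]].
exists (n1 + p)%nat. split; [lia|exact Hl].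
Qed.

Definition den_between (D0 : nat -> R -> R) (n : nat) (M : R) : Prop :=
  forall a x, (a < d)%nat -> dom n a x -> 0 < den D0 n a x <= M * brL n a x.

(** The loser receives a weighted average of two old ratios, so an upper bound on the ratio is never
    lost. *)
Lemma den_between_step D0 n M : den_between D0 n M -> den_between D0 (S n) M.
Proof.
intros HD a x Ha Hx. destruct (Nat.eq_dec a (losr n)) as [->|Hne].
- unfold brL. rewrite !den_los. fold brL.
  pose proof (HD (a1 n) x (Ha1 n) (dom_los1 n x Hx)).
  pose proof (HD (a0 n) _ (Ha0 n) (dom_los0 n x Hx)).
  pose proof (exp_pos (brU n (a1 n) x)). nra.
- unfold brL. rewrite !den_nonlos by exact Hne. apply HD; [exact Ha|]. now apply dom_nonlos.
Qed.

Lemma den_between_later D0 n m M : (n <= m)%nat -> den_between D0 n M -> den_between D0 m M.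
Proof. induction 1; auto using den_between_step. Qed.

Definition den_pos (D0 : nat -> R -> R) (n : nat) : Prop :=
  forall a x, (a < d)%nat -> dom n a x -> 0 < den D0 n a x.

Lemma den_pos_step D0 n : den_pos D0 n -> den_pos D0 (S n).
Proof.
intros HD a x Ha Hx. destruct (Nat.eq_dec a (losr n)) as [->|Hne].
- rewrite den_los.
  pose proof (HD (a1 n) x (Ha1 n) (dom_los1 n x Hx)).
  pose proof (HD (a0 n) _ (Ha0 n) (dom_los0 n x Hx)).
  pose proof (exp_pos (brU n (a1 n) x)). nra.
- rewrite den_nonlos by exact Hne. apply HD; [exact Ha|]. now apply dom_nonlos.
Qed.

Lemma den_pos_later D0 n m : (n <= m)%nat -> den_pos D0 n -> den_pos D0 m.
Proof. induction 1; auto using den_pos_step. Qed.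

(** For a positive density the value on the loser dominates either summand, the second one up to a
    factor [exp (- Sl)]. So a lower bound on one letter spreads to all letters within a window. *)
Lemma den_lower D0 n b c v : (b < d)%nat -> (c < d)%nat -> den_pos D0 n -> 0 <= v ->
  (forall x, dom n b x -> v <= den D0 n b x) ->
  forall x, dom (n + K) c x -> exp (- Sl) ^ K * v <= den D0 (n + K) c x.
Proof.
intros Hb Hc Hpos Hv0 Hv.
pose (Q := fun m a v => (n <= m)%nat /\ 0 <= v /\ forall x, dom m a x -> v <= den D0 m a x).
assert (Hk : 0 < exp (- Sl) <= 1).
{ split; [apply exp_pos|]. rewrite <- exp_0. apply exp_le. pose proof Sl_nonneg; lra. }
assert (HQ : Q (n + K)%nat c (exp (- Sl) ^ K * v)).
{ apply (path_spread Q (exp (- Sl))) with b; auto.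
  - intros m a w Ha [Hm [Hw HwQ]]. split; [lia|]. split; [nra|]. intros x Hx.
    destruct (Nat.eq_dec a (losr m)) as [->|Hne].
    + rewrite den_los. pose proof (den_pos_later D0 n m Hm Hpos) as Hp.
      pose proof (Hp (a1 m) x (Ha1 m) (dom_los1 m x Hx)) as P1.
      pose proof (Hp (a0 m) _ (Ha0 m) (dom_los0 m x Hx)) as P0.
      pose proof (expU_le m (a1 m) x (Ha1 m) (dom_los1 m x Hx)) as PU.
      pose proof (exp_pos (brU m (a1 m) x)).
      unfold losr, loser in HwQ. destruct (ep m) eqn:Ee.
      * specialize (HwQ _ (dom_los0 m x Hx)). 
        apply Rle_trans with (den D0 m (a0 m) (brH m (a1 m) x) * exp (brU m (a1 m) x)); [|lra].
        rewrite Rmult_comm. apply Rmult_le_compat; lra.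
      * specialize (HwQ _ (dom_los1 m x Hx)). nra.
    + rewrite den_nonlos by exact Hne. specialize (HwQ x (dom_nonlos m a x Ha Hne Hx)). nra.
  - intros m w [Hm [Hw HwQ]]. split; [lia|]. split; [nra|]. intros x Hx.
    rewrite den_los. pose proof (den_pos_later D0 n m Hm Hpos) as Hp.
    pose proof (Hp (a1 m) x (Ha1 m) (dom_los1 m x Hx)) as P1.
    pose proof (Hp (a0 m) _ (Ha0 m) (dom_los0 m x Hx)) as P0.
    pose proof (expU_le m (a1 m) x (Ha1 m) (dom_los1 m x Hx)) as PU.
    pose proof (exp_pos (brU m (a1 m) x)).
    unfold winr, winner in HwQ. destruct (ep m) eqn:Ee.
    + specialize (HwQ _ (dom_los1 m x Hx)). nra.
    + specialize (HwQ _ (dom_los0 m x Hx)).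
      apply Rle_trans with (den D0 m (a0 m) (brH m (a1 m) x) * exp (brU m (a1 m) x)); [|lra].
      rewrite Rmult_comm. apply Rmult_le_compat; lra.
  - split; [lia|]. auto. }
apply HQ.
Qed.

Lemma den_upper D0 n M j : den_pos D0 n -> 0 <= M ->
  (forall a x, (a < d)%nat -> dom n a x -> den D0 n a x <= M) ->
  forall a x, (a < d)%nat -> dom (n + j) a x -> den D0 (n + j) a x <= (1 + exp Sl) ^ j * M.
Proof.
intros Hpos HM0 HM. induction j as [|j IH]; intros a x Ha Hx.
- rewrite Nat.add_0_r in *. rewrite pow_O, Rmult_1_l. auto.
- rewrite Nat.add_succ_r in *. cbn [pow].
  assert (Hpw : 0 < (1 + exp Sl) ^ j) by (apply pow_lt; pose proof (exp_pos Sl); lra).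
  assert (Hm0 : 0 <= (1 + exp Sl) ^ j * M) by nra.
  rewrite Rmult_assoc. set (m := ((1 + exp Sl) ^ j * M)) in *.
  pose proof (exp_pos Sl).
  destruct (Nat.eq_dec a (losr (n + j))) as [->|Hne].
  + rewrite den_los.
    pose proof (IH _ x (Ha1 _) (dom_los1 _ x Hx)) as P1.
    pose proof (IH _ _ (Ha0 _) (dom_los0 _ x Hx)) as P0.
    pose proof (expU_le _ _ x (Ha1 (n + j)) (dom_los1 _ x Hx)) as PU.
    pose proof (den_pos_later D0 n (n + j) ltac:(lia) Hpos _ _ (Ha0 _) (dom_los0 _ x Hx)) as Q0.
    assert (den D0 (n + j) (a0 (n + j)) (brH (n + j) (a1 (n + j)) x) *
       exp (brU (n + j) (a1 (n + j)) x) <= m * exp Sl).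
    { apply Rmult_le_compat; try lra. left; apply exp_pos. }
    lra.
  + rewrite den_nonlos by exact Hne. specialize (IH a x Ha (dom_nonlos _ a x Ha Hne Hx)). nra.
Qed.

Lemma finite_argmax (F : nat -> R) m : (0 < m)%nat ->
  exists b, (b < m)%nat /\ forall a, (a < m)%nat -> F a <= F b.
Proof.
induction m as [|m IH]; intros Hm; [lia|].
destruct m as [|m].
- exists 0%nat. split; [lia|]. intros a Ha. replace a with 0%nat by lia. lra.
- destruct IH as [b [Hb HF]]; [lia|].
  destruct (Rle_or_lt (F b) (F (S m))) as [Hle|Hlt].
  + exists (S m). split; [lia|]. intros a Ha. destruct (Nat.eq_dec a (S m)) as [->|]; [lra|].
    apply Rle_trans with (F b); [apply HF; lia|exact Hle].
  + exists b. split; [lia|]. intros a Ha. destruct (Nat.eq_dec a (S m)) as [->|]; [lra|].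
    apply HF; lia.
Qed.

Definition CK : R := (1 + exp Sl) ^ K * exp Sl ^ K.

Lemma CK_ge1 : 1 <= (1 + exp Sl) ^ K /\ 1 <= exp Sl ^ K.
Proof.
pose proof (exp_pos Sl). split; apply pow_R1_Rle; [lra|].
rewrite <- exp_0. apply exp_le. apply Sl_nonneg.
Qed.

(** A Harnack inequality. Let [v] be the largest of the values at the left ends at level [n]. All
    densities are at most [q * v] there and grow by a bounded factor over the window, while the
    lower bound [v / q] on the maximal letter spreads to every letter; this accounts for the two
    factors [q]. *)
Lemma den_comparable D0 n q : 0 < q -> den_pos D0 n ->
  (forall a x y, (a < d)%nat -> dom n a x -> dom n a y -> den D0 n a x <= q * den D0 n a y) ->
  forall a b x y, (a < d)%nat -> (b < d)%nat -> dom (n + K) a x -> dom (n + K) b y ->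
    den D0 (n + K) a x <= q * q * CK * den D0 (n + K) b y.
Proof.
intros Hq Hpos Hosc a b x y Ha Hb Hx Hy.
assert (Hlo : forall a, (a < d)%nat -> dom n a (lo n a)).
{ intros c Hc. pose proof (Hlh n c Hc). unfold dom; lra. }
destruct (finite_argmax (fun a => den D0 n a (lo n a)) d Hd) as [bb [Hbb Hmax]].
set (v := den D0 n bb (lo n bb)) in *.
assert (Hv : 0 < v) by (apply Hpos; auto).
assert (H1 : den D0 (n + K) a x <= (1 + exp Sl) ^ K * (q * v)).
{ apply den_upper; auto; [nra|]. intros c z Hc Hz.
  eapply Rle_trans; [apply (Hosc c z (lo n c)); auto|].
  apply Rmult_le_compat_l; [lra|]. now apply Hmax. }
assert (H2 : exp (- Sl) ^ K * (v / q) <= den D0 (n + K) b y).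
{ apply (den_lower D0 n bb b); auto.
  - left. now apply Rdiv_lt_0_compat.
  - intros z Hz. pose proof (Hosc bb (lo n bb) z Hbb (Hlo bb Hbb) Hz) as Ho. fold v in Ho.
    apply (Rmult_le_reg_l q); [exact Hq|].
    replace (q * (v / q)) with v by (field; lra). exact Ho. }
eapply Rle_trans; [exact H1|].
replace ((1 + exp Sl) ^ K * (q * v)) with (q * q * CK * (exp (- Sl) ^ K * (v / q))).
- apply Rmult_le_compat_l; [|exact H2]. unfold CK. destruct CK_ge1.
  apply Rmult_le_pos; [nra|]. apply Rmult_le_pos; lra.
- unfold CK. assert (Hee : exp Sl ^ K * exp (- Sl) ^ K = 1).
  { rewrite <- Rpow_mult_distr, <- exp_plus, Rplus_opp_r, exp_0, pow1. reflexivity. }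
  transitivity (((1 + exp Sl) ^ K * (q * v)) * (exp Sl ^ K * exp (- Sl) ^ K)); [field; lra|].
  rewrite Hee. ring.
Qed.

Lemma brL_den_pos n : den_pos (fun _ _ => 1) n.
Proof. intros a x _ _. apply (brL_pos n a x). Qed.

Definition CL : R := exp G * exp G * CK.

Lemma CL_ge : (1 + exp Sl) ^ K <= CL /\ 1 <= CL.
Proof.
unfold CL, CK. destruct CK_ge1.
assert (1 <= exp G) by (rewrite <- exp_0; now apply exp_le).
assert (1 <= exp G * exp G) by nra.
set (p := (1 + exp Sl) ^ K) in *. set (e := exp Sl ^ K) in *.
assert (p <= p * e) by nra. assert (p * e <= exp G * exp G * (p * e)) by nra. lra.
Qed.

Lemma brL_comparable n a b x y : (a < d)%nat -> (b < d)%nat -> dom n a x -> dom n b y ->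
  brL n a x <= CL * brL n b y.
Proof.
intros Ha Hb Hx Hy. destruct (Nat.le_gt_cases K n) as [HK|HK].
- replace n with (n - K + K)%nat in * by lia.
  apply (den_comparable (fun _ _ => 1) (n - K) (exp G)); auto.
  + apply exp_pos.
  + apply brL_den_pos.
  + intros c z w Hc Hz Hw. apply (brL_osc (n - K) c z w); auto.
(* Below level [K] no full window is available, but the density started at 1, has grown by a bounded
   factor, and is at least 1 everywhere. *)
- assert (H1 : brL n a x <= (1 + exp Sl) ^ n * 1).
  { apply (den_upper (fun _ _ => 1) 0 1 n); auto; [apply brL_den_pos|lra|intros; simpl; lra]. }
  assert (H2 : (1 + exp Sl) ^ n <= (1 + exp Sl) ^ K).
  { apply Rle_pow; [pose proof (exp_pos Sl); lra|lia]. }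
  pose proof (brL_ge1 n b y). destruct CL_ge. nra.
Qed.

Definition C3 : R := CL * exp Sl.

Lemma C3_ge1 : 1 <= C3.
Proof.
unfold C3. destruct CL_ge.
assert (1 <= exp Sl) by (rewrite <- exp_0; apply exp_le; apply Sl_nonneg). nra.
Qed.

(** Neither part of the merged tower is negligible. This bounds the weights of the average away from
    0 and yields the fraction [th]. *)
Lemma brL_parts n x : dom (S n) (losr n) x ->
  brL n (a1 n) x <= C3 * (brL n (a0 n) (brH n (a1 n) x) * exp (brU n (a1 n) x)) /\
  brL n (a0 n) (brH n (a1 n) x) * exp (brU n (a1 n) x) <= C3 * brL n (a1 n) x.
Proof.
intros Hx. pose proof (dom_los1 n x Hx) as Hx1. pose proof (dom_los0 n x Hx) as Hx0.
pose proof (brL_comparable n _ _ _ _ (Ha1 n) (Ha0 n) Hx1 Hx0) as H10.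
pose proof (brL_comparable n _ _ _ _ (Ha0 n) (Ha1 n) Hx0 Hx1) as H01.
pose proof (expU_le n (a1 n) x (Ha1 n) Hx1) as [HU1 HU2].
pose proof (brL_pos n (a1 n) x) as L1. pose proof (brL_pos n (a0 n) (brH n (a1 n) x)) as L0.
destruct CL_ge as [_ HCL]. unfold C3.
set (l1 := brL n (a1 n) x) in *. set (l0 := brL n (a0 n) (brH n (a1 n) x)) in *.
assert (Hone : exp Sl * exp (- Sl) = 1) by (rewrite <- exp_plus, Rplus_opp_r, exp_0; reflexivity).
pose proof (exp_pos Sl). pose proof (exp_pos (- Sl)).
split.
- assert (1 <= exp Sl * exp (brU n (a1 n) x)) by nra.
  replace (CL * exp Sl * (l0 * exp (brU n (a1 n) x))) with
    ((CL * l0) * (exp Sl * exp (brU n (a1 n) x))) by ring. nra.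
- assert (0 < CL * l1) by nra. nra.
Qed.

Definition th : R := C3 / (1 + C3).

Lemma th_bounds : 0 < th < 1.
Proof.
pose proof C3_ge1. unfold th. split; [apply Rdiv_lt_0_compat; lra|].
apply (Rmult_lt_reg_r (1 + C3)); [lra|]. unfold Rdiv. rewrite Rmult_assoc, Rinv_l; lra.
Qed.

Lemma th_part p q : p <= C3 * q -> p <= th * (p + q).
Proof.
intros H. pose proof C3_ge1. unfold th.
apply (Rmult_le_reg_r (1 + C3)); [lra|].
replace (C3 / (1 + C3) * (p + q) * (1 + C3)) with (C3 * (p + q)) by (field; lra). nra.
Qed.

(** The source of the contraction: distances measured along a merged tower shrink by [th] when
    passing to either of its parts. *)
Lemma brE_parts_contract n x y : dom (S n) (losr n) x -> dom (S n) (losr n) y ->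
  let D := Rabs (brE (S n) (losr n) x - brE (S n) (losr n) y) in
  Rabs (brE n (a1 n) x - brE n (a1 n) y) <= th * D /\
  Rabs (brE n (a0 n) (brH n (a1 n) x) - brE n (a0 n) (brH n (a1 n) y)) <= th * D.
Proof.
assert (Hle : forall x y, x <= y -> dom (S n) (losr n) x -> dom (S n) (losr n) y ->
  brE n (a1 n) y - brE n (a1 n) x <= th * (brE (S n) (losr n) y - brE (S n) (losr n) x) /\
  brE n (a0 n) (brH n (a1 n) y) - brE n (a0 n) (brH n (a1 n) x) <=
    th * (brE (S n) (losr n) y - brE (S n) (losr n) x)).
{ clear x y. intros x y Hxy Hx Hy.
  assert (Hin : forall z, x <= z <= y -> dom (S n) (losr n) z) by (unfold dom in *; intros; lra).
  assert (HL : forall z, brL (S n) (losr n) z = brL n (a1 n) z +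
     brL n (a0 n) (brH n (a1 n) z) * exp (brU n (a1 n) z)) by (intros; apply den_los).
  split.
  - apply (deriv_incr_le _ (brL n (a1 n)) _ (brL (S n) (losr n))); [exact Hxy| | |].
    + intros; apply brE_deriv.
    + intros; apply brE_deriv.
    + intros z Hz. rewrite HL. apply th_part. apply brL_parts. auto.
  - apply (deriv_incr_le (fun z => brE n (a0 n) (brH n (a1 n) z))
       (fun z => brL n (a0 n) (brH n (a1 n) z) * exp (brU n (a1 n) z)) _ (brL (S n) (losr n)));
      [exact Hxy| | |].
    + intros. apply (derivable_pt_lim_comp (brH n (a1 n)) (brE n (a0 n)));
        [apply brH_deriv|apply brE_deriv].
    + intros; apply brE_deriv.
    + intros z Hz. rewrite HL, Rplus_comm. apply th_part. apply brL_parts. auto. }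
assert (Hmono : forall x y, x <= y ->
  brE n (a1 n) x <= brE n (a1 n) y /\
  brE n (a0 n) (brH n (a1 n) x) <= brE n (a0 n) (brH n (a1 n) y) /\
  brE (S n) (losr n) x <= brE (S n) (losr n) y).
{ clear x y. intros x y Hxy. repeat split; apply brE_mono; auto. now apply brH_mono. }
intros Hx Hy D. unfold D. destruct (Rle_or_lt x y) as [Hxy|Hxy].
- destruct (Hle x y Hxy Hx Hy) as [E1 E2]. destruct (Hmono x y Hxy) as [M1 [M2 M3]].
  rewrite !(Rabs_minus_sym (brE _ _ x)), !(Rabs_minus_sym (brE _ _ (brH n (a1 n) x))).
  rewrite !Rabs_pos_eq by lra. auto.
- destruct (Hle y x ltac:(lra) Hy Hx) as [E1 E2]. destruct (Hmono y x ltac:(lra)) as [M1 [M2 M3]].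
  rewrite !Rabs_pos_eq by lra. auto.
Qed.

(** Tracing a point backwards through a window, its letter is at some moment the loser; there the
    density exceeds that of the lower part by the factor [1 + / C3]. *)
Lemma brL_growth : exists g, 1 < g /\ forall n a x, (a < d)%nat -> dom n a x -> g ^ (n / K) <= brL n a x.
Proof.
set (g := 1 + / C3). pose proof C3_ge1 as HC3.
assert (Hi : 0 < / C3) by (apply Rinv_0_lt_compat; lra).
exists g. split; [unfold g; lra|].
assert (Hone : forall n x, dom (S n) (losr n) x -> g * brL n (a1 n) x <= brL (S n) (losr n) x).
{ intros n x Hx. destruct (brL_parts n x Hx) as [H1 _]. unfold brL at 2. rewrite den_los. fold brL.
  apply (Rmult_le_compat_l (/ C3)) in H1; [|lra].
  rewrite <- Rmult_assoc, Rinv_l, Rmult_1_l in H1 by lra. unfold g. lra. }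
assert (Hwin : forall n j a x, (a < d)%nat -> dom (n + j) a x -> exists b, (b < d)%nat /\ dom n b x /\
   (g * brL n b x <= brL (n + j) a x \/
    (brL n b x <= brL (n + j) a x /\ forall i, (n <= i < n + j)%nat -> losr i <> a))).
{ intros n. induction j as [|j IH]; intros a x Ha Hx.
  - rewrite Nat.add_0_r in *. exists a. repeat split; auto; [apply Hx|apply Hx|].
    right. split; [lra|intros; lia].
  - rewrite Nat.add_succ_r in *. destruct (Nat.eq_dec a (losr (n + j))) as [->|Hne].
    + destruct (IH (a1 (n + j)) x (Ha1 _) (dom_los1 _ x Hx)) as [b [Hb [Hbx Hor]]].
      exists b. split; [exact Hb|]. split; [exact Hbx|]. left.
      pose proof (Hone _ x Hx) as Ho. pose proof (brL_pos n b x). pose proof (brL_pos (n + j) (a1 (n + j)) x).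
      assert (1 < g) by (unfold g; lra).
      destruct Hor as [Hor|[Hor _]]; nra.
    + destruct (IH a x Ha (dom_nonlos _ a x Ha Hne Hx)) as [b [Hb [Hbx Hor]]].
      exists b. split; [exact Hb|]. split; [exact Hbx|].
      unfold brL at 2 4. rewrite !den_nonlos by exact Hne. fold brL.
      destruct Hor as [Hor|[Hor Hnl]]; [now left|right]. split; [exact Hor|].
      intros i Hi'. destruct (Nat.eq_dec i (n + j)) as [->|]; [congruence|]. apply Hnl. lia. }
assert (HK : K <> 0%nat).
{ destruct (every_letter_loses 0 0 Hd) as [j [Hj _]]. lia. }
assert (Hj : forall j a x, (a < d)%nat -> dom (j * K) a x -> g ^ j <= brL (j * K) a x).
{ induction j as [|j IH]; intros a x Ha Hx.
  - simpl. apply (brL_ge1 0).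
  - replace (S j * K)%nat with (j * K + K)%nat in * by (simpl; lia).
    destruct (Hwin (j * K)%nat K a x Ha Hx) as [b [Hb [Hbx Hor]]].
    specialize (IH b x Hb Hbx). simpl. destruct Hor as [Hor|[_ Hor]].
    + assert (0 < g) by (unfold g; lra). nra.
    + exfalso. destruct (every_letter_loses (j * K) a Ha) as [i [Hi1 Hi2]]. apply (Hor i); auto. }
intros n a x Ha Hx.
assert (Hn : exists j r, n = (j * K + r)%nat /\ j = (n / K)%nat).
{ exists (n / K)%nat, (n mod K)%nat. split; [|reflexivity]. pose proof (Nat.div_mod_eq n K). lia. }
destruct Hn as [j [r [Hn Hnj]]]. rewrite <- Hnj. clear Hnj. subst n.
destruct (Hwin (j * K)%nat r a x Ha Hx) as [b [Hb [Hbx Hor]]].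
specialize (Hj j b x Hb Hbx). pose proof (brL_pos (j * K) b x).
assert (1 < g) by (unfold g; lra).
destruct Hor as [Hor|[Hor _]]; nra.
Qed.

(** The tower has length at most 1 while its density grows exponentially, so its base is
    exponentially short. This controls the discrepancy between the two ways of indexing the levels
    of a tower. *)
Lemma interval_length_decay : exists g, 1 < g /\ forall n a, (a < d)%nat -> hi n a - lo n a <= / g ^ (n / K).
Proof.
destruct brL_growth as [g [Hg HL]]. exists g. split; [exact Hg|]. intros n a Ha.
pose proof (incrm_brE_le1 n a Ha) as H1. unfold incrm in H1.
assert (Hp : 0 < g ^ (n / K)) by (apply pow_lt; lra).
assert (H2 : hi n a - lo n a <= / g ^ (n / K) * (brE n a (hi n a) - brE n a (lo n a))).
{ apply (deriv_incr_le id (fun _ => 1) (brE n a) (brL n a)).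
  - left; now apply Hlh.
  - intros; apply derivable_pt_lim_id.
  - intros; apply brE_deriv.
  - intros z Hz. specialize (HL n a z Ha Hz).
    apply (Rmult_le_reg_l (g ^ (n / K))); [exact Hp|].
    rewrite <- Rmult_assoc, Rinv_r, Rmult_1_l by lra. lra. }
pose proof (Rinv_0_lt_compat _ Hp). nra.
Qed.

(** * Cones of densities with Hoelder logarithm *)

Variable nu : R.
Hypothesis Hnu : 0 < nu <= 1.

Definition rat (D0 : nat -> R -> R) (n a : nat) (x : R) : R := den D0 n a x / brL n a x.

(** For positive ratios: the logarithm is Hoelder with constant [al] in the coordinate [brE], in
    which merging contracts distances. Exchanging [x] and [y] gives the reverse bound. *)
Definition cone (D0 : nat -> R -> R) (n a : nat) (al : R) : Prop :=
  forall x y, dom n a x -> dom n a y ->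
    rat D0 n a x <= rat D0 n a y * exp (al * om nu (Rabs (brE n a x - brE n a y))).

Lemma rat_mult D0 n a x : den D0 n a x = rat D0 n a x * brL n a x.
Proof. unfold rat. field. pose proof (brL_pos n a x). lra. Qed.

Lemma rat_pos D0 n a x : (a < d)%nat -> den_pos D0 n -> dom n a x -> 0 < rat D0 n a x.
Proof. intros Ha HD Hx. apply Rdiv_lt_0_compat; [now apply HD|apply brL_pos]. Qed.

Lemma cone_weaken D0 n a al be : (a < d)%nat -> den_pos D0 n -> al <= be -> cone D0 n a al -> cone D0 n a be.
Proof.
intros Ha HD Hab Hc x y Hx Hy. eapply Rle_trans; [exact (Hc x y Hx Hy)|].
apply Rmult_le_compat_l; [left; apply rat_pos; auto|].
apply exp_le. apply Rmult_le_compat_r; [apply om_pos|exact Hab].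
Qed.

Lemma cone_nonlos D0 n a al : (a < d)%nat -> a <> losr n -> cone D0 n a al -> cone D0 (S n) a al.
Proof.
intros Ha Hne Hc x y Hx Hy.
unfold rat, brL. rewrite !den_nonlos, !brE_nonlos by exact Hne.
apply Hc; now apply dom_nonlos.
Qed.

Definition th' : R := Rpower th nu.

Lemma th'_bounds : 0 < th' < 1.
Proof.
destruct th_bounds as [H1 H2]. unfold th'. split; [apply exp_pos|].
unfold Rpower. rewrite <- exp_0. apply exp_increasing.
assert (ln th < 0) by (rewrite <- ln_1; apply ln_increasing; lra). nra.
Qed.

(** Both summands of the merged density satisfy the same multiplicative bound, so their sum does.
    The old constant is multiplied by [th'] because distances contract; one [G] comes from the
    weights in the numerator, the other from dividing by the merged [brL]. *)
Lemma cone_los D0 n al : 0 <= al -> den_pos D0 n ->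
  cone D0 n (a0 n) al -> cone D0 n (a1 n) al -> cone D0 (S n) (losr n) (th' * al + 2 * G).
Proof.
intros Hal HD Hc0 Hc1 x y Hx Hy.
pose proof (dom_los1 n x Hx) as Hx1. pose proof (dom_los0 n x Hx) as Hx0.
pose proof (dom_los1 n y Hy) as Hy1. pose proof (dom_los0 n y Hy) as Hy0.
destruct (brE_parts_contract n x y Hx Hy) as [E1 E0].
pose proof (brE_los_split n x y) as Es.
pose proof (brE_dist_le1 (S n) (losr n) x y (losr_lt n) Hx Hy) as Ele.
pose proof (brL_dist (S n) (losr n) y x) as HLd.
rewrite (Rabs_minus_sym (brE (S n) (losr n) y)) in HLd.
set (D := Rabs (brE (S n) (losr n) x - brE (S n) (losr n) y)) in *.
pose proof (brL_dist n (a1 n) x y) as L1. pose proof (brL_dist n (a0 n) (brH n (a1 n) x) (brH n (a1 n) y)) as L0.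
pose proof (brU_dist n (a1 n) x y) as Ud.
pose proof (Hc1 x y Hx1 Hy1) as R1. pose proof (Hc0 _ _ Hx0 Hy0) as R0.
set (D1 := Rabs (brE n (a1 n) x - brE n (a1 n) y)) in *.
set (D2 := Rabs (brE n (a0 n) (brH n (a1 n) x) - brE n (a0 n) (brH n (a1 n) y))) in *.
assert (P1 : 0 <= D1) by apply Rabs_pos. assert (P2 : 0 <= D2) by apply Rabs_pos.
assert (PD : 0 <= D) by apply Rabs_pos.
destruct th_bounds as [Ht0 Ht1].
assert (O1 : om nu D1 <= th' * om nu D).
{ unfold th'. rewrite <- om_scale by lra. apply om_mono; lra. }
assert (O2 : om nu D2 <= th' * om nu D).
{ unfold th'. rewrite <- om_scale by lra. apply om_mono; lra. }
assert (OD : D <= om nu D) by (apply om_ge; lra).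
assert (K1 : den D0 n (a1 n) x <= den D0 n (a1 n) y * exp (G * D + al * (th' * om nu D))).
{ rewrite (rat_mult D0 n (a1 n) x), (rat_mult D0 n (a1 n) y).
  eapply Rle_trans.
  { apply Rmult_le_compat; [left; apply rat_pos; auto|left; apply brL_pos|exact R1|exact L1]. }
  apply Rle_trans with (rat D0 n (a1 n) y * brL n (a1 n) y * exp (al * om nu D1 + G * D1)).
  { rewrite exp_plus. right; ring. }
  apply Rmult_le_compat_l.
  - left. apply Rmult_lt_0_compat; [apply rat_pos; auto|apply brL_pos].
  - apply exp_le. nra. }
assert (K0 : den D0 n (a0 n) (brH n (a1 n) x) * exp (brU n (a1 n) x) <=
   den D0 n (a0 n) (brH n (a1 n) y) * exp (brU n (a1 n) y) * exp (G * D + al * (th' * om nu D))).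
{ rewrite (rat_mult D0 n (a0 n) (brH n (a1 n) x)), (rat_mult D0 n (a0 n) (brH n (a1 n) y)).
  eapply Rle_trans.
  { apply Rmult_le_compat_r; [left; apply exp_pos|].
    apply Rmult_le_compat; [left; apply rat_pos; auto|left; apply brL_pos|exact R0|exact L0]. }
  apply Rle_trans with (rat D0 n (a0 n) (brH n (a1 n) y) * brL n (a0 n) (brH n (a1 n) y) *
     exp (al * om nu D2 + G * D2 + brU n (a1 n) x)).
  { rewrite !exp_plus. right; ring. }
  rewrite Rmult_assoc with (r3 := exp (G * D + _)), <- exp_plus.
  apply Rmult_le_compat_l.
  - left. apply Rmult_lt_0_compat; [apply rat_pos; auto|apply brL_pos].
  - apply exp_le. apply Rabs_le_between in Ud. nra. }
assert (Kd : den D0 (S n) (losr n) x <= den D0 (S n) (losr n) y * exp (G * D + al * (th' * om nu D))).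
{ rewrite !den_los. rewrite Rmult_plus_distr_r. lra. }
pose proof (brL_pos (S n) (losr n) x) as Lx. pose proof (brL_pos (S n) (losr n) y) as Ly.
pose proof (den_pos_step D0 n HD (losr n) y (losr_lt n) Hy) as Dy.
unfold rat.
apply (Rmult_le_reg_r (brL (S n) (losr n) x)); [exact Lx|].
unfold Rdiv at 1. rewrite Rmult_assoc, Rinv_l, Rmult_1_r by lra.
eapply Rle_trans; [exact Kd|].
set (lx := brL (S n) (losr n) x) in *. set (ly := brL (S n) (losr n) y) in *.
set (dy := den D0 (S n) (losr n) y) in *.
assert (Hl : 1 <= lx / ly * exp (G * D)).
{ apply (Rmult_le_reg_l ly); [exact Ly|].
  replace (ly * (lx / ly * exp (G * D))) with (lx * exp (G * D)) by (field; lra). lra. }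
replace (dy / ly * exp ((th' * al + 2 * G) * om nu D) * lx) with
  (dy * (lx / ly * exp ((th' * al + 2 * G) * om nu D))) by (field; lra).
apply Rmult_le_compat_l; [lra|].
apply Rle_trans with (lx / ly * exp (G * D) * exp (G * D + al * (th' * om nu D))).
- rewrite <- (Rmult_1_l (exp (_ + _))) at 1. apply Rmult_le_compat_r; [left; apply exp_pos|exact Hl].
- rewrite Rmult_assoc, <- exp_plus. apply Rmult_le_compat_l.
  + left. now apply Rdiv_lt_0_compat.
  + apply exp_le. nra.
Qed.

(** Only a loss improves the constant of a letter, and every letter loses once in the window. The
    second clause of [Hj] follows the letters that have already lost; the additive [2 * G] per step
    covers the growth before and after. *)
Lemma cone_window D0 n al : 0 <= al -> den_pos D0 n -> (forall a, (a < d)%nat -> cone D0 n a al) ->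
  forall a, (a < d)%nat -> cone D0 (n + K) a (th' * (al + 2 * G * INR K) + 2 * G).
Proof.
intros Hal HD Hc. destruct th'_bounds as [Ht0 Ht1].
assert (Hj : forall j, (forall a, (a < d)%nat -> cone D0 (n + j) a (al + 2 * G * INR j)) /\
  (forall a i, (a < d)%nat -> (i < j)%nat -> losr (n + i) = a ->
     cone D0 (n + j) a (th' * (al + 2 * G * INR j) + 2 * G))).
{ induction j as [|j [IH1 IH2]].
  - split; [|intros; lia]. intros a Ha. rewrite Nat.add_0_r. simpl. rewrite Rmult_0_r, Rplus_0_r. auto.
  - assert (HGj : 0 <= 2 * G * INR j) by (pose proof (pos_INR j); nra).
    assert (HSj : 2 * G * INR (S j) = 2 * G * INR j + 2 * G) by (rewrite S_INR; ring).
    pose proof (den_pos_later D0 n (n + j) ltac:(lia) HD) as HDj.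
    pose proof (den_pos_step D0 (n + j) HDj) as HDSj.
    assert (Hlos : cone D0 (S (n + j)) (losr (n + j)) (th' * (al + 2 * G * INR j) + 2 * G)).
    { apply cone_los; auto. lra. }
    rewrite Nat.add_succ_r. split.
    + intros a Ha. destruct (Nat.eq_dec a (losr (n + j))) as [->|Hne].
      * eapply cone_weaken; [apply losr_lt|exact HDSj| |exact Hlos]. rewrite HSj. nra.
      * eapply cone_weaken; [exact Ha|exact HDSj| |apply cone_nonlos; [exact Ha|exact Hne|now apply IH1]].
        rewrite HSj. lra.
    + intros a i Ha Hi Hli. destruct (Nat.eq_dec a (losr (n + j))) as [->|Hne].
      * eapply cone_weaken; [apply losr_lt|exact HDSj| |exact Hlos]. rewrite HSj. nra.
      * eapply cone_weaken; [exact Ha|exact HDSj| |apply cone_nonlos; [exact Ha|exact Hne|apply (IH2 a i)]];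
          auto.
        -- rewrite HSj. nra.
        -- assert (i <> j) by (intros ->; congruence). lia. }
intros a Ha. destruct (every_letter_loses n a Ha) as [j [Hj1 Hj2]].
apply (proj2 (Hj K) a (j - n)%nat Ha); [lia|].
replace (n + (j - n))%nat with j by lia. exact Hj2.
Qed.

Lemma exp_bernoulli s t : 1 <= s -> 0 <= t -> 1 + s * (exp t - 1) <= exp (s * t).
Proof.
intros Hs Ht.
assert (H : exp (s * 0) - s * exp 0 <= exp (s * t) - s * exp t).
{ apply (deriv_nondecr (fun z => exp (s * z) - s * exp z) (fun z => exp (s * z) * s - s * exp z)); auto.
  - intros z Hz. apply (derivable_pt_lim_minus (fun z => exp (s * z)) (fun z => s * exp z)).
    + apply exp_comp_deriv. replace s with (s * 1) at 2 by ring.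
      apply (derivable_pt_lim_scal id). apply derivable_pt_lim_id.
    + apply (derivable_pt_lim_scal exp). apply derivable_pt_lim_exp.
  - intros z Hz. assert (exp z <= exp (s * z)) by (apply exp_le; nra). nra. }
rewrite Rmult_0_r, exp_0 in H. lra.
Qed.

(** With [s = / (1 - t)] one has [r2 <= s * (r2 - tau)], so the relative excess of [r1] over [r2]
    grows at most by the factor [s]; the Bernoulli inequality for the exponential moves [s] into the
    exponent. *)
Lemma subtract_constant r1 r2 tau t del : 0 <= t < 1 -> 0 <= del -> 0 <= tau <= t * r2 -> 0 < r2 ->
  r1 <= r2 * exp del -> r1 - tau <= (r2 - tau) * exp (del / (1 - t)).
Proof.
intros Ht Hdel Htau Hr2 H1.
set (s := / (1 - t)). assert (Hs : s * (1 - t) = 1) by (unfold s; field; lra).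
assert (Hs1 : 1 <= s).
{ unfold s. rewrite <- Rinv_1 at 1. apply Rinv_le_contravar; lra. }
pose proof (exp_bernoulli s del Hs1 Hdel) as Hb.
replace (del / (1 - t)) with (s * del) by (unfold s; field; lra).
assert (He : 0 <= exp del - 1).
{ assert (1 <= exp del) by (rewrite <- exp_0; now apply exp_le). lra. }
assert (Hrt : 0 <= r2 - tau) by nra.
apply Rle_trans with ((r2 - tau) * (1 + s * (exp del - 1))); [|now apply Rmult_le_compat_l].
assert (r2 <= (r2 - tau) * s).
{ replace r2 with (r2 * (s * (1 - t))) at 1 by (rewrite Hs; ring). nra. }
assert (r2 * (exp del - 1) <= (r2 - tau) * s * (exp del - 1)) by (apply Rmult_le_compat_r; lra).
nra.
Qed.

Lemma den_shift D0 tau n a x :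
  den (fun a x => D0 a x + - tau * 1) n a x = den D0 n a x - tau * brL n a x.
Proof. rewrite (den_linear D0 (fun _ _ => 1)). unfold brL. ring. Qed.

Lemma rat_shift D0 tau n a x :
  rat (fun a x => D0 a x + - tau * 1) n a x = rat D0 n a x - tau.
Proof. unfold rat. rewrite den_shift. field. pose proof (brL_pos n a x). lra. Qed.

Definition good (D0 : nat -> R -> R) (n : nat) (al M : R) : Prop :=
  den_pos D0 n /\ (forall a, (a < d)%nat -> cone D0 n a al) /\
  forall a x, (a < d)%nat -> dom n a x -> rat D0 n a x <= M.

Lemma rat_le_between D0 n M : den_pos D0 n ->
  (forall a x, (a < d)%nat -> dom n a x -> rat D0 n a x <= M) -> den_between D0 n M.
Proof.
intros HD HM a x Ha Hx. split; [now apply HD|]. rewrite rat_mult.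
apply Rmult_le_compat_r; [left; apply brL_pos|now apply HM].
Qed.

(* Subtracting from the ratio a constant below a fixed fraction [t] of its minimum costs the cone
   constant a factor [1 / (1 - t)], which the window has gained in advance. *)
Lemma good_step al0 : exists al sg, al0 <= al /\ 0 < sg < 1 /\
  forall D0 n M, 0 <= M -> good D0 n al M ->
    exists tau, good (fun a x => D0 a x + - tau * 1) (n + K) al (sg * M).
Proof.
destruct th'_bounds as [Ht0 Ht1].
set (B := th' * (2 * G * INR K) + 2 * G).
assert (HB : 0 <= B).
{ unfold B. pose proof (pos_INR K). assert (0 <= 2 * G * INR K) by nra. nra. }
(* Large enough that [th' * al + B], the constant after a window, is at most [(1 - t) * al] with [t]
   half of [1 - th']; dividing by [1 - t] then returns to [al]. *)
set (al := Rmax (Rmax al0 0) (2 * B / (1 - th'))).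
assert (Hal1 : al0 <= al /\ 0 <= al).
{ unfold al. pose proof (Rmax_l (Rmax al0 0) (2 * B / (1 - th'))).
  pose proof (Rmax_l al0 0). pose proof (Rmax_r al0 0). lra. }
assert (Hal2 : 2 * B <= al * (1 - th')).
{ pose proof (Rmax_r (Rmax al0 0) (2 * B / (1 - th'))) as H. fold al in H.
  apply (Rmult_le_compat_r (1 - th')) in H; [|lra].
  replace (2 * B / (1 - th') * (1 - th')) with (2 * B) in H by (field; lra). exact H. }
set (t := (1 - th') / 2).
set (q := exp (al + G)).
set (C1 := q * q * CK * CL).
assert (Hq : 1 <= q) by (unfold q; rewrite <- exp_0; apply exp_le; lra).
assert (HCK : 1 <= CK) by (unfold CK; destruct CK_ge1; nra).
assert (HCL : 1 <= CL) by apply CL_ge.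
assert (HC1 : 1 <= C1).
{ unfold C1. assert (1 <= q * q) by nra. assert (1 <= q * q * CK) by nra. nra. }
assert (Ht : 0 < t < 1 /\ t <= 1/2) by (unfold t; lra).
assert (Hinv : 0 < / (C1 * C1) <= 1).
{ split; [apply Rinv_0_lt_compat; nra|]. rewrite <- Rinv_1. apply Rinv_le_contravar; nra. }
(* All ratios after the window agree up to the factor [C1]. The constant subtracted below is
   [t / C1] times a sample value [r0]: it is at most [t] times every ratio and at least
   [t / (C1 * C1)] times every ratio, which gives the decay factor. *)
exists al, (1 - t / (C1 * C1)). split; [lra|]. split.
{ unfold Rdiv. nra. }
intros D0 n M HM [HD [Hcone HrM]].
assert (HDK : den_pos D0 (n + K)) by (apply (den_pos_later D0 n); [lia|exact HD]).
assert (Hcomp : forall a b x y, (a < d)%nat -> (b < d)%nat -> dom (n + K) a x -> dom (n + K) b y ->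
   rat D0 (n + K) a x <= C1 * rat D0 (n + K) b y).
{ intros a b x y Ha Hb Hx Hy.
  assert (Hden : den D0 (n + K) a x <= q * q * CK * den D0 (n + K) b y).
  { apply den_comparable; auto; [lra|].
    intros c z w Hc Hz Hw. rewrite (rat_mult D0 n c z), (rat_mult D0 n c w).
    pose proof (brL_osc n c z w Hc Hz Hw) as HL.
    pose proof (Hcone c Hc z w Hz Hw) as HR.
    assert (HR2 : rat D0 n c z <= rat D0 n c w * exp al).
    { eapply Rle_trans; [exact HR|]. apply Rmult_le_compat_l; [left; apply rat_pos; auto|].
      apply exp_le.
      pose proof (om_le1 nu _ (proj1 Hnu) (brE_dist_le1 n c z w Hc Hz Hw)).
      pose proof (om_pos nu (Rabs (brE n c z - brE n c w))). nra. }
    eapply Rle_trans.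
    { apply Rmult_le_compat; [left; apply rat_pos; auto|left; apply brL_pos|exact HR2|exact HL]. }
    unfold q. rewrite exp_plus. right. ring. }
  pose proof (brL_comparable (n + K) b a y x Hb Ha Hy Hx) as HL.
  pose proof (brL_pos (n + K) a x) as Lx. pose proof (brL_pos (n + K) b y) as Ly.
  rewrite (rat_mult D0 (n + K) a x), (rat_mult D0 (n + K) b y) in Hden.
  pose proof (rat_pos D0 (n + K) b y Hb HDK Hy) as Ry.
  apply (Rmult_le_reg_r (brL (n + K) a x)); [exact Lx|].
  eapply Rle_trans; [exact Hden|].
  replace (C1 * rat D0 (n + K) b y * brL (n + K) a x) with
    (q * q * CK * (rat D0 (n + K) b y * (CL * brL (n + K) a x))) by (unfold C1; ring).
  apply Rmult_le_compat_l; [nra|]. apply Rmult_le_compat_l; lra. }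
assert (Hx0 : dom (n + K) 0 (lo (n + K)%nat 0%nat)).
{ pose proof (Hlh (n + K)%nat 0%nat Hd). unfold dom; lra. }
set (r0 := rat D0 (n + K) 0 (lo (n + K)%nat 0%nat)) in *.
assert (Hr0 : 0 < r0) by (apply rat_pos; auto).
set (tau := t / C1 * r0).
assert (HtC : 0 < t / C1) by (apply Rdiv_lt_0_compat; lra).
assert (Htau0 : 0 < tau) by (unfold tau; nra).
assert (Htau1 : forall a x, (a < d)%nat -> dom (n + K) a x -> tau <= t * rat D0 (n + K) a x).
{ intros a x Ha Hx. pose proof (Hcomp 0%nat a _ x Hd Ha Hx0 Hx) as H. fold r0 in H.
  unfold tau. apply (Rmult_le_compat_l (t / C1)) in H; [|lra].
  replace (t / C1 * (C1 * rat D0 (n + K) a x)) with (t * rat D0 (n + K) a x) in H by (field; lra).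
  exact H. }
assert (Htau2 : forall a x, (a < d)%nat -> dom (n + K) a x -> t / (C1 * C1) * rat D0 (n + K) a x <= tau).
{ intros a x Ha Hx. pose proof (Hcomp a 0%nat x _ Ha Hd Hx Hx0) as H. fold r0 in H.
  unfold tau. assert (Hp : 0 < t / (C1 * C1)) by (apply Rdiv_lt_0_compat; nra).
  apply (Rmult_le_compat_l (t / (C1 * C1))) in H; [|lra].
  replace (t / (C1 * C1) * (C1 * r0)) with (t / C1 * r0) in H by (field; lra). exact H. }
exists tau. split; [|split].
- intros a x Ha Hx. rewrite den_shift, rat_mult.
  pose proof (brL_pos (n + K) a x). pose proof (rat_pos D0 (n + K) a x Ha HDK Hx).
  pose proof (Htau1 a x Ha Hx).
  assert (0 < rat D0 (n + K) a x - tau) by nra. nra.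
- intros a Ha x y Hx Hy. rewrite !rat_shift.
  pose proof (cone_window D0 n al (proj2 Hal1) HD Hcone a Ha x y Hx Hy) as Hc.
  pose proof (rat_pos D0 (n + K) a y Ha HDK Hy) as Ry.
  pose proof (om_pos nu (Rabs (brE (n + K) a x - brE (n + K) a y))) as Hom.
  set (o := om nu (Rabs (brE (n + K) a x - brE (n + K) a y))) in *.
  set (be := th' * (al + 2 * G * INR K) + 2 * G) in *.
  assert (Hbe : be = th' * al + B) by (unfold be, B; ring).
  assert (Hbe0 : 0 <= be) by (rewrite Hbe; nra).
  eapply Rle_trans.
  { apply (subtract_constant _ (rat D0 (n + K) a y) tau t (be * o)); auto; try lra.
    - nra.
    - split; [lra|now apply Htau1]. }
  apply Rmult_le_compat_l.
  { pose proof (Htau1 a y Ha Hy). nra. }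
  apply exp_le.
  replace (be * o / (1 - t)) with (be / (1 - t) * o) by (field; lra).
  apply Rmult_le_compat_r; [exact Hom|].
  apply (Rmult_le_reg_r (1 - t)); [lra|].
  replace (be / (1 - t) * (1 - t)) with be by (field; lra).
  rewrite Hbe. unfold t. lra.
- intros a x Ha Hx. rewrite rat_shift. pose proof (Htau2 a x Ha Hx) as H2.
  assert (HrM' : rat D0 (n + K) a x <= M).
  { pose proof (den_between_later D0 n (n + K) M ltac:(lia) (rat_le_between D0 n M HD HrM) a x Ha Hx) as Hb.
    rewrite rat_mult in Hb. pose proof (brL_pos (n + K) a x). nra. }
  assert (Hsg : 0 <= 1 - t / (C1 * C1)) by (unfold Rdiv; nra).
  apply Rle_trans with ((1 - t / (C1 * C1)) * rat D0 (n + K) a x); [lra|].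
  now apply Rmult_le_compat_l.
Qed.

Hypothesis Hu0hol : exists Kh, 0 <= Kh /\
  forall a x y, u0 a x - u0 a y <= Kh * om nu (Rabs (x - y)).

Lemma nonlinearity_equidistributed : exists sg M, 0 < sg < 1 /\ 0 < M /\
  forall n, exists kap, forall a x, (a < d)%nat -> dom n a x ->
    Rabs (bru n a x - kap * brL n a x) <= M * sg ^ (n / K) * brL n a x.
Proof.
destruct Hu0hol as [Kh [HKh0 HKh]].
(* The shift by [G + 1] makes the initial density at least 1, so that its Hoelder constant also
   bounds that of its logarithm. The shift changes the ratio by a constant only and is undone at the
   end. *)
set (D0 := fun a x => u0 a x + (G + 1) * 1).
set (M := 2 * G + 1).
destruct (good_step Kh) as [al [sg [Hal [Hsg Hstep]]]].
exists sg, M. split; [exact Hsg|]. split; [unfold M; lra|].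
assert (HD0 : forall a x, 1 <= D0 a x <= M).
{ intros a x. pose proof (Hu0 a x) as H. apply Rabs_le_between in H. unfold D0, M. lra. }
assert (Hr0 : forall a x, rat D0 0 a x = D0 a x).
{ intros a x. unfold rat, brL. simpl. field. }
assert (Hg0 : good D0 0 al M).
{ split; [|split].
  - intros a x _ _. simpl. pose proof (HD0 a x). lra.
  - intros a Ha x y Hx Hy. rewrite !Hr0. unfold brE; simpl.
    pose proof (HKh a x y) as H. pose proof (om_pos nu (Rabs (x - y))) as Ho.
    set (o := om nu (Rabs (x - y))) in *.
    apply Rle_trans with (D0 a y * (1 + al * o)).
    + pose proof (HD0 a y). assert (Kh * o <= al * o) by nra.
      assert (D0 a x - D0 a y <= Kh * o) by (unfold D0; lra).
      assert (0 <= al * o) by nra. nra.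
    + apply Rmult_le_compat_l; [pose proof (HD0 a y); lra|]. apply exp_ineq1_le.
  - intros a x _ _. rewrite Hr0. apply HD0. }
assert (Hiter : forall j, exists kap, good (fun a x => D0 a x + - kap * 1) (j * K) al (sg ^ j * M)).
{ induction j as [|j [kap IH]].
  - exists 0. simpl. rewrite Rmult_1_l. destruct Hg0 as [G1 [G2 G3]]. split; [|split].
    + intros a x Ha Hx. rewrite den_shift. specialize (G1 a x Ha Hx). lra.
    + intros a Ha x y Hx Hy. rewrite !rat_shift. specialize (G2 a Ha x y Hx Hy). rewrite !Rminus_0_r. exact G2.
    + intros a x Ha Hx. rewrite rat_shift. specialize (G3 a x Ha Hx). lra.
  - apply Hstep in IH.
    2:{ apply Rmult_le_pos; [apply pow_le; lra|unfold M; lra]. }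
    destruct IH as [tau [G1 [G2 G3]]]. exists (kap + tau).
    replace (S j * K)%nat with (j * K + K)%nat by (simpl; lia).
    split; [|split].
    + intros a x Ha Hx. specialize (G1 a x Ha Hx). rewrite !den_shift in *. lra.
    + intros a Ha x y Hx Hy. specialize (G2 a Ha x y Hx Hy). rewrite !rat_shift in *.
      replace (rat D0 (j * K + K) a x - (kap + tau)) with (rat D0 (j * K + K) a x - kap - tau) by ring.
      replace (rat D0 (j * K + K) a y - (kap + tau)) with (rat D0 (j * K + K) a y - kap - tau) by ring.
      exact G2.
    + intros a x Ha Hx. specialize (G3 a x Ha Hx). rewrite !rat_shift in *. simpl. lra. }
assert (HK : K <> 0%nat).
{ destruct (every_letter_loses 0 0 Hd) as [j [Hj _]]. lia. }
(* Positivity gives one side of the estimate and the decaying upper bound the other; both persist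
   from the last multiple of [K] up to [n]. *)
intros n. destruct (Hiter (n / K)%nat) as [kap [G1 [G2 G3]]].
exists (kap - (G + 1)). intros a x Ha Hx.
pose proof (den_between_later _ (n / K * K) n (sg ^ (n / K) * M)
  ltac:(rewrite Nat.mul_comm; apply Nat.Div0.mul_div_le) (rat_le_between _ _ _ G1 G3) a x Ha Hx) as Hb.
rewrite den_shift in Hb. unfold D0 in Hb.
rewrite (den_linear u0 (fun _ _ => 1)) in Hb. fold bru in Hb. fold brL in Hb.
apply Rabs_le. lra.
Qed.

End Contraction.

End Renormalization.

(** * One Rauzy-Veech step *)

(** Intervals laid end to end in the order of a list. Such lists carry the combinatorial data, since
    a Rauzy-Veech move is simpler on lists than on ranks. *)
Fixpoint chain (p q : nat -> R) (x : R) (l : list nat) (y : R) : Prop :=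
  match l with
  | [] => x = y
  | a :: t => p a = x /\ p a < q a /\ chain p q (q a) t y
  end.

Lemma chain_app p q x l1 l2 y :
  chain p q x (l1 ++ l2) y <-> exists z, chain p q x l1 z /\ chain p q z l2 y.
Proof.
revert x. induction l1 as [|a l1 IH]; intros x; simpl.
- split; [intros H; exists x; auto|intros [z [-> H]]; exact H].
- split.
  + intros [H1 [H2 H3]]. apply IH in H3. destruct H3 as [z [H3 H4]]. exists z. auto.
  + intros [z [[H1 [H2 H3]] H4]]. split; [exact H1|]. split; [exact H2|]. apply IH. exists z. auto.
Qed.

Lemma chain_ext p q p' q' x l y : (forall a, In a l -> p' a = p a /\ q' a = q a) ->
  chain p q x l y -> chain p' q' x l y.
Proof.
revert x. induction l as [|a l IH]; intros x He; simpl; [auto|].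
destruct (He a (or_introl eq_refl)) as [-> ->]. intros [H1 [H2 H3]].
split; [exact H1|]. split; [exact H2|]. apply IH; [|exact H3]. intros b Hb. apply He. now right.
Qed.

Lemma chain_le p q x l y : chain p q x l y -> x <= y.
Proof.
revert x. induction l as [|a l IH]; intros x; simpl; [lra|].
intros [H1 [H2 H3]]. apply IH in H3. lra.
Qed.

Lemma chain_split p q x l y a : chain p q x l y -> In a l ->
  x <= p a /\ p a < q a /\ q a <= y.
Proof.
intros Hc Ha. apply in_split in Ha. destruct Ha as [l1 [l2 ->]].
apply chain_app in Hc. destruct Hc as [z [H1 [H2 [H3 H4]]]].
apply chain_le in H1. apply chain_le in H4. lra.
Qed.

Lemma chain_before p q x l1 a l2 y b : chain p q x (l1 ++ a :: l2) y -> In b l1 -> q b <= p a.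
Proof.
intros Hc Hb. apply chain_app in Hc. destruct Hc as [z [H1 [H2 _]]].
destruct (chain_split _ _ _ _ _ _ H1 Hb) as [_ [_ H]]. lra.
Qed.

Lemma chain_after p q x l1 a l2 y b : chain p q x (l1 ++ a :: l2) y -> In b l2 -> q a <= p b.
Proof.
intros Hc Hb. apply chain_app in Hc. destruct Hc as [z [H1 [H2 [H3 H4]]]].
destruct (chain_split _ _ _ _ _ _ H4 Hb) as [H _]. lra.
Qed.

Lemma chain_cover p q x l y t : chain p q x l y -> x <= t < y -> exists a, In a l /\ p a <= t < q a.
Proof.
revert x. induction l as [|a l IH]; intros x; simpl; [lra|].
intros [H1 [H2 H3]] Ht. destruct (Rlt_or_le t (q a)) as [Hlt|Hge].
- exists a. split; [now left|lra].
- destruct (IH (q a) H3) as [b [Hb Hbt]]; [lra|]. exists b. auto.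
Qed.

Lemma chain_unique p q x l y a b t : chain p q x l y -> In a l -> In b l ->
  p a <= t < q a -> p b <= t < q b -> a = b.
Proof.
intros Hc Ha Hb Hta Htb. apply in_split in Ha. destruct Ha as [l1 [l2 ->]].
apply in_app_or in Hb. destruct Hb as [Hb|[Hb|Hb]]; [|exact Hb|].
- pose proof (chain_before _ _ _ _ _ _ _ _ Hc Hb). lra.
- pose proof (chain_after _ _ _ _ _ _ _ _ Hc Hb). lra.
Qed.

Lemma filter_Permutation (f : nat -> bool) l l' : Permutation l l' -> Permutation (filter f l) (filter f l').
Proof.
induction 1; simpl; auto.
- destruct (f x); auto.
- destruct (f x), (f y); auto. apply perm_swap.
- eapply Permutation_trans; eauto.
Qed.

Lemma decP_true (P : Prop) : P -> decP P = true.
Proof. intros H. unfold decP. destruct (excluded_middle_informative P); congruence. Qed.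

Lemma decP_false (P : Prop) : ~ P -> decP P = false.
Proof. intros H. unfold decP. destruct (excluded_middle_informative P); congruence. Qed.

(** The bridge to [pi0] and [pi1]: the letters counted in a rank are exactly those that precede [a]
    in the tiling. [St] stands for [inP] or [img]. *)
Lemma chain_rank (d : nat) (St : nat -> R -> Prop) p q x l1 a l2 y :
  chain p q x (l1 ++ a :: l2) y -> Permutation (l1 ++ a :: l2) (seq 0 d) ->
  (forall b t, (b < d)%nat -> (St b t <-> p b <= t < q b)) ->
  countL d (fun b => Iless (St b) (St a)) = length l1.
Proof.
intros Hc Hp HS. unfold countL.
rewrite <- (Permutation_length (filter_Permutation _ _ _ Hp)).
assert (Hlt : forall b, In b (l1 ++ a :: l2) -> (b < d)%nat).
{ intros b Hb. apply (Permutation_in b Hp) in Hb. apply in_seq in Hb. lia. }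
assert (Ha : In a (l1 ++ a :: l2)) by (apply in_or_app; right; now left).
assert (Hpq : forall b, In b (l1 ++ a :: l2) -> p b < q b) by (intros b Hb; eapply chain_split; eauto).
assert (H1 : forall l, (forall b, In b l -> In b l1) ->
  filter (fun b => decP (Iless (St b) (St a))) l = l).
{ induction l as [|b l IH]; intros Hl; [reflexivity|]. simpl.
  rewrite decP_true, IH; [reflexivity| |].
  - intros c Hcl. apply Hl. now right.
  - assert (Hb : In b l1) by (apply Hl; now left).
    intros s t Hs Ht. apply HS in Hs; [|apply Hlt; in_app].
    apply HS in Ht; [|now apply Hlt].
    pose proof (chain_before _ _ _ _ _ _ _ _ Hc Hb). lra. }
assert (H2 : forall l, (forall b, In b l -> b = a \/ In b l2) ->
  filter (fun b => decP (Iless (St b) (St a))) l = []).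
{ induction l as [|b l IH]; intros Hl; [reflexivity|]. simpl.
  rewrite decP_false, IH; [reflexivity| |].
  - intros c Hcl. apply Hl. now right.
  - intros Hless. pose proof (Hpq a Ha) as Hpa.
    assert (Hb : In b (l1 ++ a :: l2)).
    { destruct (Hl b (or_introl eq_refl)) as [->|Hb]; [exact Ha|]. apply in_or_app. right. now right. }
    pose proof (Hpq b Hb) as Hpb.
    assert (Hab : p a <= p b).
    { destruct (Hl b (or_introl eq_refl)) as [->|Hb2]; [lra|].
      pose proof (chain_after _ _ _ _ _ _ _ _ Hc Hb2). lra. }
    assert (p b < p a); [|lra].
    apply Hless; apply HS; auto; lra. }
rewrite filter_app, H1, H2; [now rewrite app_nil_r|simpl; intuition|auto].
Qed.

Lemma chain_rank_last (d : nat) (St : nat -> R -> Prop) p q x l y a :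
  chain p q x l y -> Permutation l (seq 0 d) ->
  (forall b t, (b < d)%nat -> (St b t <-> p b <= t < q b)) -> (a < d)%nat ->
  S (countL d (fun b => Iless (St b) (St a))) = d -> a = last0 l.
Proof.
intros Hc Hp HS Ha Hr.
assert (Hin : In a l).
{ apply (Permutation_in a (Permutation_sym Hp)). apply in_seq. lia. }
apply in_split in Hin. destruct Hin as [l1 [l2 ->]].
rewrite (chain_rank d St p q x l1 a l2 y Hc Hp HS) in Hr.
apply Permutation_length in Hp. rewrite length_app, length_seq in Hp. simpl in Hp.
destruct l2; [|simpl in Hp; lia]. now rewrite last_last.
Qed.

Lemma Ilen_interval (P : R -> Prop) p q L : p < q -> (forall t, P t <-> p <= t < q) -> Ilen P L -> L = q - p.
Proof.
intros Hpq HP [u [v [Huv [HL [H1 H2]]]]].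
assert (Hp : u <= p) by (apply H1; apply HP; lra).
assert (Hq : q <= v).
{ apply Rnot_lt_le. intros Hlt. assert (H : P (Rmax p ((q + v) / 2))).
  { apply HP. unfold Rmax. destruct (Rle_dec _ _); lra. }
  apply H1 in H. pose proof (Rmax_r p ((q + v) / 2)). lra. }
assert (Hu : u = p).
{ destruct (Req_dec u p) as [|Hne]; [auto|]. exfalso.
  assert (H : P ((u + p) / 2)) by (apply H2; lra). apply HP in H. lra. }
assert (Hv : v = q).
{ destruct (Req_dec v q) as [|Hne]; [auto|]. exfalso.
  assert (H : P ((v + q) / 2)) by (apply H2; lra). apply HP in H. lra. }
subst. reflexivity.
Qed.

Lemma interval_eq p q p' q' : p < q -> (forall x, p' <= x < q' <-> p <= x < q) -> p' = p /\ q' = q.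
Proof.
intros Hpq H.
assert (H1 : p' <= p < q') by (apply H; lra).
assert (H2 : p <= p' < q) by (apply H; lra).
split; [lra|]. apply Rle_antisym.
- apply Rnot_lt_le. intros Hlt. assert (p <= q < q) by (apply H; lra). lra.
- apply Rnot_lt_le. intros Hlt. assert (p' <= q' < q') by (apply H; lra). lra.
Qed.

(** A functional form of [lists_step], so that the lists of all levels can be defined by recursion.
    An exhausted outer block is refilled with the moved letter followed by the middle block. *)
Definition next_lists (e : bool) (t : list nat * list nat * list nat) : list nat * list nat * list nat :=
  let '(A, B, C) := t in
  if e then match removelast C with
            | [] => (A, [], last0 C :: B)
            | C' => (A, last0 C :: B, C')
            end
  else match removelast A with
       | [] => (last0 A :: B, [], C)
       | A' => (A', last0 A :: B, C)
       end.

Lemma next_lists_step e A B C : A <> [] -> C <> [] ->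
  lists_step e (A, B, C) (next_lists e (A, B, C)).
Proof.
intros HA HC. unfold next_lists. destruct e.
- rewrite (app_removelast_last 0%nat HC) at 1.
  destruct (removelast C) as [|c C'].
  + constructor.
  + constructor. discriminate.
- rewrite (app_removelast_last 0%nat HA) at 1.
  destruct (removelast A) as [|c A'].
  + constructor.
  + constructor. discriminate.
Qed.

(** The classical move of type 0: the top order is unchanged, and in the bottom order [b1] is moved
    right behind the last letter of [C]. Merging blocks does not affect either concatenation. *)
Lemma next_lists_false A' b1 B C A2 B2 C2 : C <> [] ->
  next_lists false (A' ++ [b1], B, C) = (A2, B2, C2) ->
  A2 ++ B2 ++ C2 = A' ++ b1 :: B ++ C /\ C2 ++ B2 ++ A2 = C ++ b1 :: B ++ A' /\ A2 <> [] /\ C2 <> [].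
Proof.
intros HC. unfold next_lists. rewrite removelast_last, last_last.
destruct A' as [|a A']; intros [= <- <- <-]; simpl; (repeat split; auto; try discriminate).
now rewrite app_nil_r.
Qed.

Lemma next_lists_true A B C' b0 A2 B2 C2 : A <> [] ->
  next_lists true (A, B, C' ++ [b0]) = (A2, B2, C2) ->
  A2 ++ B2 ++ C2 = A ++ b0 :: B ++ C' /\ C2 ++ B2 ++ A2 = C' ++ b0 :: B ++ A /\ A2 <> [] /\ C2 <> [].
Proof.
intros HC. unfold next_lists. rewrite removelast_last, last_last.
destruct C' as [|a C']; intros [= <- <- <-]; simpl; (repeat split; auto; try discriminate).
now rewrite app_nil_r.
Qed.

(** * The invariant of a level and its propagation *)

Definition plo (g : giem) (a : nat) : R := fst (gpart g a).
Definition phi (g : giem) (a : nat) : R := snd (gpart g a).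

(** The bottom tiling uses the extended branches at the closed right ends, where they give the
    one-sided limits of the map; [li_map] concerns the half-open intervals only. *)
Record level_inv (d : nat) (g : giem) (H : nat -> R -> R) (A B C : list nat) : Prop := {
  li_perm : Permutation (A ++ B ++ C) (seq 0 d);
  li_A : A <> [];
  li_C : C <> [];
  li_top : chain (plo g) (phi g) (glo g) (A ++ B ++ C) (ghi g);
  li_bot : chain (fun a => H a (plo g a)) (fun a => H a (phi g a)) (glo g) (C ++ B ++ A) (ghi g);
  li_map : forall a x, (a < d)%nat -> inP g a x -> gmap g x = H a x }.

Arguments li_perm {d g H A B C}.
Arguments li_A {d g H A B C}.
Arguments li_C {d g H A B C}.
Arguments li_top {d g H A B C}.
Arguments li_bot {d g H A B C}.
Arguments li_map {d g H A B C}.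

Definition first_return (g g' : giem) : Prop :=
  forall x, inI g' x ->
    exists m, (1 <= m)%nat /\ inI g' (iterf (gmap g) m x) /\
      (forall j, (1 <= j)%nat -> (j < m)%nat -> ~ inI g' (iterf (gmap g) j x)) /\
      gmap g' x = iterf (gmap g) m x.

Definition newH (H : nat -> R -> R) (e : bool) (b0 b1 a : nat) (x : R) : R :=
  if Nat.eq_dec a (loser e b0 b1) then H b0 (H b1 x) else H a x.

Section RVStep.

Variables (d : nat) (g : giem) (H : nat -> R -> R) (A B C : list nat).
Hypothesis Hinc : forall a x y, x < y -> H a x < H a y.
Hypothesis Hcont : forall a x, continuity_pt (H a) x.
Hypothesis Inv : level_inv d g H A B C.

Let b0 := last0 C.
Let b1 := last0 A.

Lemma li_lt a : In a (A ++ B ++ C) <-> (a < d)%nat.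
Proof.
pose proof (li_perm Inv) as Hp. split; intros Ha.
- apply (Permutation_in a Hp) in Ha. apply in_seq in Ha. lia.
- apply (Permutation_in a (Permutation_sym Hp)). apply in_seq. lia.
Qed.

Lemma li_bot_perm : Permutation (C ++ B ++ A) (seq 0 d).
Proof.
eapply Permutation_trans; [|apply (li_perm Inv)].
rewrite (app_assoc C). eapply Permutation_trans; [apply Permutation_app_comm|].
apply Permutation_app_head. apply Permutation_app_comm.
Qed.

Lemma li_lt_bot a : In a (C ++ B ++ A) <-> (a < d)%nat.
Proof.
pose proof li_bot_perm as Hp. split; intros Ha.
- apply (Permutation_in a Hp) in Ha. apply in_seq in Ha. lia.
- apply (Permutation_in a (Permutation_sym Hp)). apply in_seq. lia.
Qed.

Lemma li_nodup : NoDup (A ++ B ++ C).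
Proof.
eapply Permutation_NoDup; [apply Permutation_sym, (li_perm Inv)|apply seq_NoDup].
Qed.

Lemma li_b01 : b0 <> b1.
Proof.
intros E. pose proof li_nodup as Hnd.
assert (InA : In b1 A) by (apply last_in, (li_A Inv)).
assert (InC : In b0 C) by (apply last_in, (li_C Inv)).
apply in_split in InA. destruct InA as [l1 [l2 Hx]]. rewrite Hx in Hnd.
rewrite <- app_assoc in Hnd. simpl in Hnd. apply NoDup_remove_2 in Hnd.
apply Hnd. apply in_or_app. right. apply in_or_app. right. apply in_or_app. right. now rewrite <- E.
Qed.

Lemma li_b0_lt : (b0 < d)%nat.
Proof. apply li_lt. apply in_or_app; right; apply in_or_app; right. apply last_in, (li_C Inv). Qed.

Lemma li_b1_lt : (b1 < d)%nat.
Proof. apply li_lt. apply in_or_app; left. apply last_in, (li_A Inv). Qed.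

Lemma li_lohi a : (a < d)%nat -> plo g a < phi g a.
Proof. intros Ha. apply li_lt in Ha. eapply chain_split; [apply (li_top Inv)|exact Ha]. Qed.

Lemma H_mono a x y : x <= y -> H a x <= H a y.
Proof. intros [Hl| ->]; [left; now apply Hinc|lra]. Qed.

Lemma H_lt_inv a x y : H a x < H a y -> x < y.
Proof. intros Hl. apply Rnot_le_lt. intros Hle. apply (H_mono a) in Hle. lra. Qed.

Lemma li_img a y : (a < d)%nat -> (img g a y <-> H a (plo g a) <= y < H a (phi g a)).
Proof.
intros Ha. pose proof (li_lohi a Ha) as Hl. unfold img, inP. fold (plo g a) (phi g a). split.
- intros [x [Hx ->]]. rewrite (li_map Inv a x Ha Hx). split; [now apply H_mono|now apply Hinc].
- intros [Hy1 Hy2]. destruct Hy1 as [Hy1|Hy1].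
  + destruct (IVT_incr (H a) (plo g a) (phi g a) y (Hcont a) Hl (conj Hy1 Hy2)) as [z [Hz1 Hz2]].
    exists z. split; [lra|]. rewrite <- Hz2. symmetry. apply (li_map Inv a z Ha).
    unfold inP. fold (plo g a) (phi g a). lra.
  + exists (plo g a). split; [lra|]. rewrite <- Hy1. symmetry. apply (li_map Inv a _ Ha).
    unfold inP. fold (plo g a) (phi g a). lra.
Qed.

Lemma li_inP a x : inP g a x <-> plo g a <= x < phi g a.
Proof. reflexivity. Qed.

Lemma li_top_last : phi g b0 = ghi g.
Proof.
pose proof (li_top Inv) as Ht. rewrite (app_removelast_last 0%nat (li_C Inv)) in Ht.
rewrite !app_assoc in Ht. apply chain_app in Ht. destruct Ht as [z [_ [_ [_ Ht]]]]. exact Ht.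
Qed.

Lemma li_bot_last : H b1 (phi g b1) = ghi g.
Proof.
pose proof (li_bot Inv) as Ht. rewrite (app_removelast_last 0%nat (li_A Inv)) in Ht.
rewrite !app_assoc in Ht. apply chain_app in Ht. destruct Ht as [z [_ [_ [_ Ht]]]]. exact Ht.
Qed.

(** The two last intervals both end at [ghi g], so comparing their lengths amounts to comparing
    their left ends in reverse. *)
Lemma li_rv_data e c0 c1 : RV_data d g e c0 c1 ->
  c0 = b0 /\ c1 = b1 /\ if e then H b1 (plo g b1) < plo g b0 else plo g b0 < H b1 (plo g b1).
Proof.
intros [Hc0 [Hp0 [Hc1 [Hp1 [L [HL Hlen]]]]]].
assert (E0 : c0 = b0).
{ transitivity (last0 (A ++ B ++ C)).
  - apply (chain_rank_last d (inP g) (plo g) (phi g) (glo g) (A ++ B ++ C) (ghi g) c0); auto.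
    + apply (li_top Inv).
    + apply (li_perm Inv).
    + intros; reflexivity.
  - rewrite (app_removelast_last 0%nat (li_C Inv)) at 1.
    rewrite !app_assoc, last_last. reflexivity. }
assert (E1 : c1 = b1).
{ transitivity (last0 (C ++ B ++ A)).
  - apply (chain_rank_last d (img g) (fun a => H a (plo g a)) (fun a => H a (phi g a))
      (glo g) (C ++ B ++ A) (ghi g) c1); auto.
    + apply (li_bot Inv).
    + apply li_bot_perm.
    + intros; now apply li_img.
  - rewrite (app_removelast_last 0%nat (li_A Inv)) at 1.
    rewrite !app_assoc, last_last. reflexivity. }
subst c0 c1. split; [reflexivity|]. split; [reflexivity|].
apply (Ilen_interval _ (H b1 (plo g b1)) (H b1 (phi g b1))) in HL.
- pose proof li_top_last as T. pose proof li_bot_last as T'. fold (plo g b0) (phi g b0) in Hlen.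
  simpl in Hlen. destruct e; lra.
- apply Hinc. apply li_lohi, li_b1_lt.
- intros; apply li_img, li_b1_lt.
Qed.

Lemma li_img_other a x : (a < d)%nat -> a <> b1 -> inP g a x -> glo g <= H a x < H b1 (plo g b1).
Proof.
intros Ha Hne Hx. pose proof (li_bot Inv) as Ht.
rewrite (app_removelast_last 0%nat (li_A Inv)) in Ht. fold b1 in Ht.
rewrite !app_assoc in Ht. assert (Hin := proj2 (li_lt_bot a) Ha).
rewrite (app_removelast_last 0%nat (li_A Inv)) in Hin. fold b1 in Hin.
rewrite !app_assoc in Hin. apply in_app_or in Hin. destruct Hin as [Hin|[Hin|[]]]; [|congruence].
pose proof (chain_before _ _ _ _ _ _ _ _ Ht Hin) as H1. simpl in H1.
apply chain_app in Ht. destruct Ht as [z [Ht _]].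
destruct (chain_split _ _ _ _ _ _ Ht Hin) as [H2 _].
destruct Hx as [Hx1 Hx2]. fold (plo g a) in Hx1. fold (phi g a) in Hx2.
apply (H_mono a) in Hx1. apply (Hinc a) in Hx2. lra.
Qed.

Lemma li_inI_P x : inI g x -> exists a, (a < d)%nat /\ inP g a x.
Proof.
intros Hx. destruct (chain_cover _ _ _ _ _ x (li_top Inv) Hx) as [a [Ha Hax]].
exists a. split; [now apply li_lt|exact Hax].
Qed.

Lemma li_P_inI a x : (a < d)%nat -> inP g a x -> inI g x.
Proof.
intros Ha Hx. apply li_lt in Ha.
destruct (chain_split _ _ _ _ _ _ (li_top Inv) Ha) as [H1 [H2 H3]].
unfold inP in Hx. fold (plo g a) (phi g a) in Hx. unfold inI. lra.
Qed.

Lemma li_P_unique a b x : (a < d)%nat -> (b < d)%nat -> inP g a x -> inP g b x -> a = b.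
Proof.
intros Ha Hb. apply li_lt in Ha. apply li_lt in Hb.
apply (chain_unique _ _ _ _ _ a b x (li_top Inv) Ha Hb).
Qed.

Lemma li_ends : exists A' C', A = A' ++ [b1] /\ C = C' ++ [b0] /\
  forall a, In a (A' ++ B ++ C') -> (a < d)%nat /\ a <> b0 /\ a <> b1.
Proof.
pose proof (app_removelast_last 0%nat (li_A Inv)) as DA. fold b1 in DA.
pose proof (app_removelast_last 0%nat (li_C Inv)) as DC. fold b0 in DC.
exists (removelast A), (removelast C). split; [exact DA|]. split; [exact DC|].
intros a Ha. pose proof li_nodup as Hnd. split; [|split].
- apply li_lt. rewrite DA, DC. in_app.
- intros ->. rewrite DC, !app_assoc in Hnd. apply NoDup_remove_2 in Hnd. apply Hnd. rewrite DA. in_app.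
- intros ->. rewrite DA, <- app_assoc in Hnd. apply NoDup_remove_2 in Hnd. apply Hnd. rewrite DC. in_app.
Qed.

(** The return to the new domain takes one step off the loser and two steps on it. This identifies
    the first return map and, level by level, the return times under [f]. *)
Definition return_facts (e : bool) (g' : giem) : Prop :=
  (forall x, inI g' x -> inI g x) /\
  (forall a x, (a < d)%nat -> a <> loser e b0 b1 -> inP g' a x -> inP g a x /\ inI g' (H a x)) /\
  (forall x, inP g' (loser e b0 b1) x ->
     inP g b1 x /\ inP g b0 (H b1 x) /\ ~ inI g' (H b1 x) /\ inI g' (H b0 (H b1 x))).

Lemma first_return_map e g' :
  first_return g g' ->
  (forall a x, (a < d)%nat -> inP g' a x -> inI g' x) ->
  return_facts e g' ->
  forall a x, (a < d)%nat -> inP g' a x -> gmap g' x = newH H e b0 b1 a x.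
Proof.
intros Hret HPI [_ [Hnl Hl]] a x Ha Hx.
destruct (Hret x (HPI a x Ha Hx)) as [m [Hm1 [Hm2 [Hm3 Hm4]]]]. rewrite Hm4.
unfold newH. destruct (Nat.eq_dec a (loser e b0 b1)) as [->|Hne].
- destruct (Hl x Hx) as [K1 [K2 [K3 K4]]].
  assert (G1 : gmap g x = H b1 x) by (apply (li_map Inv); [apply li_b1_lt|exact K1]).
  assert (G2 : gmap g (H b1 x) = H b0 (H b1 x)).
  { apply (li_map Inv); [apply li_b0_lt|exact K2]. }
  destruct m as [|[|[|m]]].
  + lia.
  + exfalso. apply K3. unfold iterf in Hm2. simpl in Hm2. now rewrite G1 in Hm2.
  + unfold iterf. simpl. rewrite G1. exact G2.
  + exfalso. apply (Hm3 2%nat); [lia|lia|]. unfold iterf. simpl. now rewrite G1, G2.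
- destruct (Hnl a x Ha Hne Hx) as [K1 K2].
  assert (G1 : gmap g x = H a x) by (now apply (li_map Inv)).
  destruct m as [|[|m]].
  + lia.
  + exact G1.
  + exfalso. apply (Hm3 1%nat); [lia|lia|]. unfold iterf. simpl. now rewrite G1.
Qed.

Lemma rv_step_false g' A2 B2 C2 :
  next_lists false (A, B, C) = (A2, B2, C2) ->
  plo g b0 < H b1 (plo g b1) ->
  (forall x, inI g' x <-> inI g x /\ ~ img g b1 x) ->
  (forall a, (a < d)%nat -> a <> b0 -> gpart g' a = gpart g a) ->
  (forall x, inP g' b0 x <-> inP g b0 x /\ ~ img g b1 x) ->
  first_return g g' ->
  explicit_step d false b0 b1 (H b1) (plo g) (phi g) (plo g') (phi g') /\
  level_inv d g' (newH H false b0 b1) A2 B2 C2 /\ return_facts false g'.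
Proof.
intros Hnext Hlen HI Hpart HP0 Hret.
pose proof li_b0_lt as Lb0. pose proof li_b1_lt as Lb1. pose proof li_b01 as Hb01.
pose proof li_top_last as T. pose proof li_bot_last as T'.
set (z := H b1 (plo g b1)) in *.
pose proof (Hinc b1 _ _ (li_lohi b1 Lb1)) as Hz. fold z in Hz.
destruct (chain_split _ _ _ _ _ _ (li_top Inv) (proj2 (li_lt b0) Lb0)) as [Hb0a [Hb0b Hb0c]].
assert (HI' : glo g' = glo g /\ ghi g' = z).
{ apply interval_eq; [lra|]. intros x. fold (inI g' x). rewrite HI, (li_img b1 x Lb1). fold z.
  unfold inI. lra. }
destruct HI' as [Eglo Eghi].
assert (HP0' : plo g' b0 = plo g b0 /\ phi g' b0 = z).
{ apply interval_eq; [lra|]. intros x. change (inP g' b0 x <-> plo g b0 <= x < z).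
  rewrite HP0, (li_img b1 x Lb1), li_inP. fold z. lra. }
destruct HP0' as [Elo0 Ehi0].
assert (Hother : forall a, (a < d)%nat -> a <> b0 -> plo g' a = plo g a /\ phi g' a = phi g a).
{ intros a Ha Hne. unfold plo, phi. rewrite (Hpart a Ha Hne). auto. }
assert (HRF : return_facts false g').
{ split; [intros x Hx; now apply HI|]. split.
  - simpl. intros a x Ha Hne Hx.
    assert (HPx : inP g a x).
    { destruct (Nat.eq_dec a b0) as [->|Hn0]; [now apply HP0|].
      unfold inP in *. rewrite (Hpart a Ha Hn0) in Hx. exact Hx. }
    split; [exact HPx|]. unfold inI. rewrite Eglo, Eghi. now apply li_img_other.
  - simpl. intros x Hx. destruct (Hother b1 Lb1 (not_eq_sym Hb01)) as [F1 F2].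
    assert (HPx : inP g b1 x).
    { unfold inP in *. rewrite (Hpart b1 Lb1 (not_eq_sym Hb01)) in Hx. exact Hx. }
    assert (Hy : z <= H b1 x < ghi g).
    { destruct HPx as [X1 X2]. apply (H_mono b1) in X1. apply (Hinc b1) in X2.
      split; [exact X1|rewrite <- T'; exact X2]. }
    split; [exact HPx|].
    assert (HPy : inP g b0 (H b1 x)) by (apply li_inP; lra).
    split; [exact HPy|]. split; [unfold inI; lra|].
    unfold inI. rewrite Eglo, Eghi. now apply li_img_other. }
split; [|split; [|exact HRF]].
{ split; [now rewrite T|]. split; [exact Ehi0|]. split; [exact Elo0|exact Hother]. }
destruct li_ends as [A' [C' [DA [DC Hmid]]]].
rewrite DA in Hnext.
apply next_lists_false in Hnext; [|apply (li_C Inv)].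
destruct Hnext as [W1 [W2 [W3 W4]]].
assert (Wtop : A2 ++ B2 ++ C2 = A ++ B ++ C) by (rewrite W1, DA, <- app_assoc; reflexivity).
assert (Htop' : chain (plo g') (phi g') (glo g') (A2 ++ B2 ++ C2) (ghi g')).
{ rewrite Wtop, Eglo, Eghi. pose proof (li_top Inv) as Ht. rewrite DC in Ht |- *.
  rewrite !app_assoc in Ht |- *. apply chain_app in Ht. apply chain_app.
  destruct Ht as [y [Ht1 [Ht2 [Ht3 Ht4]]]]. exists y. split.
  - eapply chain_ext; [|exact Ht1]. intros a Ha. destruct (Nat.eq_dec b1 a) as [<-|Hn1].
    + apply Hother; auto.
    + destruct (Hmid a) as [M1 [M2 M3]]; [rewrite DA in Ha; in_app|]. now apply Hother.
  - simpl. rewrite Elo0, Ehi0. repeat split; auto. }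
constructor; auto.
- rewrite Wtop. apply (li_perm Inv).
- rewrite W2, Eglo, Eghi. pose proof (li_bot Inv) as Ht.
  rewrite DC in Ht |- *. rewrite DA in Ht.
  rewrite <- !app_assoc in Ht. simpl in Ht. rewrite <- !app_assoc. simpl.
  apply chain_app in Ht. destruct Ht as [y [Ht1 [Ht2 [Ht3 Ht4]]]].
  rewrite !app_assoc in Ht4. apply chain_app in Ht4. destruct Ht4 as [y2 [Ht4 [Ht5 [Ht6 Ht7]]]].
  apply chain_app. exists y.
  assert (N0 : forall x, newH H false b0 b1 b0 x = H b0 x).
  { intros x. unfold newH, loser. destruct (Nat.eq_dec b0 b1); congruence. }
  assert (N1 : forall x, newH H false b0 b1 b1 x = H b0 (H b1 x)).
  { intros x. unfold newH, loser. destruct (Nat.eq_dec b1 b1); congruence. }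
  assert (Nx : forall a, In a (A' ++ B ++ C') ->
     newH H false b0 b1 a (plo g' a) = H a (plo g a) /\ newH H false b0 b1 a (phi g' a) = H a (phi g a)).
  { intros a Ha. destruct (Hmid a Ha) as [M1 [M2 M3]].
    unfold newH, loser. destruct (Nat.eq_dec a b1) as [E|_]; [congruence|].
    destruct (Hother a M1 M2) as [-> ->]. auto. }
  split.
  + eapply chain_ext; [|exact Ht1]. intros a Ha. apply Nx. in_app.
  + simpl. rewrite !N0, !N1, Elo0, Ehi0. destruct (Hother b1 Lb1 (not_eq_sym Hb01)) as [-> ->].
    fold z. rewrite T', <- T. repeat split; auto.
    * rewrite T. apply Hinc. lra.
    * eapply chain_ext; [|simpl in Ht5; unfold z; rewrite Ht5; exact Ht4].
      intros a Ha. apply Nx. apply in_app_or in Ha. apply in_or_app.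
      destruct Ha as [Ha|Ha]; [right; in_app|now left].
- apply (first_return_map false g' Hret); [|exact HRF].
  intros a x Ha Hx. apply HI. destruct (Nat.eq_dec a b0) as [->|Hn0].
  + apply HP0 in Hx. split; [now apply (li_P_inI b0)|apply Hx].
  + assert (HPx : inP g a x) by (unfold inP in *; rewrite (Hpart a Ha Hn0) in Hx; exact Hx).
    split; [now apply (li_P_inI a)|]. rewrite (li_img b1 x Lb1). fold z. intros [X1 X2].
    apply Hn0. apply (li_P_unique a b0 x); auto. apply li_inP. lra.
Qed.

Lemma rv_step_true g' A2 B2 C2 :
  next_lists true (A, B, C) = (A2, B2, C2) ->
  H b1 (plo g b1) < plo g b0 ->
  (forall x, inI g' x <-> inI g x /\ ~ inP g b0 x) ->
  (forall a, (a < d)%nat -> a <> b0 -> a <> b1 -> gpart g' a = gpart g a) ->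
  (forall x, inP g' b1 x <-> inI g x /\ img g b1 (gmap g x) /\ ~ inP g b0 (gmap g x)) ->
  (forall x, inP g' b0 x <-> inP g b1 x /\ ~ inP g' b1 x) ->
  first_return g g' ->
  explicit_step d true b0 b1 (H b1) (plo g) (phi g) (plo g') (phi g') /\
  level_inv d g' (newH H true b0 b1) A2 B2 C2 /\ return_facts true g'.
Proof.
intros Hnext Hlen HI Hpart HP1 HP0 Hret.
pose proof li_b0_lt as Lb0. pose proof li_b1_lt as Lb1. pose proof li_b01 as Hb01.
pose proof li_top_last as T. pose proof li_bot_last as T'.
pose proof (li_lohi b1 Lb1) as Hlh1.
destruct (chain_split _ _ _ _ _ _ (li_top Inv) (proj2 (li_lt b0) Lb0)) as [Hb0a [Hb0b Hb0c]].
destruct (chain_split _ _ _ _ _ _ (li_bot Inv) (proj2 (li_lt_bot b1) Lb1)) as [Hb1a _].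
(* The cut point: the part of the interval of [b1] to the right of [z] is mapped onto the interval
   of [b0]. *)
destruct (IVT_incr (H b1) (plo g b1) (phi g b1) (plo g b0) (Hcont b1) Hlh1) as [z [Hz1 Hz2]].
{ rewrite T', <- T. lra. }
assert (HI' : glo g' = glo g /\ ghi g' = plo g b0).
{ apply interval_eq; [lra|]. intros x. fold (inI g' x). rewrite HI, li_inP.
  unfold inI. lra. }
destruct HI' as [Eglo Eghi].
assert (HP1x : forall x, inP g' b1 x <-> plo g b1 <= x < z).
{ intros x. rewrite HP1. split.
  - intros [Hx [Himg HnP]]. apply (li_img b1 _ Lb1) in Himg.
    destruct (li_inI_P x Hx) as [a [Ha HxP]]. rewrite (li_map Inv a x Ha HxP) in *.
    destruct (Nat.eq_dec a b1) as [->|Hne].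
    + split; [apply HxP|]. apply (H_lt_inv b1). rewrite Hz2. rewrite li_inP in HnP.
      destruct HxP as [_ HxP]. apply (Hinc b1) in HxP. fold (phi g b1) in HxP. lra.
    + pose proof (li_img_other a x Ha Hne HxP). lra.
  - intros Hx. assert (HxP : inP g b1 x) by (apply li_inP; lra).
    rewrite (li_map Inv b1 x Lb1 HxP). split; [now apply (li_P_inI b1)|].
    assert (H b1 x < plo g b0) by (rewrite <- Hz2; apply Hinc; lra).
    split.
    + apply (li_img b1 _ Lb1). split; [apply H_mono; lra|]. rewrite T', <- T. lra.
    + rewrite li_inP. lra. }
assert (HP1' : plo g' b1 = plo g b1 /\ phi g' b1 = z) by (apply interval_eq; [lra|exact HP1x]).
destruct HP1' as [Elo1 Ehi1].
assert (HP0x : forall x, inP g' b0 x <-> z <= x < phi g b1).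
{ intros x. rewrite HP0, HP1x, li_inP. lra. }
assert (HP0' : plo g' b0 = z /\ phi g' b0 = phi g b1) by (apply interval_eq; [lra|exact HP0x]).
destruct HP0' as [Elo0 Ehi0].
assert (Hother : forall a, (a < d)%nat -> a <> b0 -> a <> b1 -> plo g' a = plo g a /\ phi g' a = phi g a).
{ intros a Ha Hne0 Hne1. unfold plo, phi. rewrite (Hpart a Ha Hne0 Hne1). auto. }
assert (Himgother : forall a x, (a < d)%nat -> a <> b1 -> inP g a x -> inI g' (H a x)).
{ intros a x Ha Hne Hx. pose proof (li_img_other a x Ha Hne Hx). unfold inI. rewrite Eglo, Eghi. lra. }
assert (HRF : return_facts true g').
{ split; [intros x Hx; now apply HI|]. split.
  - simpl. intros a x Ha Hne Hx. destruct (Nat.eq_dec a b1) as [->|Hn1].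
    + apply HP1x in Hx. split; [apply li_inP; lra|]. unfold inI. rewrite Eglo, Eghi. split.
      * apply Rle_trans with (H b1 (plo g b1)); [exact Hb1a|apply H_mono; lra].
      * rewrite <- Hz2. apply Hinc. lra.
    + assert (HPx : inP g a x) by (unfold inP in *; rewrite (Hpart a Ha Hne Hn1) in Hx; exact Hx).
      split; [exact HPx|]. now apply Himgother.
  - simpl. intros x Hx. apply HP0x in Hx.
    assert (HPx : inP g b1 x) by (apply li_inP; lra).
    assert (Hy : plo g b0 <= H b1 x < phi g b0).
    { rewrite <- Hz2, T, <- T'. split; [apply H_mono; lra|apply Hinc; lra]. }
    split; [exact HPx|]. split; [exact Hy|]. split; [unfold inI; lra|].
    apply Himgother; auto. }
split; [|split; [|exact HRF]].
{ split; [now rewrite T|]. rewrite Ehi1. auto. }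
destruct li_ends as [A' [C' [DA [DC Hmid]]]].
rewrite DC in Hnext.
apply next_lists_true in Hnext; [|apply (li_A Inv)].
destruct Hnext as [W1 [W2 [W3 W4]]].
assert (Htop' : chain (plo g') (phi g') (glo g') (A2 ++ B2 ++ C2) (ghi g')).
{ rewrite W1, Eglo, Eghi. pose proof (li_top Inv) as Ht. rewrite DA, DC in Ht. rewrite DA.
  rewrite <- !app_assoc in Ht |- *. simpl in Ht |- *. apply chain_app in Ht. apply chain_app.
  destruct Ht as [y [Ht1 [Ht2 [Ht3 Ht4]]]]. exists y. split.
  - eapply chain_ext; [|exact Ht1]. intros a Ha.
    destruct (Hmid a) as [M1 [M2 M3]]; [in_app|]. now apply Hother.
  - simpl. rewrite Elo0, Ehi0, Elo1, Ehi1. rewrite !app_assoc in Ht4. apply chain_app in Ht4.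
    destruct Ht4 as [y2 [Ht4 [Ht5 _]]]. repeat split; auto; try lra.
    rewrite Ht5. eapply chain_ext; [|exact Ht4]. intros a Ha.
    destruct (Hmid a) as [M1 [M2 M3]]; [in_app|]. now apply Hother. }
constructor; auto.
- eapply Permutation_trans; [|apply (li_perm Inv)]. rewrite W1, DC.
  apply Permutation_app_head. rewrite (app_assoc B).
  apply (Permutation_cons_append (B ++ C') b0).
- rewrite W2, Eglo, Eghi. pose proof (li_bot Inv) as Ht.
  rewrite DA, DC in Ht. rewrite DA.
  rewrite <- !app_assoc in Ht. simpl in Ht.
  apply chain_app in Ht. destruct Ht as [y [Ht1 [Ht2 [Ht3 Ht4]]]].
  rewrite !app_assoc in Ht4. apply chain_app in Ht4. destruct Ht4 as [y2 [Ht4 [Ht5 [Ht6 Ht7]]]].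
  apply chain_app. exists y.
  assert (N0 : forall x, newH H true b0 b1 b0 x = H b0 (H b1 x)).
  { intros x. unfold newH, loser. destruct (Nat.eq_dec b0 b0); congruence. }
  assert (N1 : forall x, newH H true b0 b1 b1 x = H b1 x).
  { intros x. unfold newH, loser. destruct (Nat.eq_dec b1 b0); congruence. }
  assert (Nx : forall a, In a (A' ++ B ++ C') ->
     newH H true b0 b1 a (plo g' a) = H a (plo g a) /\ newH H true b0 b1 a (phi g' a) = H a (phi g a)).
  { intros a Ha. destruct (Hmid a Ha) as [M1 [M2 M3]].
    unfold newH, loser. destruct (Nat.eq_dec a b0) as [E|_]; [congruence|].
    destruct (Hother a M1 M2 M3) as [-> ->]. auto. }
  split.
  + eapply chain_ext; [|exact Ht1]. intros a Ha. apply Nx. in_app.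
  + simpl. rewrite !N0, Elo0, Ehi0, Hz2, T', <- T. repeat split; auto.
    rewrite app_assoc. apply chain_app. exists y2. split.
    * eapply chain_ext; [|exact Ht4].
      intros a Ha. apply Nx. apply in_app_or in Ha. apply in_or_app.
      destruct Ha as [Ha|Ha]; [right; in_app|now left].
    * simpl. rewrite !N1, Elo1, Ehi1, Hz2. repeat split; auto.
- apply (first_return_map true g' Hret); [|exact HRF].
  intros a x Ha Hx. apply HI. rewrite li_inP.
  destruct (Nat.eq_dec a b0) as [->|Hn0]; [|destruct (Nat.eq_dec a b1) as [->|Hn1]].
  + apply HP0x in Hx. assert (HPx : inP g b1 x) by (apply li_inP; lra).
    split; [now apply (li_P_inI b1)|]. intros Hx0. apply Hb01. apply (li_P_unique b0 b1 x); auto.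
  + apply HP1x in Hx. assert (HPx : inP g b1 x) by (apply li_inP; lra).
    split; [now apply (li_P_inI b1)|]. intros Hx0. apply Hb01. apply (li_P_unique b0 b1 x); auto.
  + assert (HPx : inP g a x) by (unfold inP in *; rewrite (Hpart a Ha Hn0 Hn1) in Hx; exact Hx).
    split; [now apply (li_P_inI a)|]. intros Hx0. apply Hn0. apply (li_P_unique a b0 x); auto.
Qed.

(** The type is existentially quantified in [RV_step]; this makes it a function of the level, with
    which all admissible data agree by [rv_data_type]. *)
Definition rv_type : bool := decP (exists c0 c1, RV_data d g true c0 c1).

Lemma rv_data_type e c0 c1 : RV_data d g e c0 c1 -> e = rv_type /\ c0 = b0 /\ c1 = b1.
Proof.
intros HR. destruct (li_rv_data e c0 c1 HR) as [E0 [E1 Hlen]]. split; [|auto].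
unfold rv_type. destruct e.
- symmetry. apply decP_true. now exists c0, c1.
- symmetry. apply decP_false. intros [c0' [c1' HR']].
  destruct (li_rv_data true c0' c1' HR') as [_ [_ Hlen']]. lra.
Qed.

Lemma rv_step_inv g' A2 B2 C2 :
  RV_step d g g' -> next_lists rv_type (A, B, C) = (A2, B2, C2) ->
  explicit_step d rv_type b0 b1 (H b1) (plo g) (phi g) (plo g') (phi g') /\
  level_inv d g' (newH H rv_type b0 b1) A2 B2 C2 /\ return_facts rv_type g' /\
  RV_data d g rv_type b0 b1.
Proof.
intros [e [c0 [c1 [HR [Hstep Hret]]]]] Hnext.
destruct (rv_data_type e c0 c1 HR) as [Ee [-> ->]].
destruct (li_rv_data e b0 b1 HR) as [_ [_ Hlen]]. rewrite Ee in *.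
clear Ee. destruct rv_type.
- destruct Hstep as [S1 [S2 [S3 S4]]].
  destruct (rv_step_true g' A2 B2 C2 Hnext Hlen S1 S2 S3 S4 Hret) as [R1 [R2 R3]]. auto.
- destruct Hstep as [S1 [S2 S3]].
  destruct (rv_step_false g' A2 B2 C2 Hnext Hlen S1 S2 S3 Hret) as [R1 [R2 R3]]. auto.
Qed.

End RVStep.

(** * The initial blocks *)

(** Sorting by selection: the interval containing the left end [x] must start there; remove it and
    continue from its right end. *)
Lemma chain_exists p q l x y :
  NoDup l -> x <= y ->
  (forall a, In a l -> p a < q a /\ x <= p a /\ q a <= y) ->
  (forall a b t, In a l -> In b l -> p a <= t < q a -> p b <= t < q b -> a = b) ->
  (forall t, x <= t < y -> exists a, In a l /\ p a <= t < q a) ->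
  exists l', Permutation l' l /\ chain p q x l' y.
Proof.
remember (length l) as n eqn:En. revert l x En.
induction n as [|n IH]; intros l x En Hnd Hxy Hb Hdis Hcov.
- destruct l; [|discriminate]. exists []. split; [constructor|]. simpl.
  destruct (Req_dec x y) as [|Hne]; [auto|]. destruct (Hcov x) as [a [[] _]]. lra.
- assert (Hlt : x < y).
  { destruct l as [|a l]; [discriminate|]. destruct (Hb a (or_introl eq_refl)). lra. }
  destruct (Hcov x) as [a [Ha Hax]]; [lra|].
  destruct (Hb a Ha) as [Ha1 [Ha2 Ha3]].
  apply in_split in Ha. destruct Ha as [l1 [l2 ->]].
  assert (Hin : forall b, In b (l1 ++ l2) -> In b (l1 ++ a :: l2) /\ b <> a).
  { intros b Hbl. split.
    - apply in_app_or in Hbl. apply in_or_app. simpl. tauto.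
    - intros ->. apply NoDup_remove_2 in Hnd. auto. }
  assert (Haa : In a (l1 ++ a :: l2)) by (apply in_or_app; right; now left).
  destruct (IH (l1 ++ l2) (q a)) as [l' [Hp Hc]].
  + rewrite length_app in *. simpl in En. lia.
  + now apply NoDup_remove_1 in Hnd.
  + exact Ha3.
  + intros b Hbl. destruct (Hin b Hbl) as [Hb1 Hb2]. destruct (Hb b Hb1) as [B1 [B2 B3]].
    split; [exact B1|]. split; [|exact B3]. apply Rnot_lt_le. intros Hlt'.
    apply Hb2. apply (Hdis b a (p b)); auto; lra.
  + intros b c t Hbl Hcl. apply Hdis; [apply (Hin b Hbl)|apply (Hin c Hcl)].
  + intros t Ht. destruct (Hcov t) as [b [Hbl Hbt]]; [lra|]. exists b. split; [|exact Hbt].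
    apply in_app_or in Hbl. apply in_or_app. destruct Hbl as [Hbl|[<-|Hbl]]; [tauto|lra|tauto].
  + exists (a :: l'). split.
    * apply Permutation_cons_app. exact Hp.
    * simpl. repeat split; auto. lra.
Qed.

Lemma chain_last p q x l y : l <> [] -> chain p q x l y -> y = q (last0 l) /\ x = p (hd0 l).
Proof.
intros Hne Hc. split.
- rewrite (app_removelast_last 0%nat Hne) in Hc. apply chain_app in Hc.
  destruct Hc as [z [_ [_ [_ Hc]]]]. symmetry. exact Hc.
- destruct l; [congruence|]. simpl in *. symmetry. apply Hc.
Qed.

(** A maximal initial run of letters whose images also adjoin. If anything follows, the images fail
    to adjoin there, which will be a discontinuity. *)
Lemma split_block p q t : t <> [] -> (forall a, In a t -> p a < q a) ->
  exists X rest, t = X ++ rest /\ X <> [] /\ chain p q (p (hd0 X)) X (q (last0 X)) /\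
    (rest <> [] -> q (last0 X) <> p (hd0 rest)).
Proof.
induction t as [|a t IH]; intros Hne Hpq; [congruence|].
assert (Hpa : p a < q a) by (apply Hpq; now left).
destruct t as [|c t].
- exists [a], []. simpl. repeat split; auto; try discriminate; congruence.
- destruct (Req_dec (q a) (p c)) as [Heq|Hneq].
  + destruct IH as [X [rest [Ht [HX [Hc Hr]]]]]; [discriminate|intros; apply Hpq; now right|].
    exists (a :: X), rest.
    assert (Hhd : hd0 X = c) by (destruct X; [congruence|]; injection Ht as <- _; reflexivity).
    rewrite last_cons_nonnil by exact HX.
    split; [now rewrite Ht|]. split; [discriminate|]. split; [|exact Hr].
    simpl. split; [reflexivity|]. split; [exact Hpa|]. rewrite Heq, <- Hhd. exact Hc.
  + exists [a], (c :: t). simpl. repeat split; auto; try discriminate.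
Qed.

(** The image of a block is one interval, so sorting these intervals yields the bottom order as a
    permutation of whole blocks. *)
Lemma blocks_chain p q x y (blk : nat -> list nat) (m : nat) (t : list nat) :
  (forall i, (i < m)%nat -> blk i <> [] /\
     chain p q (p (hd0 (blk i))) (blk i) (q (last0 (blk i)))) ->
  x <= y ->
  t = concat (map blk (seq 0 m)) -> NoDup t ->
  (forall a, In a t -> x <= p a /\ q a <= y) ->
  (forall a b s, In a t -> In b t -> p a <= s < q a -> p b <= s < q b -> a = b) ->
  (forall s, x <= s < y -> exists a, In a t /\ p a <= s < q a) ->
  exists l', Permutation l' (seq 0 m) /\ chain p q x (concat (map blk l')) y.
Proof.
intros Hblk Hxy Ht Hnd Hb Hdis Hcov.
set (bp := fun i => p (hd0 (blk i))). set (bq := fun i => q (last0 (blk i))).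
assert (Hin : forall i a, (i < m)%nat -> In a (blk i) -> In a t).
{ intros i a Hi Ha. rewrite Ht. apply in_concat. exists (blk i). split; [|exact Ha].
  apply in_map. apply in_seq. lia. }
assert (Huniq : forall i j a, (i < m)%nat -> (j < m)%nat -> In a (blk i) -> In a (blk j) -> i = j).
{ rewrite Ht in Hnd. clear - Hnd. 
  assert (Hgen : forall l, NoDup (concat (map blk l)) -> NoDup l -> forall i j a, In i l -> In j l ->
    In a (blk i) -> In a (blk j) -> i = j).
  { induction l as [|k l IH]; intros Hc Hl i j a Hi Hj Hai Haj; [destruct Hi|].
    simpl in Hc. inversion Hl as [|? ? Hk Hl']; subst.
    assert (Hno : forall i, In i l -> In a (blk i) -> In a (blk k) -> False).
    { intros i' Hi' Ha1 Ha2. apply in_split in Ha2. destruct Ha2 as [m1 [m2 Hm]]. rewrite Hm in Hc.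
      rewrite <- app_assoc in Hc. simpl in Hc. apply NoDup_remove_2 in Hc. apply Hc.
      apply in_or_app. right. apply in_or_app. right. apply in_concat. exists (blk i').
      split; [now apply in_map|exact Ha1]. }
    destruct Hi as [<-|Hi], Hj as [<-|Hj]; auto.
    - exfalso. eapply Hno; eauto.
    - exfalso. eapply Hno; eauto.
    - apply (IH ltac:(eapply NoDup_app_remove_l; exact Hc) Hl' i j a); auto. }
  intros i j a Hi Hj. apply (Hgen (seq 0 m) Hnd (seq_NoDup m 0)); apply in_seq; lia. }
destruct (chain_exists bp bq (seq 0 m) x y) as [l' [Hp Hc]].
- apply seq_NoDup.
- exact Hxy.
- intros i Hi. apply in_seq in Hi. destruct (Hblk i ltac:(lia)) as [Hne Hch].
  pose proof (hd_in _ Hne) as Hh. pose proof (last_in _ Hne) as Hl.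
  destruct (chain_split _ _ _ _ _ _ Hch Hh) as [_ [C1 C2]].
  pose proof (Hb _ (Hin i _ ltac:(lia) Hh)). pose proof (Hb _ (Hin i _ ltac:(lia) Hl)).
  unfold bp, bq. lra.
- intros i j s Hi Hj Hsi Hsj. apply in_seq in Hi. apply in_seq in Hj.
  destruct (Hblk i ltac:(lia)) as [_ Hchi]. destruct (Hblk j ltac:(lia)) as [_ Hchj].
  destruct (chain_cover _ _ _ _ _ s Hchi Hsi) as [a [Ha Hsa]].
  destruct (chain_cover _ _ _ _ _ s Hchj Hsj) as [b [Hb' Hsb]].
  assert (a = b) by (apply (Hdis a b s); auto; [apply (Hin i)|apply (Hin j)]; auto; lia).
  subst b. apply (Huniq i j a); auto; lia.
- intros s Hs. destruct (Hcov s Hs) as [a [Ha Hsa]]. rewrite Ht in Ha. apply in_concat in Ha.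
  destruct Ha as [bl [Hbl Ha]]. apply in_map_iff in Hbl. destruct Hbl as [i [<- Hi]].
  exists i. split; [exact Hi|]. apply in_seq in Hi. destruct (Hblk i ltac:(lia)) as [_ Hch].
  destruct (chain_split _ _ _ _ _ _ Hch Ha) as [C1 [C2 C3]]. unfold bp, bq. lra.
- exists l'. split; [exact Hp|].
  assert (Hlt : forall i, In i l' -> (i < m)%nat).
  { intros i Hi. apply (Permutation_in i Hp) in Hi. apply in_seq in Hi. lia. }
  clear Hp Hxy Hb Hcov. revert x Hc. induction l' as [|i l' IH]; intros x Hc; [exact Hc|].
  destruct Hc as [Hc1 [Hc2 Hc3]]. simpl. apply chain_app. exists (bq i). split.
  + rewrite <- Hc1. apply Hblk. apply Hlt. now left.
  + apply IH; [|exact Hc3]. intros; apply Hlt; now right.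
Qed.

Lemma rank_prefix (d : nat) (St : nat -> R -> Prop) p q x P T y a :
  chain p q x (P ++ T) y -> Permutation (P ++ T) (seq 0 d) ->
  (forall b t, (b < d)%nat -> (St b t <-> p b <= t < q b)) -> (a < d)%nat ->
  (In a P <-> (countL d (fun b => Iless (St b) (St a)) < length P)%nat).
Proof.
intros Hc Hp HS Ha. split.
- intros Hin. apply in_split in Hin. destruct Hin as [l1 [l2 ->]].
  rewrite <- app_assoc in *. simpl in *.
  rewrite (chain_rank d St p q x l1 a (l2 ++ T) y Hc Hp HS). rewrite length_app. simpl. lia.
- intros Hr.
  assert (Hin : In a (P ++ T)).
  { apply (Permutation_in a (Permutation_sym Hp)). apply in_seq. lia. }
  apply in_app_or in Hin. destruct Hin as [Hin|Hin]; [exact Hin|].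
  apply in_split in Hin. destruct Hin as [l1 [l2 ->]]. rewrite app_assoc in *.
  rewrite (chain_rank d St p q x (P ++ l1) a l2 y Hc Hp HS) in Hr. rewrite length_app in Hr. lia.
Qed.

(** If a proper initial segment has the same letters in both orders, their ranks fill [1] to
    [length P] on both sides, which is what irreducibility forbids. *)
Lemma irreducible_prefix d g p q P T P' T' x y x' y' :
  irreducible d g ->
  chain (plo g) (phi g) x (P ++ T) y -> Permutation (P ++ T) (seq 0 d) ->
  chain p q x' (P' ++ T') y' -> Permutation (P' ++ T') (seq 0 d) ->
  (forall b t, (b < d)%nat -> (img g b t <-> p b <= t < q b)) ->
  Permutation P P' -> P <> [] -> T <> [] -> False.
Proof.
intros Hirr Ht Hpt Hb Hpb Himg HPP HP HT.
pose proof (Permutation_length Hpt) as Hlen. rewrite length_app, length_seq in Hlen.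
pose proof (Permutation_length HPP) as HlenP.
assert (Hl1 : (1 <= length P)%nat) by (destruct P; [congruence|simpl; lia]).
assert (Hl2 : (1 <= length T)%nat) by (destruct T; [congruence|simpl; lia]).
assert (HSt : forall b t, (b < d)%nat -> (inP g b t <-> plo g b <= t < phi g b)) by (intros; reflexivity).
apply (Hirr (length P) Hl1 ltac:(lia)). intros m. split.
- intros [a [Ha [[_ Hp0] <-]]].
  assert (Hin : In a P).
  { apply (rank_prefix d (inP g) _ _ _ _ _ _ a Ht Hpt HSt Ha). unfold pi0 in Hp0. lia. }
  apply (Permutation_in a HPP) in Hin.
  apply (rank_prefix d (img g) _ _ _ _ _ _ a Hb Hpb Himg Ha) in Hin. unfold pi1. lia.
- intros Hm.
  assert (Hin : In (nth (m - 1) P' 0%nat) P') by (apply nth_In; lia).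
  destruct (nth_split P' 0%nat (n := (m - 1)%nat) ltac:(lia)) as [l1 [l2 [HP' Hl]]].
  set (a := nth (m - 1) P' 0%nat) in *.
  assert (Ha : (a < d)%nat).
  { assert (Hin' : In a (P' ++ T')) by (in_app).
    apply (Permutation_in a Hpb) in Hin'. apply in_seq in Hin'. lia. }
  exists a. split; [exact Ha|]. split.
  + assert (HinP : In a P) by (apply (Permutation_in a (Permutation_sym HPP)); exact Hin).
    apply (rank_prefix d (inP g) _ _ _ _ _ _ a Ht Hpt HSt Ha) in HinP. unfold pi0. lia.
  + unfold pi1. rewrite HP' in Hb, Hpb. rewrite <- app_assoc in Hb, Hpb. simpl in Hb, Hpb.
    rewrite (chain_rank d (img g) p q x' l1 a (l2 ++ T') y' Hb Hpb Himg). lia.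
Qed.

(** * Blocks of continuity of the initial map *)

Section LevelZero.

Variables (d : nat) (f : giem) (H : nat -> R -> R).
Hypothesis Hd2 : (2 <= d)%nat.
Hypothesis Hinc : forall a x y, x < y -> H a x < H a y.
Hypothesis Hcont : forall a x, continuity_pt (H a) x.
Hypothesis Hgiem : is_giem d f.
Hypothesis Hmap : forall a x, (a < d)%nat -> inP f a x -> gmap f x = H a x.

Let p a := H a (plo f a).
Let q a := H a (phi f a).

Lemma branch_preimage a t : (a < d)%nat -> p a <= t < q a -> exists x, inP f a x /\ H a x = t.
Proof.
intros Ha Ht. destruct Hgiem as [_ [Hint _]]. destruct (Hint a Ha) as [Hl _].
fold (plo f a) (phi f a) in Hl. unfold p, q in Ht. destruct Ht as [[Ht1|Ht1] Ht2].
- destruct (IVT_incr (H a) _ _ t (Hcont a) Hl (conj Ht1 Ht2)) as [z [Hz1 Hz2]].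
  exists z. split; [|exact Hz2]. unfold inP. fold (plo f a) (phi f a). lra.
- exists (plo f a). split; [|exact Ht1]. unfold inP. fold (plo f a) (phi f a). lra.
Qed.

Lemma branch_image a y : (a < d)%nat -> (img f a y <-> p a <= y < q a).
Proof.
intros Ha. split.
- intros [x [Hx ->]]. rewrite (Hmap a x Ha Hx). destruct Hx as [Hx1 Hx2].
  fold (plo f a) in Hx1. fold (phi f a) in Hx2. unfold p, q. split; [|now apply Hinc].
  destruct Hx1 as [Hx1| ->]; [left; now apply Hinc|lra].
- intros Hy. destruct (branch_preimage a y Ha Hy) as [x [Hx <-]]. exists x.
  split; [exact Hx|]. symmetry. now apply Hmap.
Qed.

Lemma branch_in_range a : (a < d)%nat -> p a < q a /\ glo f <= p a /\ q a <= ghi f.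
Proof.
intros Ha. destruct Hgiem as [_ [Hint [_ [_ [Hin _]]]]]. destruct (Hint a Ha) as [Hl [Hl1 Hl2]].
fold (plo f a) (phi f a) in *.
assert (HI : forall x, inP f a x -> glo f <= H a x < ghi f).
{ intros x Hx. rewrite <- (Hmap a x Ha Hx). apply Hin. unfold inP in Hx. fold (plo f a) (phi f a) in Hx.
  unfold inI. lra. }
assert (Hlo : inP f a (plo f a)) by (unfold inP; fold (plo f a) (phi f a); lra).
split; [now apply Hinc|]. split; [now apply HI|].
apply Rnot_lt_le. intros Hgt.
destruct (branch_preimage a (ghi f) Ha) as [z [Hz1 Hz2]].
{ pose proof (HI _ Hlo). unfold p. lra. }
pose proof (HI z Hz1). lra.
Qed.

Lemma branch_disjoint a b t : (a < d)%nat -> (b < d)%nat -> p a <= t < q a -> p b <= t < q b -> a = b.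
Proof.
intros Ha Hb Hta Htb. destruct (branch_preimage a t Ha Hta) as [x [Hx1 Hx2]].
destruct (branch_preimage b t Hb Htb) as [y [Hy1 Hy2]].
destruct Hgiem as [_ [Hint [Hdis [_ [_ [Hinj _]]]]]].
assert (HI : forall c z, (c < d)%nat -> inP f c z -> inI f z).
{ intros c z Hc Hz. destruct (Hint c Hc) as [_ [L1 L2]]. unfold inP, inI in *. lra. }
assert (x = y).
{ apply Hinj; [now apply (HI a)|now apply (HI b)|].
  rewrite (Hmap a x Ha Hx1), (Hmap b y Hb Hy1). congruence. }
subst y. destruct (Nat.eq_dec a b) as [|Hne]; [auto|]. exfalso. exact (Hdis a b Ha Hb Hne x (conj Hx1 Hy1)).
Qed.

Lemma branch_cover t : glo f <= t < ghi f -> exists a, (a < d)%nat /\ p a <= t < q a.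
Proof.
intros Ht. destruct Hgiem as [_ [_ [_ [Hcov [_ [_ [Hsur _]]]]]]].
destruct (Hsur t Ht) as [x [Hx <-]]. destruct (Hcov x Hx) as [a [Ha HxP]]. exists a. split; [exact Ha|].
apply (branch_image a _ Ha). exists x. auto.
Qed.

Lemma top_chain_exists : exists t, Permutation t (seq 0 d) /\ chain (plo f) (phi f) (glo f) t (ghi f).
Proof.
destruct Hgiem as [Hlh [Hint [Hdis [Hcov _]]]].
apply chain_exists.
- apply seq_NoDup.
- lra.
- intros a Ha. apply in_seq in Ha. destruct (Hint a ltac:(lia)) as [H1 [H2 H3]]. auto.
- intros a b t Ha Hb Hta Htb. apply in_seq in Ha. apply in_seq in Hb.
  destruct (Nat.eq_dec a b) as [|Hne]; [auto|]. exfalso.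
  apply (Hdis a b ltac:(lia) ltac:(lia) Hne t). split; assumption.
- intros t Ht. destruct (Hcov t Ht) as [a [Ha Hat]]. exists a. split; [apply in_seq; lia|exact Hat].
Qed.

(** The limit from the left is [q a] and the value is [p b]; a point of [f] near the break would
    have to be close to both. *)
Lemma break_discont a b : (a < d)%nat -> (b < d)%nat -> phi f a = plo f b -> q a <> p b ->
  discont f (plo f b).
Proof.
intros Ha Hb Hab Hne. pose proof Hgiem as [_ [Hint _]].
destruct (Hint a Ha) as [A1 [A2 A3]]. destruct (Hint b Hb) as [B1 [B2 B3]].
fold (plo f a) (phi f a) in *. fold (plo f b) (phi f b) in *.
split; [unfold inI; lra|]. intros Hc.
assert (He : 0 < Rabs (q a - p b) / 2) by (assert (0 < Rabs (q a - p b)) by (apply Rabs_pos_lt; lra); lra).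
destruct (Hc _ He) as [al [Hal H1]]. destruct (Hcont a (phi f a) _ He) as [be [Hbe H2]].
simpl in H1, H2. unfold Rdist in *.
set (m := Rmin (Rmin al be) (phi f a - plo f a)).
assert (Hm : 0 < m /\ m <= al /\ m <= be /\ m <= phi f a - plo f a).
{ unfold m. pose proof (Rmin_l (Rmin al be) (phi f a - plo f a)).
  pose proof (Rmin_r (Rmin al be) (phi f a - plo f a)).
  pose proof (Rmin_l al be). pose proof (Rmin_r al be).
  split; [|lra]. repeat apply Rmin_pos; lra. }
set (y := phi f a - m / 2).
assert (HyP : inP f a y) by (unfold inP, y; fold (plo f a) (phi f a); lra).
assert (K1 : Rabs (gmap f y - gmap f (plo f b)) < Rabs (q a - p b) / 2).
{ apply H1. split.
  - split; [unfold inI, y; lra|unfold y; lra].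
  - rewrite <- Hab. unfold y. rewrite Rabs_left; lra. }
assert (K2 : Rabs (H a y - H a (phi f a)) < Rabs (q a - p b) / 2).
{ apply H2. split.
  - split; [exact I|unfold y; lra].
  - unfold y. rewrite Rabs_left; lra. }
rewrite (Hmap a y Ha HyP), (Hmap b (plo f b) Hb) in K1 by (unfold inP; fold (plo f b) (phi f b); lra).
fold (q a) in K2. fold (p b) in K1.
assert (Rabs (q a - p b) <= Rabs (H a y - q a) + Rabs (H a y - p b)); [|lra].
replace (q a - p b) with (- (H a y - q a) + (H a y - p b)) by ring.
eapply Rle_trans; [apply Rabs_triang|]. rewrite Rabs_Ropp. lra.
Qed.

(** Each break between maximal blocks is a discontinuity, so genus one leaves at most three blocks
    [X], [Y], [Z]. Irreducibility then restricts the order of their images. *)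
Lemma level_zero_inv : irreducible d f -> genus_one f -> exists A B C, level_inv d f H A B C.
Proof.
intros Hirr Hgen. destruct top_chain_exists as [t [Hp Ht]].
pose proof Hgiem as [Hlh _].
assert (Hlt : forall a, In a t <-> (a < d)%nat).
{ intros a. split; intros Ha.
  - apply (Permutation_in a Hp) in Ha. apply in_seq in Ha. lia.
  - apply (Permutation_in a (Permutation_sym Hp)). apply in_seq. lia. }
assert (Hpq : forall a, In a t -> p a < q a) by (intros a Ha; apply branch_in_range; now apply Hlt).
assert (Hnd : NoDup t) by (eapply Permutation_NoDup; [apply Permutation_sym, Hp|apply seq_NoDup]).
assert (Hlen : length t = d) by (rewrite (Permutation_length Hp); apply length_seq).
assert (Htne : t <> []) by (intros ->; simpl in Hlen; lia).
assert (Hfinish : forall A B C, A ++ B ++ C = t -> chain p q (glo f) (C ++ B ++ A) (ghi f) ->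
   A <> [] -> C <> [] -> level_inv d f H A B C).
{ intros A B C E Hc HA HC. constructor; auto; rewrite E; auto. }
assert (Hbad : forall P T P' T', t = P ++ T -> Permutation P P' -> Permutation t (P' ++ T') ->
   chain p q (glo f) (P' ++ T') (ghi f) -> P <> [] -> T <> [] -> False).
{ intros P T P' T' E HPP HPt Hc HP HT. subst t.
  apply (irreducible_prefix d f p q P T P' T' (glo f) (ghi f) (glo f) (ghi f)); auto.
  - eapply Permutation_trans; [apply Permutation_sym, HPt|exact Hp].
  - intros; now apply branch_image. }
assert (Hblocks : forall blk m,
  (forall i, (i < m)%nat -> blk i <> [] /\
     chain p q (p (hd0 (blk i))) (blk i) (q (last0 (blk i)))) ->
  t = concat (map blk (seq 0 m)) ->
  exists l', Permutation l' (seq 0 m) /\ chain p q (glo f) (concat (map blk l')) (ghi f)).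
{ intros blk m Hblk E. apply (blocks_chain p q (glo f) (ghi f) blk m t); auto; [lra| | |].
  - intros a Ha. apply branch_in_range. now apply Hlt.
  - intros a b s Ha Hb. apply branch_disjoint; now apply Hlt.
  - intros s Hs. destruct (branch_cover s Hs) as [a [Ha Has]]. exists a. split; [now apply Hlt|exact Has]. }
assert (Hbreak : forall X Y, t = X ++ Y -> X <> [] -> Y <> [] ->
  q (last0 X) <> p (hd0 Y) -> discont f (plo f (hd0 Y))).
{ intros X Y E HX HY Hne. apply (break_discont (last0 X)); auto.
  - apply Hlt. rewrite E. apply in_or_app. left. now apply last_in.
  - apply Hlt. rewrite E. apply in_or_app. right. now apply hd_in.
  - rewrite E in Ht. apply chain_app in Ht. destruct Ht as [z [Ht1 Ht2]].
    apply chain_last in Ht1; [|exact HX]. apply chain_last in Ht2; [|exact HY].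
    destruct Ht1 as [-> _], Ht2 as [_ Ht2]. exact Ht2. }
assert (Hplo : forall X Y, t = X ++ Y -> Y <> [] -> forall a, In a X -> plo f a < plo f (hd0 Y)).
{ intros X Y E HY a Ha. destruct Y as [|b Y]; [congruence|]. simpl. rewrite E in Ht.
  pose proof (chain_before _ _ _ _ _ _ _ _ Ht Ha) as Hle.
  assert (plo f a < phi f a); [|lra].
  eapply chain_split; [exact Ht|]. in_app. }
destruct (split_block p q t Htne Hpq) as [X [r1 [E1 [HX [CX BX]]]]].
destruct r1 as [|c1 r1'] eqn:Er1.
(* With one block, domain and image have the same order, and the first letter alone is a forbidden
   initial segment, since [2 <= d]. *)
{ exfalso. rewrite app_nil_r in E1. subst X. destruct t as [|a t']; [congruence|].
  destruct t' as [|b t'']; [simpl in Hlen; lia|].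
  destruct (Hblocks (fun _ => a :: b :: t'') 1%nat) as [l' [Hl' Hc]].
  - intros i Hi. split; [exact Htne|exact CX].
  - simpl. now rewrite app_nil_r.
  - simpl in Hl'. apply Permutation_sym, Permutation_length_1_inv in Hl'. subst l'. 
    cbn [map concat] in Hc. rewrite app_nil_r in Hc.
    apply (Hbad [a] (b :: t'') [a] (b :: t'')); auto; discriminate. }
rewrite <- Er1 in *. assert (Hr1 : r1 <> []) by (rewrite Er1; discriminate). clear c1 r1' Er1.
assert (Hpq1 : forall a, In a r1 -> p a < q a) by (intros; apply Hpq; rewrite E1; in_app).
destruct (split_block p q r1 Hr1 Hpq1) as [Y [r2 [E2 [HY [CY BY]]]]].
assert (D1 : discont f (plo f (hd0 r1))) by (apply (Hbreak X); auto).
destruct r2 as [|c2 r2'] eqn:Er2.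
{ rewrite app_nil_r in E2. subst r1.
  destruct (Hblocks (fun i => match i with O => X | _ => Y end) 2%nat) as [l' [Hl' Hc]].
  - intros [|i] Hi; auto.
  - simpl. now rewrite app_nil_r.
  - simpl in Hl'. apply Permutation_sym, Permutation_length_2_inv in Hl'.
    destruct Hl' as [-> | ->]; cbn [map concat] in Hc; rewrite app_nil_r in Hc.
    + exfalso. apply (Hbad X Y X Y); auto. now rewrite E1.
    + exists X, [], Y. apply Hfinish; auto. }
rewrite <- Er2 in *. assert (Hr2 : r2 <> []) by (rewrite Er2; discriminate). clear c2 r2' Er2.
assert (Hpq2 : forall a, In a r2 -> p a < q a) by (intros; apply Hpq1; rewrite E2; in_app).
destruct (split_block p q r2 Hr2 Hpq2) as [Z [r3 [E3 [HZ [CZ BZ]]]]].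
assert (E12 : t = (X ++ Y) ++ r2) by (rewrite E1, E2, app_assoc; reflexivity).
assert (HlastY : last0 (X ++ Y) = last0 Y).
{ rewrite (app_removelast_last 0%nat HY) at 1. now rewrite app_assoc, last_last. }
assert (HXY : X ++ Y <> []) by (destruct X; [congruence|discriminate]).
assert (D2 : discont f (plo f (hd0 r2))).
{ apply (Hbreak (X ++ Y)); auto. rewrite HlastY. auto. }
destruct r3 as [|c3 r3'] eqn:Er3.
{ rewrite app_nil_r in E3. subst r2 r1.
  destruct (Hblocks (fun i => match i with O => X | S O => Y | _ => Z end) 3%nat) as [l' [Hl' Hc]].
  - intros [|[|i]] Hi; auto.
  - simpl. now rewrite app_nil_r.
  - assert (Hl3 : length l' = 3%nat) by (rewrite (Permutation_length Hl'); reflexivity).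
    assert (Hnd3 : NoDup l') by (eapply Permutation_NoDup; [apply Permutation_sym, Hl'|apply seq_NoDup]).
    assert (Hin3 : forall i, In i l' -> i = 0%nat \/ i = 1%nat \/ i = 2%nat).
    { intros i Hi. apply (Permutation_in i Hl') in Hi. apply in_seq in Hi. lia. }
    destruct l' as [|i [|j [|k [|]]]]; try discriminate.
    pose proof (Hin3 i ltac:(simpl; tauto)) as Hi3. pose proof (Hin3 j ltac:(simpl; tauto)) as Hj3.
    pose proof (Hin3 k ltac:(simpl; tauto)) as Hk3.
    assert (Hij : i <> j /\ i <> k /\ j <> k).
    { inversion Hnd3 as [|? ? N1 N2]; subst. inversion N2 as [|? ? N3 N4]; subst. simpl in *. intuition. }
    clear Hl' Hl3 Hnd3 Hin3.
    (* Image orders [XYZ], [XZY] and [YXZ] have a forbidden initial segment. [YZX] and [ZXY] become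
       exchanges of two blocks with empty middle after two blocks are joined; [ZYX] is the genuine
       three-block case. *)
    destruct Hi3 as [-> | [-> | ->]], Hj3 as [-> | [-> | ->]], Hk3 as [-> | [-> | ->]];
      try (exfalso; lia); clear Hij; cbn [map concat] in Hc; rewrite app_nil_r in Hc.
    + exfalso. apply (Hbad X (Y ++ Z) X (Y ++ Z)); auto. now rewrite E1.
    + exfalso. apply (Hbad X (Y ++ Z) X (Z ++ Y)); auto. rewrite E1. apply Permutation_app_head, Permutation_app_comm.
    + exfalso. apply (Hbad (X ++ Y) Z (Y ++ X) Z); auto.
      * apply Permutation_app_comm.
      * rewrite E12. apply Permutation_app_tail, Permutation_app_comm.
      * now rewrite <- app_assoc.
    + exists X, [], (Y ++ Z). apply Hfinish; auto.
      * simpl. now rewrite <- app_assoc.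
    + exists (X ++ Y), [], Z. apply Hfinish; auto.
    + exists X, Y, Z. apply Hfinish; auto. }
exfalso. rewrite <- Er3 in *. assert (Hr3 : r3 <> []) by (rewrite Er3; discriminate). clear c3 r3' Er3.
assert (E123 : t = (X ++ Y ++ Z) ++ r3) by (rewrite E1, E2, E3, !app_assoc; reflexivity).
assert (HlastZ : last0 (X ++ Y ++ Z) = last0 Z).
{ rewrite (app_removelast_last 0%nat HZ) at 1. now rewrite !app_assoc, last_last. }
assert (D3 : discont f (plo f (hd0 r3))).
{ apply (Hbreak (X ++ Y ++ Z)); auto; [destruct X; [congruence|discriminate]|]. rewrite HlastZ. auto. }
assert (Hh1 : hd0 r1 = hd0 Y) by (rewrite E2; now apply hd_app_nonnil).
assert (Hh2 : hd0 r2 = hd0 Z) by (rewrite E3; now apply hd_app_nonnil).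
assert (L1 : plo f (hd0 r1) < plo f (hd0 r2)).
{ apply (Hplo (X ++ Y)); auto. rewrite Hh1. apply in_or_app; right. now apply hd_in. }
assert (L2 : plo f (hd0 r2) < plo f (hd0 r3)).
{ apply (Hplo (X ++ Y ++ Z)); auto. rewrite Hh2. apply in_or_app; right. apply in_or_app; right. now apply hd_in. }
destruct (Hgen _ _ _ D1 D2 D3) as [E|[E|E]]; lra.
Qed.

End LevelZero.

(** * Towers and the final estimate *)

Lemma exp_decay_vs_sqrt (s : R) (K : nat) : 0 < s < 1 -> (0 < K)%nat ->
  exists C, 0 < C /\ forall n, s ^ (n / K) <= C * Rpower (1 / 2) (sqrt (INR n)).
Proof.
intros Hs HK. set (b := - ln s).
assert (Hb : 0 < b).
{ unfold b. assert (ln s < 0) by (rewrite <- ln_1; apply ln_increasing; lra). lra. }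
assert (HKr : 0 < INR K) by (now apply lt_0_INR).
(* The summand [b] pays for rounding down in [n / K]; the other is the maximum of
   [t * ln 2 - b * t * t / INR K] over [t], found by completing the square. *)
set (c := b + INR K * (ln 2 * ln 2) / (4 * b)).
exists (exp c). split; [apply exp_pos|]. intros n.
rewrite <- (Rpower_pow (n / K) s) by lra. unfold Rpower. rewrite <- exp_plus. apply exp_le.
replace (ln (1 / 2)) with (- ln 2) by (unfold Rdiv; rewrite Rmult_1_l, ln_Rinv; lra).
replace (ln s) with (- b) by (unfold b; ring).
assert (Hn : INR n <= INR K * INR (n / K) + INR K).
{ rewrite <- mult_INR, <- plus_INR. apply le_INR. pose proof (Nat.div_mod_eq n K).
  pose proof (Nat.mod_upper_bound n K ltac:(lia)). lia. }
pose proof (sqrt_pos (INR n)) as Ht. pose proof (sqrt_sqrt (INR n) (pos_INR n)) as Hq.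
set (t := sqrt (INR n)) in *. rewrite <- Hq in Hn.
apply (Rmult_le_reg_l (4 * b * INR K)); [nra|].
replace (4 * b * INR K * (c + t * - ln 2)) with
  (4 * b * b * INR K + INR K * INR K * (ln 2 * ln 2) - 4 * b * INR K * t * ln 2) by (unfold c; field; lra).
pose proof (Rle_0_sqr (2 * b * t - INR K * ln 2)) as Hsq. unfold Rsqr in Hsq.
assert (4 * b * b * (t * t) <= 4 * b * b * (INR K * INR (n / K) + INR K)).
{ apply Rmult_le_compat_l; [nra|exact Hn]. }
nra.
Qed.

Lemma sumR_add m n F : sumR (m + n) F = sumR m F + sumR n (fun i => F (m + i)%nat).
Proof.
induction n as [|n IH]; [rewrite Nat.add_0_r; simpl; lra|].
rewrite Nat.add_succ_r. simpl. rewrite IH. lra.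
Qed.

Lemma sumR_shift q (F : nat -> R) : sumR q (fun i => F (S i)) = sumR q F + F q - F 0%nat.
Proof. induction q as [|q IH]; simpl; [lra|rewrite IH; lra]. Qed.

Lemma iterf_add F m n x : iterf F (m + n) x = iterf F n (iterf F m x).
Proof. unfold iterf. rewrite Nat.add_comm. apply Nat.iter_add. Qed.

Section Assembly.

Variables (d k : nat) (f : giem) (fs : nat -> giem) (nu G : R).
Variables (H0 U0 u0 : nat -> R -> R) (A0 B0 C0 : list nat).
Hypothesis Hd : (2 <= d)%nat.
Hypothesis Hnu : 0 < nu <= 1.
Hypothesis Hglo : glo f = 0.
Hypothesis Hghi : ghi f = 1.
Hypothesis Hfs0 : fs O = f.
Hypothesis Hrv : forall n, RV_step d (fs n) (fs (S n)).
Hypothesis Hkb : k_bounded d k fs.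
Hypothesis HH0 : forall a x, derivable_pt_lim (H0 a) x (exp (U0 a x)).
Hypothesis HU0 : forall a x, derivable_pt_lim (U0 a) x (u0 a x).
Hypothesis Hu0c : forall a x, continuous (u0 a) x.
Hypothesis HG : 0 <= G.
Hypothesis Hu0 : forall a x, Rabs (u0 a x) <= G.
Hypothesis Hu0h : forall a x y, u0 a x - u0 a y <= G * om nu (Rabs (x - y)).
Hypothesis Hinv0 : level_inv d f H0 A0 B0 C0.

Let ep n := rv_type d (fs n).

Fixpoint lsts (n : nat) : list nat * list nat * list nat :=
  match n with O => (A0, B0, C0) | S m => next_lists (ep m) (lsts m) end.

Let As n := fst (fst (lsts n)).
Let Bs n := snd (fst (lsts n)).
Let Cs n := snd (lsts n).
Let a0 n := last0 (Cs n).
Let a1 n := last0 (As n).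
Let Hb n a := brH a0 a1 ep H0 n a.
Let Ub n a := brU a0 a1 ep H0 U0 n a.
Let Eb n a := brE a0 a1 ep H0 n a.
Let lo n a := plo (fs n) a.
Let hi n a := phi (fs n) a.

Lemma Hb_incr n a x y : x < y -> Hb n a x < Hb n a y.
Proof. apply (brH_incr a0 a1 ep H0 U0 HH0). Qed.

Lemma Hb_cont n a x : continuity_pt (Hb n a) x.
Proof. apply (brH_cont a0 a1 ep H0 U0 HH0). Qed.

Lemma lsts_split n : lsts n = (As n, Bs n, Cs n).
Proof. unfold As, Bs, Cs. now destruct (lsts n) as [[A B] C]. Qed.

Lemma level_inv_all n : level_inv d (fs n) (Hb n) (As n) (Bs n) (Cs n).
Proof.
induction n as [|n IH]; [rewrite Hfs0; exact Hinv0|].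
assert (Hnx : next_lists (rv_type d (fs n)) (As n, Bs n, Cs n) = (As (S n), Bs (S n), Cs (S n))).
{ rewrite <- lsts_split, <- lsts_split. reflexivity. }
destruct (rv_step_inv d (fs n) (Hb n) _ _ _ (Hb_incr n) (Hb_cont n) IH (fs (S n)) _ _ _ (Hrv n) Hnx)
  as [_ [R _]]. exact R.
Qed.

Lemma step_facts n :
  explicit_step d (ep n) (a0 n) (a1 n) (Hb n (a1 n)) (lo n) (hi n) (lo (S n)) (hi (S n)) /\
  return_facts d (fs n) (Hb n) (As n) (Cs n) (ep n) (fs (S n)) /\
  RV_data d (fs n) (ep n) (a0 n) (a1 n).
Proof.
assert (Hnx : next_lists (rv_type d (fs n)) (As n, Bs n, Cs n) = (As (S n), Bs (S n), Cs (S n))).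
{ rewrite <- lsts_split, <- lsts_split. reflexivity. }
destruct (rv_step_inv d (fs n) (Hb n) _ _ _ (Hb_incr n) (Hb_cont n) (level_inv_all n) (fs (S n)) _ _ _
  (Hrv n) Hnx) as [R1 [_ [R2 R3]]]. auto.
Qed.

Lemma win_at_winr n b : win_at d (fs n) b <-> winr a0 a1 ep n = b.
Proof.
split.
- intros [e [c0 [c1 [HR Hw]]]].
  destruct (rv_data_type d (fs n) (Hb n) _ _ _ (Hb_incr n) (Hb_cont n) (level_inv_all n) e c0 c1 HR)
    as [-> [-> ->]]. exact Hw.
- intros Hw. exists (ep n), (a0 n), (a1 n). split; [apply step_facts|exact Hw].
Qed.

Lemma los_at_losr n b : los_at d (fs n) b <-> losr a0 a1 ep n = b.
Proof.
split.
- intros [e [c0 [c1 [HR Hw]]]].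
  destruct (rv_data_type d (fs n) (Hb n) _ _ _ (Hb_incr n) (Hb_cont n) (level_inv_all n) e c0 c1 HR)
    as [-> [-> ->]]. exact Hw.
- intros Hw. exists (ep n), (a0 n), (a1 n). split; [apply step_facts|exact Hw].
Qed.

(** The window in [k_bounded] is centred. Applied at [n + k], it becomes a one-sided window of
    length [2 * k] starting at [n]. *)
Lemma paths n b c : (b < d)%nat -> (c < d)%nat ->
  exists n1 p, (n <= n1)%nat /\ (n1 + p < n + 2 * k)%nat /\ winr a0 a1 ep n1 = b /\
    losr a0 a1 ep (n1 + p) = c /\
    forall i, (i < p)%nat -> losr a0 a1 ep (n1 + i) = winr a0 a1 ep (n1 + i + 1).
Proof.
intros Hbd Hcd. destruct (Hkb (n + k)%nat b c Hbd Hcd) as [n1 [p [K1 [K2 [K3 [K4 [Kw [Kl Kc]]]]]]]].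
exists n1, p. split; [lia|]. split; [lia|]. split; [now apply win_at_winr|]. split; [now apply los_at_losr|].
intros i Hi. symmetry. apply win_at_winr. apply (Kc i Hi). now apply los_at_losr.
Qed.

Lemma a0_lt n : (a0 n < d)%nat.
Proof. apply (li_b0_lt d (fs n) (Hb n) _ _ _ (level_inv_all n)). Qed.
Lemma a1_lt n : (a1 n < d)%nat.
Proof. apply (li_b1_lt d (fs n) (Hb n) _ _ _ (level_inv_all n)). Qed.
Lemma a01_ne n : a0 n <> a1 n.
Proof. apply (li_b01 d (fs n) (Hb n) _ _ _ (level_inv_all n)). Qed.
Lemma lo_hi n a : (a < d)%nat -> lo n a < hi n a.
Proof. apply (li_lohi d (fs n) (Hb n) _ _ _ (level_inv_all n)). Qed.

Lemma chain_sum p q l x y : chain p q x l y ->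
  fold_right Rplus 0 (map (fun a => q a - p a) l) = y - x.
Proof.
revert x. induction l as [|a l IH]; intros x; simpl; [lra|].
intros [H1 [H2 H3]]. rewrite (IH _ H3). lra.
Qed.

Lemma sumR_perm F l m : Permutation l (seq 0 m) -> fold_right Rplus 0 (map F l) = sumR m F.
Proof.
intros Hp. transitivity (fold_right Rplus 0 (map F (seq 0 m))).
- clear - Hp. induction Hp; simpl; lra.
- clear. induction m as [|m IH]; [reflexivity|]. rewrite seq_S, map_app, fold_right_app. simpl.
  rewrite <- IH. rewrite Rplus_0_r. clear. generalize (F m). induction (map F (seq 0 m)); simpl; intros; [lra|].
  rewrite IHl. lra.
Qed.

Lemma total_length : sumR d (fun a => hi 0 a - lo 0 a) = 1.
Proof.
pose proof (level_inv_all 0) as I. pose proof (chain_sum _ _ _ _ _ (li_top I)) as Hs.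
rewrite (sumR_perm _ _ d (li_perm I)) in Hs. rewrite Hfs0, Hglo, Hghi in Hs.
unfold hi, lo. rewrite Hfs0. lra.
Qed.

Lemma total_image : sumR d (incrm lo hi (brH a0 a1 ep H0) 0) = sumR d (fun a => hi 0 a - lo 0 a).
Proof.
rewrite total_length.
pose proof (level_inv_all 0) as I. pose proof (chain_sum _ _ _ _ _ (li_bot I)) as Hs.
rewrite (sumR_perm _ _ d (li_bot_perm _ _ _ _ _ _ I)) in Hs. rewrite Hfs0, Hglo, Hghi in Hs.
unfold incrm, hi, lo. rewrite Hfs0. unfold Hb in Hs. lra.
Qed.

(** [J i] extends the [i]-th iterate of [f] on the interval to an increasing continuous function on
    [R]. The tower of the loser is the tower over [a1 n] topped by the one over [a0 n], so its
    height is [q1 + q0], and [J] switches from one to the other at [q1]. *)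
Lemma iterates n a : (a < d)%nat -> exists q J,
  return_time (gmap f) (fs n) a q /\
  (forall i x y, x < y -> J i x < J i y) /\ (forall i x, continuity_pt (J i) x) /\
  (forall x, J 0%nat x = x) /\ (forall x, J q x = Hb n a x) /\
  (forall i x, (i <= q)%nat -> inP (fs n) a x -> iterf (gmap f) i x = J i x) /\
  (forall x, Eb n a x = sumR q (fun i => J i x)).
Proof.
revert a. induction n as [|n IH]; intros a Ha.
- exists 1%nat, (fun i x => match i with O => x | _ => H0 a x end).
  pose proof (level_inv_all 0) as I.
  assert (Hm : forall x, inP (fs 0) a x -> gmap f x = H0 a x).
  { intros x Hx. rewrite <- Hfs0. now apply (li_map I a x Ha). }
  split.
  { split; [lia|]. intros x Hx. split; [|intros; lia]. unfold iterf; simpl. rewrite (Hm x Hx).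
    pose proof (proj2 (li_lt_bot _ _ _ _ _ _ I a) Ha) as Hin.
    destruct (chain_split _ _ _ _ _ _ (li_bot I) Hin) as [C1 [C2 C3]]. cbv beta in C1, C3.
    destruct Hx as [Hx1 Hx2]. apply (Hb_incr 0 a) in Hx2.
    assert (Hb 0 a (plo (fs 0) a) <= Hb 0 a x).
    { destruct Hx1 as [Hx1|Hx1]; [left; now apply Hb_incr|unfold plo; rewrite Hx1; lra]. }
    unfold inI. change (H0 a x) with (Hb 0 a x). unfold phi in *. lra. }
  repeat split.
  + intros [|i] x y Hxy; [exact Hxy|now apply (Hb_incr 0 a)].
  + intros [|i] x; [apply continuity_pt_id|apply (Hb_cont 0 a)].
  + intros i x Hi Hx. destruct i as [|[|i]]; [reflexivity| |lia]. unfold iterf; simpl. now apply Hm.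
  + intros x. unfold Eb, brE. simpl. lra.
- destruct (step_facts n) as [_ [[RI [RN RL0]] _]].
  assert (RL : forall x, inP (fs (S n)) (losr a0 a1 ep n) x ->
    inP (fs n) (a1 n) x /\ inP (fs n) (a0 n) (Hb n (a1 n) x) /\
    ~ inI (fs (S n)) (Hb n (a1 n) x) /\ inI (fs (S n)) (Hb n (a0 n) (Hb n (a1 n) x))) by exact RL0.
  clear RL0.
  destruct (Nat.eq_dec a (losr a0 a1 ep n)) as [->|Hne].
  + destruct (IH (a1 n) (a1_lt n)) as [q1 [J1 [[T1 T1'] [I1 [K1 [Z1 [F1 [M1 S1]]]]]]]].
    destruct (IH (a0 n) (a0_lt n)) as [q0 [J0 [[T0 T0'] [I0 [K0 [Z0 [F0 [M0 S0]]]]]]]].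
    exists (q1 + q0)%nat, (fun i => if Nat.ltb i q1 then J1 i else (fun x => J0 (i - q1)%nat (Hb n (a1 n) x))).
    assert (Hit : forall i x, (i <= q0)%nat -> inP (fs (S n)) (losr a0 a1 ep n) x ->
      iterf (gmap f) (q1 + i) x = iterf (gmap f) i (Hb n (a1 n) x)).
    { intros i x Hi Hx. rewrite iterf_add. destruct (RL x Hx) as [P1 _].
      rewrite (M1 q1 x (Nat.le_refl q1) P1), F1. reflexivity. }
    split; [|split; [|split; [|split; [|split; [|split]]]]].
    * split; [lia|]. intros x Hx. destruct (RL x Hx) as [P1 [P0 [P2 P3]]]. split.
      -- rewrite Hit by (auto; lia). rewrite (M0 q0 _ (Nat.le_refl q0) P0), F0. exact P3.
      -- intros m Hm1 Hm2 HI. destruct (Nat.lt_trichotomy m q1) as [Hlt|[->|Hgt]].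
         ++ apply (proj2 (T1' x P1) m Hm1 Hlt). now apply RI.
         ++ apply P2. rewrite (M1 q1 x (Nat.le_refl q1) P1), F1 in HI. exact HI.
         ++ apply (proj2 (T0' _ P0) (m - q1)%nat); [lia|lia|]. apply RI.
            rewrite <- Hit by (auto; lia). replace (q1 + (m - q1))%nat with m by lia. exact HI.
    * intros i x y Hxy. destruct (Nat.ltb i q1); [now apply I1|]. apply I0. now apply Hb_incr.
    * intros i x. destruct (Nat.ltb i q1); [apply K1|].
      apply (continuity_pt_comp (Hb n (a1 n)) (J0 (i - q1)%nat)); [apply Hb_cont|apply K0].
    * intros x. assert (Hlt : Nat.ltb 0 q1 = true) by (apply Nat.ltb_lt; lia). rewrite Hlt. apply Z1.
    * intros x. assert (Hlt : Nat.ltb (q1 + q0) q1 = false) by (apply Nat.ltb_ge; lia). rewrite Hlt.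
      replace (q1 + q0 - q1)%nat with q0 by lia. rewrite F0. unfold Hb. cbn [brH].
      destruct (Nat.eq_dec (losr a0 a1 ep n) (losr a0 a1 ep n)); congruence.
    * intros i x Hi Hx. destruct (RL x Hx) as [P1 [P0 _]].
      destruct (Nat.ltb i q1) eqn:El.
      -- apply Nat.ltb_lt in El. apply M1; [lia|exact P1].
      -- apply Nat.ltb_ge in El. replace i with (q1 + (i - q1))%nat at 1 by lia.
         rewrite Hit by (auto; lia). apply M0; [lia|exact P0].
    * intros x. rewrite sumR_add.
      rewrite (sumR_ext q1 _ (fun i => J1 i x)).
      2:{ intros i Hi. assert (Hlt : Nat.ltb i q1 = true) by (apply Nat.ltb_lt; lia). now rewrite Hlt. }
      rewrite (sumR_ext q0 _ (fun i => J0 i (Hb n (a1 n) x))).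
      2:{ intros i Hi. assert (Hlt : Nat.ltb (q1 + i) q1 = false) by (apply Nat.ltb_ge; lia). rewrite Hlt.
          now replace (q1 + i - q1)%nat with i by lia. }
      rewrite <- S1, <- S0. unfold Eb, brE. cbn [coc].
      destruct (Nat.eq_dec (losr a0 a1 ep n) (losr a0 a1 ep n)); [reflexivity|congruence].
  + destruct (IH a Ha) as [q [J [[T T'] [I [K [Z [F [M S]]]]]]]].
    exists q, J. split; [|split; [exact I|split; [exact K|split; [exact Z|split; [|split]]]]].
    * split; [exact T|]. intros x Hx. destruct (RN a x Ha Hne Hx) as [P1 P2]. split.
      -- rewrite (M q x (Nat.le_refl q) P1), F. exact P2.
      -- intros m Hm1 Hm2 HI. apply (proj2 (T' x P1) m Hm1 Hm2). now apply RI.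
    * intros x. rewrite F. unfold Hb. cbn [brH]. destruct (Nat.eq_dec a (losr a0 a1 ep n)); congruence.
    * intros i x Hi Hx. apply M; [exact Hi|]. apply (RN a x Ha Hne Hx).
    * intros x. rewrite <- S. unfold Eb, brE. cbn [coc]. destruct (Nat.eq_dec a (losr a0 a1 ep n)); congruence.
Qed.

Lemma every_letter_loses_fs n c : (c < d)%nat ->
  exists j, (n <= j < n + 2 * k)%nat /\ losr a0 a1 ep j = c.
Proof.
intros Hc. destruct (paths n c c Hc Hc) as [n1 [p [P1 [P2 [_ [P4 _]]]]]].
exists (n1 + p)%nat. split; [lia|exact P4].
Qed.

Lemma slope_bound : exists Sl, forall n a x, (a < d)%nat -> lo n a <= x <= hi n a -> Rabs (Ub n a x) <= Sl.
Proof.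
apply (slopes_bounded d a0 a1 ep H0 U0 u0 HH0 HU0 G HG Hu0 lo hi a0_lt a1_lt a01_ne lo_hi
  (fun n => proj1 (step_facts n)) total_length As Bs Cs (2 * k)).
- intros n. rewrite <- !lsts_split. cbn [lsts]. rewrite lsts_split. apply next_lists_step.
  + apply (li_A (level_inv_all n)).
  + apply (li_C (level_inv_all n)).
- intros n. apply (li_perm (level_inv_all n)).
- intros n. apply (li_A (level_inv_all n)).
- intros n. apply (li_C (level_inv_all n)).
- reflexivity.
- reflexivity.
- apply every_letter_loses_fs.
- apply total_image.
- lia.
Qed.

Lemma nonlinearity_estimate : exists C, 0 < C /\ forall n a, (a < d)%nat ->
  let T := sumR d (incrm lo hi Ub 0) in
  Rabs (incrm lo hi Ub n a - incrm lo hi Eb n a * T) <= C * Rpower (1 / 2) (sqrt (INR n)) /\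
  hi n a - lo n a <= C * Rpower (1 / 2) (sqrt (INR n)) /\
  incrm lo hi Hb n a <= C * Rpower (1 / 2) (sqrt (INR n)).
Proof.
destruct slope_bound as [Sl HSl].
assert (Hk : (0 < 2 * k)%nat) by (destruct (every_letter_loses_fs 0 0 ltac:(lia)) as [j [Hj _]]; lia).
destruct (nonlinearity_equidistributed d a0 a1 ep H0 U0 u0 HH0 HU0 G HG Hu0 lo hi a0_lt a1_lt a01_ne lo_hi
  (fun n => proj1 (step_facts n)) total_length Sl (2 * k) ltac:(lia) HSl paths nu Hnu
  (ex_intro _ G (conj HG Hu0h))) as [sg [M [Hsg [HM Heq]]]].
destruct (interval_length_decay d a0 a1 ep H0 U0 u0 HH0 HU0 G HG Hu0 lo hi a0_lt a1_lt a01_ne lo_hi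
  (fun n => proj1 (step_facts n)) total_length Sl (2 * k) ltac:(lia) HSl paths) as [g [Hg Hlen]].
destruct (exp_decay_vs_sqrt sg (2 * k) Hsg Hk) as [C1 [HC1 Hd1]].
assert (Hg1 : 0 < / g < 1).
{ split; [apply Rinv_0_lt_compat; lra|]. rewrite <- Rinv_1. apply Rinv_lt_contravar; lra. }
destruct (exp_decay_vs_sqrt (/ g) (2 * k) Hg1 Hk) as [C2 [HC2 Hd2]].
pose proof (exp_pos Sl) as HeS.
(* One summand for each estimate: the nonlinearity, the length of the base, and the length of its
   image, which is at most [exp Sl] times that of the base. *)
exists (2 * M * C1 + C2 + exp Sl * C2). split; [nra|]. intros n a Ha T.
pose proof (exp_pos (sqrt (INR n) * ln (1 / 2))) as Hrp. fold (Rpower (1 / 2) (sqrt (INR n))) in Hrp.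
set (rp := Rpower (1 / 2) (sqrt (INR n))) in *.
specialize (Hd1 n). specialize (Hd2 n). fold rp in Hd1, Hd2.
pose proof (lo_hi n a Ha) as Hl.
assert (Hlen' : hi n a - lo n a <= C2 * rp).
{ eapply Rle_trans; [now apply Hlen|]. rewrite <- pow_inv. exact Hd2. }
assert (HMrp : 0 <= 2 * M * C1 * rp).
{ repeat apply Rmult_le_pos; lra. }
assert (HC2rp : 0 <= C2 * rp) by nra.
split; [|split].
- destruct (Heq n) as [kap Hkap].
  set (eta := M * sg ^ (n / (2 * k))) in *.
  assert (Heta : eta <= M * C1 * rp) by (unfold eta; nra).
  assert (Heta0 : 0 <= eta) by (unfold eta; apply Rmult_le_pos; [lra|apply pow_le; lra]).
  assert (Hinc : forall b, (b < d)%nat ->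
    - eta * incrm lo hi Eb n b <= incrm lo hi Ub n b - kap * incrm lo hi Eb n b <= eta * incrm lo hi Eb n b).
  { intros b Hbd. pose proof (lo_hi n b Hbd) as Hlb. unfold incrm.
    rewrite Ropp_mult_distr_l_reverse. apply Rabs_le_between.
    apply (deriv_abs_le _ (bru a0 a1 ep H0 U0 u0 n b) _ (brL a0 a1 ep H0 U0 n b)); [lra| | |].
    - intros z _. apply (brU_deriv a0 a1 ep H0 U0 u0 HH0 HU0).
    - intros z _. apply (brE_deriv a0 a1 ep H0 U0 HH0).
    - intros z Hz. exact (Hkap b z Hbd Hz). }
  assert (HE1 : sumR d (incrm lo hi Eb n) = 1).
  { apply (brE_total d a0 a1 ep H0 lo hi a0_lt a1_lt a01_ne (fun n => proj1 (step_facts n)) total_length). }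
  assert (HT : sumR d (incrm lo hi Ub n) = T).
  { apply (coc_total d a0 a1 ep H0 lo hi a0_lt a1_lt a01_ne (fun n => proj1 (step_facts n)) U0). }
  (* Summed over the alphabet, the increments of [Eb] give 1 and those of [Ub] give [T], so [kap]
     equals [T] up to [eta]. Replacing it by [T] doubles the error. *)
  assert (HTk : - eta <= T - kap <= eta).
  { assert (Y1 : sumR d (incrm lo hi Ub n) <= sumR d (fun b => (kap + eta) * incrm lo hi Eb n b)).
    { apply sumR_le. intros b Hbd. specialize (Hinc b Hbd). lra. }
    assert (Y2 : sumR d (fun b => (kap - eta) * incrm lo hi Eb n b) <= sumR d (incrm lo hi Ub n)).
    { apply sumR_le. intros b Hbd. specialize (Hinc b Hbd). lra. }
    rewrite sumR_scal, HE1, HT in *. lra. }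
  assert (HEa : 0 < incrm lo hi Eb n a <= 1).
  { split.
    - apply (incrm_brE_pos d a0 a1 ep H0 U0 HH0 lo hi lo_hi n a Ha).
    - apply (incrm_brE_le1 d a0 a1 ep H0 U0 HH0 lo hi a0_lt a1_lt a01_ne lo_hi
        (fun n => proj1 (step_facts n)) total_length n a Ha). }
  specialize (Hinc a Ha). set (e := incrm lo hi Eb n a) in *.
  assert (0 <= exp Sl * (C2 * rp)) by nra.
  assert (Rabs (incrm lo hi Ub n a - e * T) <= 2 * eta); [|nra].
  apply Rabs_le. nra.
- nra.
- assert (Hh : incrm lo hi Hb n a <= exp Sl * (hi n a - lo n a)).
  { unfold incrm. apply (deriv_incr_le _ (fun z => exp (Ub n a z)) id (fun _ => 1)); [lra| | |].
    - intros z _. apply (brH_deriv a0 a1 ep H0 U0 HH0).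
    - intros z _. apply derivable_pt_lim_id.
    - intros z Hz. rewrite Rmult_1_r. apply exp_le. pose proof (HSl n a z Ha Hz) as Hs.
      apply Rabs_le_between in Hs. lra. }
  assert (exp Sl * (hi n a - lo n a) <= exp Sl * (C2 * rp)) by (apply Rmult_le_compat_l; lra).
  nra.
Qed.

Lemma conclusion : exists C : R, 0 < C /\
    exists T : R, total_D2D d f T /\
    forall (n a : nat), (a < d)%nat ->
      exists (N : R) (q : nat) (Ssum : R),
        IntD2D (gmap (fs n)) (fst (gpart (fs n) a)) (snd (gpart (fs n) a)) N /\
        return_time (gmap f) (fs n) a q /\
        sum_tower_len (gmap f) (fs n) a q Ssum /\
        Rabs (N - Ssum / (ghi f - glo f) * T) <= C * Rpower (1 / 2) (sqrt (INR n)) /\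
        (T = 0 -> Rabs N <= C * Rpower (1 / 2) (sqrt (INR n))).
Proof.
destruct nonlinearity_estimate as [C [HC Hest]].
set (T := sumR d (incrm lo hi Ub 0)) in *.
assert (HN : forall n a, (a < d)%nat ->
  IntD2D (gmap (fs n)) (fst (gpart (fs n) a)) (snd (gpart (fs n) a)) (incrm lo hi Ub n a)).
{ intros n a Ha. apply (IntD2D_branch _ (Hb n a) (Ub n a) (bru a0 a1 ep H0 U0 u0 n a)).
  - now apply lo_hi.
  - intros x. apply (brH_deriv a0 a1 ep H0 U0 HH0).
  - intros x. apply (brU_deriv a0 a1 ep H0 U0 u0 HH0 HU0).
  - intros x. apply (bru_continuous a0 a1 ep H0 U0 u0 HH0 HU0 Hu0c).
  - intros x Hx. now apply (li_map (level_inv_all n)). }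
exists (C * (1 + 2 * Rabs T)). pose proof (Rabs_pos T) as HT0. split; [nra|].
exists T. split.
{ exists (incrm lo hi Ub 0). split; [|reflexivity]. intros a Ha. rewrite <- Hfs0. now apply HN. }
intros n a Ha.
destruct (iterates n a Ha) as [q [J [Hret [Jinc [Jcont [J0 [Jq [Jit JE]]]]]]]].
(* The increment of [Eb] counts the levels 0 to [q - 1] of the tower, the statement the levels 1 to
   [q]: add the length of the image under the return map and remove that of the base. *)
exists (incrm lo hi Ub n a), q, (incrm lo hi Eb n a + incrm lo hi Hb n a - (hi n a - lo n a)).
pose proof (lo_hi n a Ha) as Hl.
destruct (Hest n a Ha) as [E1 [E2 E3]].
pose proof (exp_pos (sqrt (INR n) * ln (1 / 2))) as Hrp. fold (Rpower (1 / 2) (sqrt (INR n))) in Hrp.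
set (rp := Rpower (1 / 2) (sqrt (INR n))) in *.
assert (HHb : 0 <= incrm lo hi Hb n a) by (unfold incrm; pose proof (Hb_incr n a _ _ Hl); lra).
assert (Hmain : Rabs (incrm lo hi Ub n a -
  (incrm lo hi Eb n a + incrm lo hi Hb n a - (hi n a - lo n a)) / (ghi f - glo f) * T) <=
  C * (1 + 2 * Rabs T) * rp).
{ rewrite Hghi, Hglo.
  replace (incrm lo hi Ub n a - (incrm lo hi Eb n a + incrm lo hi Hb n a - (hi n a - lo n a)) / (1 - 0) * T)
    with ((incrm lo hi Ub n a - incrm lo hi Eb n a * T) + - ((incrm lo hi Hb n a - (hi n a - lo n a)) * T))
    by field.
  eapply Rle_trans; [apply Rabs_triang|]. rewrite Rabs_Ropp, Rabs_mult.
  assert (Hd' : Rabs (incrm lo hi Hb n a - (hi n a - lo n a)) <= C * rp) by (apply Rabs_le; lra).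
  pose proof (Rmult_le_compat_r (Rabs T) _ _ HT0 Hd').
  assert (0 <= C * rp * Rabs T) by (apply Rmult_le_pos; nra). lra. }
split; [now apply HN|]. split; [exact Hret|]. split; [|split].
- exists (fun i => J i (hi n a) - J i (lo n a)). split.
  + intros i Hi. apply Ilen_incr_image; [exact Hl|apply Jinc|apply Jcont|].
    intros y. split; intros [x [Hx ->]]; exists x; (split; [exact Hx|]).
    * apply Jit; [lia|exact Hx].
    * symmetry. apply Jit; [lia|exact Hx].
  + assert (Hsum : forall x, sumR q (fun i => J (S i) x) = Eb n a x + Hb n a x - x).
    { intros x. rewrite (sumR_shift q (fun i => J i x)), <- JE, Jq, J0. reflexivity. }
    rewrite (sumR_ext q _ (fun i => J (S i) (hi n a) + -1 * J (S i) (lo n a))) by (intros; ring).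
    rewrite sumR_plus, sumR_scal, !Hsum. unfold incrm. ring.
- exact Hmain.
- intros HT. rewrite HT in Hmain at 1. rewrite Rmult_0_r, Rminus_0_r in Hmain. exact Hmain.
Qed.

End Assembly.

Theorem theorem2 :
  forall (d k : nat), (2 <= d)%nat ->
  exists lam : R, 0 < lam < 1 /\
  forall (nu : R) (f : giem) (fs : nat -> giem),
    0 < nu ->
    glo f = 0 -> ghi f = 1 ->
    is_giem d f -> irreducible d f ->
    (* f_n = R^n(f) for all n: f is infinitely renormalizable *)
    fs O = f -> (forall n, RV_step d (fs n) (fs (S n))) ->
    C2nu_branches d nu f ->
    k_bounded d k fs ->
    genus_one f -> no_connection d f ->
    exists C : R, 0 < C /\
    exists T : R, total_D2D d f T /\
    forall (n a : nat), (a < d)%nat ->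
      exists (N : R) (q : nat) (Ssum : R),
        IntD2D (gmap (fs n)) (fst (gpart (fs n) a)) (snd (gpart (fs n) a)) N /\
        return_time (gmap f) (fs n) a q /\
        sum_tower_len (gmap f) (fs n) a q Ssum /\
        Rabs (N - Ssum / (ghi f - glo f) * T) <= C * Rpower lam (sqrt (INR n)) /\
        (T = 0 -> Rabs N <= C * Rpower lam (sqrt (INR n))).
Proof.
intros d k Hd. exists (1 / 2). split; [lra|].
intros nu f fs Hnu Hglo Hghi Hgiem Hirr Hfs0 Hrv HC2 Hkb Hgen _.
set (nu' := Rmin nu 1).
assert (Hnu' : 0 < nu' <= 1) by (split; [apply Rmin_pos; lra|apply Rmin_r]).
assert (Hex : forall a, exists t : (R -> R) * (R -> R) * (R -> R),
  is_branch nu' (fst (fst t)) (snd (fst t)) (snd t) /\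
  ((a < d)%nat -> forall x, inP f a x -> gmap f x = fst (fst t) x) /\
  ((d <= a)%nat -> forall x, snd t x = 0)).
{ intros a. destruct (Nat.lt_ge_cases a d) as [Ha|Ha].
  - destruct (HC2 a Ha) as [h [h1 [h2 [Hh [Hder [K HK]]]]]].
    fold (plo f a) (phi f a) nu' in Hh, Hder, HK.
    destruct Hgiem as [_ [Hint _]]. destruct (Hint a Ha) as [L1 [L2 L3]].
    fold (plo f a) (phi f a) in L1, L2, L3.
    destruct (branch_extension nu' (plo f a) (phi f a) h h1 h2 K) as [H [U [u [Hbr HHh]]]]; auto; [lra|].
    exists (H, U, u). split; [exact Hbr|]. split; [|lia].
    intros _ x Hx. simpl. unfold inP in Hx. fold (plo f a) (phi f a) in Hx.
    rewrite HHh by lra. symmetry. now apply Hh.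
  (* Numbers that are not letters get the identity as branch, so that the analytic hypotheses hold
     for every natural number. *)
  - exists (fun x => x, fun _ => 0, fun _ => 0). split; [|split; [lia|reflexivity]]. simpl.
    split; [|split; [|split]].
    + intros x. rewrite exp_0. apply derivable_pt_lim_id.
    + intros x. apply derivable_pt_lim_const.
    + intros x. apply continuous_const.
    + exists 0. split; [lra|]. split; intros; [rewrite Rabs_R0; lra|lra]. }
pose (tr := fun a => proj1_sig (constructive_indefinite_description _ (Hex a))).
assert (Htr : forall a, is_branch nu' (fst (fst (tr a))) (snd (fst (tr a))) (snd (tr a)) /\
  ((a < d)%nat -> forall x, inP f a x -> gmap f x = fst (fst (tr a)) x) /\
  ((d <= a)%nat -> forall x, snd (tr a) x = 0)).
{ intros a. unfold tr. exact (proj2_sig (constructive_indefinite_description _ (Hex a))). }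
clearbody tr. clear Hex.
assert (HexK : forall a, exists K, 0 <= K /\ (forall x, Rabs (snd (tr a) x) <= K) /\
    forall x y, snd (tr a) x - snd (tr a) y <= K * om nu' (Rabs (x - y))).
{ intros a. destruct (Htr a) as [[_ [_ [_ HK]]] _]. exact HK. }
pose (kf := fun a => proj1_sig (constructive_indefinite_description _ (HexK a))).
assert (Hkf : forall a, 0 <= kf a /\ (forall x, Rabs (snd (tr a) x) <= kf a) /\
    forall x y, snd (tr a) x - snd (tr a) y <= kf a * om nu' (Rabs (x - y))).
{ intros a. unfold kf. exact (proj2_sig (constructive_indefinite_description _ (HexK a))). }
clearbody kf. clear HexK.
destruct (finite_upper_bound kf d) as [M HM].
assert (HM0 : 0 <= M).
{ apply Rle_trans with (kf 0%nat); [apply Hkf|apply HM; lia]. }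
set (H0 := fun a => fst (fst (tr a))). set (U0 := fun a => snd (fst (tr a))). set (u0 := fun a => snd (tr a)).
assert (HH0 : forall a x, derivable_pt_lim (H0 a) x (exp (U0 a x))) by (intros a; apply (Htr a)).
assert (Hinc : forall a x y, x < y -> H0 a x < H0 a y).
{ intros a x y Hxy. apply (deriv_incr _ (fun z => exp (U0 a z))); auto. intros; apply exp_pos. }
assert (Hcont : forall a x, continuity_pt (H0 a) x).
{ intros a x. apply derivable_continuous_pt. eexists. apply HH0. }
assert (Hmap : forall a x, (a < d)%nat -> inP f a x -> gmap f x = H0 a x).
{ intros a x Ha. now apply (Htr a). }
destruct (level_zero_inv d f H0 Hd Hinc Hcont Hgiem Hmap Hirr Hgen) as [A [B [C Hinv]]].
apply (conclusion d k f fs nu' M H0 U0 u0 A B C); auto.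
- intros a. apply (Htr a).
- intros a. apply (Htr a).
- intros a x. destruct (Nat.lt_ge_cases a d) as [Ha|Ha].
  + eapply Rle_trans; [apply (Hkf a)|now apply HM].
  + unfold u0. rewrite (proj2 (proj2 (Htr a)) Ha x), Rabs_R0. exact HM0.
- intros a x y. pose proof (om_pos nu' (Rabs (x - y))) as Ho. destruct (Nat.lt_ge_cases a d) as [Ha|Ha].
  + eapply Rle_trans; [apply (Hkf a)|]. apply Rmult_le_compat_r; [exact Ho|now apply HM].
  + unfold u0. rewrite !(proj2 (proj2 (Htr a)) Ha). nra.
Qed.
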